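(* Let $(M,\omega,\mathbb{T})$ be a compact symplectic toric manifold of real dimension $4$. Let $J\in DGK_\omega^{\mathbb{T}}(M)$ and $\mathring J\in DGK_\omega^{\mathbb{T}}(\mathring M)$ be given with respect to admissible coordinates $(\mu^j,t^j)$ on $\mathring M$ by $$J=\sum_{i,j=1}^2\Psi_{ij}\frac{\partial}{\partial t^i}\otimes d\mu^j-\sum_{i,j=1}^2(\Psi^{-1})_{ij}\frac{\partial}{\partial\mu^i}\otimes dt^j,\qquad \mathring J=\sum_{i,j=1}^2\mathring\Psi_{ij}\frac{\partial}{\partial t^i}\otimes d\mu^j-\sum_{i,j=1}^2(\mathring\Psi^{-1})_{ij}\frac{\partial}{\partial\mu^i}\otimes dt^j.$$ If (C1) $\mathring\Psi-\Psi$ admits a smooth extension to $\Delta$, and (C2) $\Psi^T\mathring\Psi^{-1}\Psi-\Psi^T$ admits a smooth extension to $\Delta$, then $\mathring J$ is the restriction to $\mathring M$ of an element of $DGK_\omega^{\mathbb{T}}(M)$.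
   Context: Toric setting. $M$ is compact connected, $\mathbb{T}$ is a 2-torus with Lie algebra $\mathfrak{t}$ acting effectively and in a hamiltonian fashion on $(M,\omega)$ with moment map $\mu:M\to\mathfrak{t}^*$; $\Delta=\mu(M)$ is the moment polytope, $\mathring\Delta$ its interior, $\mathring M=\mu^{-1}(\mathring\Delta)$. A basis $(\xi_1,\xi_2)$ of $\mathfrak{t}$ is fixed; $K_j=\xi_j^\sharp$ is the induced vector field, $\mu^j=\langle\mu,\xi_j\rangle$, $\omega(K_j,\cdot)=-d\mu^j$. A function on $\Delta$ is smooth if it is the restriction of a smooth function on $\mathfrak{t}^*$; $\mathbb{T}$-invariant smooth functions on $M$ (resp. $\mathring M$) are identified with smooth functions on $\Delta$ (resp. $\mathring\Delta$); $\Psi,\mathring\Psi$ are regarded as functions on $\mathring\Delta$. Structures (with $N=M$ or $\mathring M$). $J$ is $\omega$-tamed if $\omega(X,JX)>0$ for $X\ne0$; $J^{*_\omega}$ is defined by $\omega(JX,Y)=\omega(X,J^{*_\omega}Y)$. Generalized Kähler structures of symplectic type are identified with $\omega$-tamed almost complex structures $J$ such that both $J$ and $J^{*_\omega}$ are integrable; $GK_\omega^{\mathbb{T}}(N)$ is the set of $\mathbb{T}$-invariant ones on $N$. With $\mathcal{K}$ the distribution on $\mathring M$ spanned by the $K_j$, $DGK_\omega^{\mathbb{T}}(N)=\{J\in GK_\omega^{\mathbb{T}}(N):J^{*_\omega}\mathcal{K}=J\mathcal{K}\text{ on }\mathring M\}$. Admissible coordinates are coordinates $(\mu^j,t^j)$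 on $\mathring M$ induced by some $J_1\in DGK_\omega^{\mathbb{T}}(M)$: around each point of $\mathring M$ there are local $J_1$-holomorphic coordinates $u^j+it^j$ with $\partial/\partial u^j=-J_1K_j$, $\partial/\partial t^j=K_j$, and one replaces the $u^j$ by the $\mu^j$. In such coordinates $\omega=\sum_jd\mu^j\wedge dt^j$, and the coordinate fields and forms $d\mu^j,dt^j$ are globally defined on $\mathring M$. *)

(* Defs.v *)
From HB Require Import structures.
From mathcomp Require Import all_boot all_order all_algebra.
From mathcomp Require Import all_classical all_reals all_analysis.

Set Implicit Arguments.
Unset Strict Implicit.
Unset Printing Implicit Defensive.

Import Order.TTheory GRing.Theory Num.Theory.
Import numFieldNormedType.Exports.

Local Open Scope classical_set_scope.
Local Open Scope ring_scope.

(** * Smooth maps between open sets of coordinate spaces *)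

(* The set [U] is meant to be open: derivatives are taken in the whole space. *)
Fixpoint Ck_on (k : nat) (R : realType) (n : nat) (V : normedModType R)
    (U : set 'rV[R]_n) (f : 'rV[R]_n -> V) : Prop :=
  (forall x, U x -> continuous_at x f) /\
  match k with
  | 0%N => True
  | k'.+1 => forall a : 'I_n,
      (forall x, U x -> derivable f x (delta_mx 0 a)) /\
      Ck_on k' U (fun x => 'D_(delta_mx 0 a) f x : V)
  end.

Definition smooth_on (R : realType) (n : nat) (V : normedModType R)
    (U : set 'rV[R]_n) (f : 'rV[R]_n -> V) : Prop :=
  forall k, Ck_on k U f.

(** * Manifolds *)

(* [crd] and [par] are total functions, meaningful only on [dom] and on
   [crd @` dom] respectively. *)
Record chart (R : realType) (M : topologicalType) (n : nat) := Chart {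
  dom : set M;
  crd : M -> 'rV[R]_n;
  par : 'rV[R]_n -> M;
  dom_open : open dom;
  img_open : open (crd @` dom);
  crdK : forall p, dom p -> par (crd p) = p;
  crd_continuous : forall p, dom p -> continuous_at p crd;
  par_continuous : forall x, (crd @` dom) x -> continuous_at x par }.

Definition smooth_transition (R : realType) (M : topologicalType) (n : nat)
    (c d : chart R M n) : Prop :=
  smooth_on (crd c @` (dom c `&` dom d)) (crd d \o par c).

Record atlas (R : realType) (M : topologicalType) (n : nat) := Atlas {
  idx : Type;
  cht :> idx -> chart R M n;
  cht_cover : forall p, exists i, dom (cht i) p;
  cht_transition : forall i j, smooth_transition (cht i) (cht j) }.

(* A chart of the differentiable structure, not necessarily listed in [A]. *)
Definition local_coordinates (R : realType) (M : topologicalType) (n : nat)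
    (A : atlas R M n) (c : chart R M n) : Prop :=
  forall i, smooth_transition (A i) c /\ smooth_transition c (A i).

(* Tangent vectors are row vectors of components.  [tmap c d F p v] is
   [dF_p(v)], where [v] has components in [c] and the result in [d]. *)
Definition tmap (R : realType) (M : topologicalType) (n : nat)
    (c d : chart R M n) (F : M -> M) (p : M) (v : 'rV[R]_n) : 'rV[R]_n :=
  'D_v (crd d \o F \o par c) (crd c p).

Definition change (R : realType) (M : topologicalType) (n : nat)
    (c d : chart R M n) (p : M) (v : 'rV[R]_n) : 'rV[R]_n :=
  tmap c d id p v.

Definition dfun (R : realType) (M : topologicalType) (n : nat)
    (c : chart R M n) (f : M -> R) (p : M) (v : 'rV[R]_n) : R :=
  'D_v (f \o par c) (crd c p).

(* The components, in [d], of the [a]-th coordinate field of [c]. *)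
Definition coord_field (R : realType) (M : topologicalType) (n : nat)
    (c d : chart R M n) (a : 'I_n) (p : M) : 'rV[R]_n :=
  change c d p (delta_mx 0 a).

(* The differential of the [a]-th coordinate of [c] at a vector [v] which has
   components in [d]. *)
Definition coord_form (R : realType) (M : topologicalType) (n : nat)
    (c d : chart R M n) (a : 'I_n) (p : M) (v : 'rV[R]_n) : R :=
  dfun d (fun q => crd c q 0 a) p v.

(* A tensor field is given by its components in every chart of the atlas;
   [T i p] is meaningful for [p] in the domain of the [i]-th chart. *)
Definition components (R : realType) (M : topologicalType) (n : nat)
    (A : atlas R M n) (V : Type) := idx A -> M -> V.

Definition smooth_components (R : realType) (M : topologicalType) (n : nat)
    (A : atlas R M n) (V : normedModType R) (O : set M)
    (T : components A V) : Prop :=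
  forall i, smooth_on (crd (A i) @` (dom (A i) `&` O)) (T i \o par (A i)).

Definition smooth_function (R : realType) (M : topologicalType) (n : nat)
    (A : atlas R M n) (V : normedModType R) (O : set M) (f : M -> V) : Prop :=
  smooth_components (A := A) O (fun=> f).

Definition vector_field (R : realType) (M : topologicalType) (n : nat)
    (A : atlas R M n) (O : set M) (X : components A 'rV[R]_n) : Prop :=
  (forall i j p, O p -> dom (A i) p -> dom (A j) p ->
     X j p = change (A i) (A j) p (X i p)) /\
  smooth_components O X.

(* Endomorphisms of the tangent bundle act on row vectors by
   [J(v) = v *m J i p]. *)
Definition endo_field (R : realType) (M : topologicalType) (n : nat)
    (A : atlas R M n) (O : set M) (J : components A 'M[R]_n) : Prop :=
  (forall i j p v, O p -> dom (A i) p -> dom (A j) p ->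
     change (A i) (A j) p (v *m J i p) = change (A i) (A j) p v *m J j p) /\
  smooth_components O J.

Definition endo_apply (R : realType) (M : topologicalType) (n : nat)
    (A : atlas R M n) (J : components A 'M[R]_n) (X : components A 'rV[R]_n)
    : components A 'rV[R]_n :=
  fun i p => X i p *m J i p.

(* [B(u, v)] for the bilinear form of matrix [B]. *)
Definition bil (R : realType) (n : nat) (B : 'M[R]_n) (u v : 'rV[R]_n) : R :=
  (u *m B *m v^T) 0 0.

Definition bilinear_field (R : realType) (M : topologicalType) (n : nat)
    (A : atlas R M n) (w : components A 'M[R]_n) : Prop :=
  (forall i j p u v, dom (A i) p -> dom (A j) p ->
     bil (w j p) (change (A i) (A j) p u) (change (A i) (A j) p v)
       = bil (w i p) u v) /\
  smooth_components setT w.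

Definition lie_bracket (R : realType) (M : topologicalType) (n : nat)
    (A : atlas R M n) (X Y : components A 'rV[R]_n)
    : components A 'rV[R]_n :=
  fun i p => 'D_(X i p) (Y i \o par (A i)) (crd (A i) p)
           - 'D_(Y i p) (X i \o par (A i)) (crd (A i) p).

(* Vanishing of the Nijenhuis tensor. *)
Definition integrable_endo (R : realType) (M : topologicalType) (n : nat)
    (A : atlas R M n) (N : set M) (J : components A 'M[R]_n) : Prop :=
  forall (O : set M) (X Y : components A 'rV[R]_n),
    open O -> O `<=` N -> vector_field O X -> vector_field O Y ->
    forall i p, O p -> dom (A i) p ->
      lie_bracket (endo_apply J X) (endo_apply J Y) i p
      - lie_bracket (endo_apply J X) Y i p *m J i p
      - lie_bracket X (endo_apply J Y) i p *m J i p
      - lie_bracket X Y i p = 0.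

(** * Symplectic forms *)

Definition closed_2form (R : realType) (M : topologicalType) (n : nat)
    (A : atlas R M n) (w : components A 'M[R]_n) : Prop :=
  forall i p (a b c : 'I_n), dom (A i) p ->
    let pd (e f g : 'I_n) :=
      'D_(delta_mx 0 e) (fun x => w i (par (A i) x) f g) (crd (A i) p) in
    pd a b c + pd b c a + pd c a b = 0.

Definition symplectic_form (R : realType) (M : topologicalType) (n : nat)
    (A : atlas R M n) (w : components A 'M[R]_n) : Prop :=
  [/\ bilinear_field w,
      (forall i p, dom (A i) p -> (w i p)^T = - w i p),
      (forall i p, dom (A i) p -> w i p \in unitmx) &
      closed_2form w].

(* [J^{*w}]; see [w_adjointP]. *)
Definition w_adjoint (R : realType) (M : topologicalType) (n : nat)
    (A : atlas R M n) (w J : components A 'M[R]_n) : components A 'M[R]_n :=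
  fun i p => (invmx (w i p) *m J i p *m w i p)^T.

Lemma w_adjointP (R : realType) (M : topologicalType) (n : nat)
    (A : atlas R M n) (w J : components A 'M[R]_n) i p (S : 'M[R]_n) :
  w i p \in unitmx ->
  (forall u v, bil (w i p) (u *m J i p) v = bil (w i p) u (v *m S)) <->
  S = w_adjoint w J i p.
Proof.
move=> wU; split=> [h|-> u v]; last first.
  by rewrite /bil /w_adjoint [(v *m _)^T]trmx_mul trmxK !mulmxA mulmxK.
have JW : J i p *m w i p = w i p *m S^T.
  apply/matrixP => a b.
  have := h (delta_mx 0 a) (delta_mx 0 b).
  rewrite /bil trmx_mul !mulmxA !trmx_delta -!rowE -!colE !mxE.
  under eq_bigr do rewrite mxE.
  by move=> ->; apply: eq_bigr => j _; rewrite mxE.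
by rewrite /w_adjoint -mulmxA JW mulKmx // trmxK.
Qed.

(** * Toric 4-manifolds *)

(* The torus is [R^2 / Z^2], with Lie algebra [t = R^2] and dual [t^* = R^2].
   It acts through the exponential map: [rho s] is the action of [exp s]. *)
Definition integral_vector (R : realType) (s : 'rV[R]_2) : Prop :=
  exists z : 'rV[int]_2, s = map_mx intr z.

Definition smooth_action (R : realType) (M : topologicalType)
    (A : atlas R M 4) (rho : 'rV[R]_2 -> M -> M) : Prop :=
  [/\ forall p, rho 0 p = p,
      forall s t p, rho (s + t) p = rho s (rho t p),
      continuous (fun z : ('rV[R]_2 * M)%type => rho z.1 z.2) &
      forall i j,
        smooth_on
          [set z : 'rV[R]_(2 + 4) | (crd (A i) @` dom (A i)) (rsubmx z) /\
             dom (A j) (rho (lsubmx z) (par (A i) (rsubmx z)))]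
          (fun z => crd (A j) (rho (lsubmx z) (par (A i) (rsubmx z))))].

(* The kernel contains [Z^2] for an action of the torus, and is not larger for
   an effective one. *)
Definition effective_torus_action (R : realType) (M : topologicalType)
    (A : atlas R M 4) (rho : 'rV[R]_2 -> M -> M) : Prop :=
  smooth_action A rho /\
  forall s, (forall p, rho s p = p) <-> integral_vector s.

(* The induced vector field [s^sharp], for [s] in [t]. *)
Definition induced_field (R : realType) (M : topologicalType)
    (A : atlas R M 4) (rho : 'rV[R]_2 -> M -> M) (s : 'rV[R]_2)
    : components A 'rV[R]_4 :=
  fun i p => derive1 (fun h : R => crd (A i) (rho (h *: s) p)) 0.

Definition pairing (R : realType) (m s : 'rV[R]_2) : R := (m *m s^T) 0 0.

Definition invariant_form (R : realType) (M : topologicalType)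
    (A : atlas R M 4) (rho : 'rV[R]_2 -> M -> M)
    (w : components A 'M[R]_4) : Prop :=
  forall s i j p u v, dom (A i) p -> dom (A j) (rho s p) ->
    bil (w j (rho s p)) (tmap (A i) (A j) (rho s) p u)
                        (tmap (A i) (A j) (rho s) p v) = bil (w i p) u v.

Definition moment_map (R : realType) (M : topologicalType) (A : atlas R M 4)
    (w : components A 'M[R]_4) (rho : 'rV[R]_2 -> M -> M)
    (mu : M -> 'rV[R]_2) : Prop :=
  [/\ smooth_function A setT mu,
      forall s p, mu (rho s p) = mu p &
      forall s i p v, dom (A i) p ->
        bil (w i p) (induced_field rho s i p) v
          = - dfun (A i) (fun q => pairing (mu q) s) p v].

Definition symplectic_toric (R : realType) (M : topologicalType)
    (A : atlas R M 4) (w : components A 'M[R]_4)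
    (rho : 'rV[R]_2 -> M -> M) (mu : M -> 'rV[R]_2) : Prop :=
  [/\ compact [set: M], connected [set: M] & hausdorff_space M] /\
  [/\ symplectic_form w, effective_torus_action A rho,
      invariant_form rho w & moment_map w rho mu].

Definition moment_polytope (R : realType) (M : topologicalType)
    (mu : M -> 'rV[R]_2) : set 'rV[R]_2 := mu @` [set: M].

Definition Mring (R : realType) (M : topologicalType)
    (mu : M -> 'rV[R]_2) : set M := mu @^-1` interior (moment_polytope mu).

(** * Generalized Kähler structures of symplectic type *)

Definition almost_complex (R : realType) (M : topologicalType)
    (A : atlas R M 4) (N : set M) (J : components A 'M[R]_4) : Prop :=
  endo_field N J /\
  forall i p, N p -> dom (A i) p -> J i p *m J i p = - 1%:M.

Definition tamed (R : realType) (M : topologicalType) (A : atlas R M 4)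
    (w : components A 'M[R]_4) (N : set M) (J : components A 'M[R]_4) : Prop :=
  forall i p v, N p -> dom (A i) p -> v != 0 -> 0 < bil (w i p) v (v *m J i p).

Definition invariant_endo (R : realType) (M : topologicalType)
    (A : atlas R M 4) (rho : 'rV[R]_2 -> M -> M) (N : set M)
    (J : components A 'M[R]_4) : Prop :=
  forall s i j p v, N p -> N (rho s p) ->
    dom (A i) p -> dom (A j) (rho s p) ->
    tmap (A i) (A j) (rho s) p (v *m J i p)
      = tmap (A i) (A j) (rho s) p v *m J j (rho s p).

Definition GK (R : realType) (M : topologicalType) (A : atlas R M 4)
    (w : components A 'M[R]_4) (rho : 'rV[R]_2 -> M -> M) (N : set M)
    (J : components A 'M[R]_4) : Prop :=
  [/\ almost_complex N J, tamed w N J, integrable_endo N J,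
      integrable_endo N (w_adjoint w J) & invariant_endo rho N J].

(* In the sequel the rows of [xi] are the chosen basis of [t]. *)

Definition Kfield (R : realType) (M : topologicalType) (A : atlas R M 4)
    (rho : 'rV[R]_2 -> M -> M) (xi : 'M[R]_2) (j : 'I_2)
    : components A 'rV[R]_4 :=
  induced_field rho (row j xi).

(* The distribution spanned by the [K_j], as a row space. *)
Definition Kdist (R : realType) (M : topologicalType) (A : atlas R M 4)
    (rho : 'rV[R]_2 -> M -> M) (xi : 'M[R]_2) (i : idx A) (p : M)
    : 'M[R]_(2, 4) :=
  \matrix_(j < 2) Kfield rho xi j i p.

Definition DGK (R : realType) (M : topologicalType) (A : atlas R M 4)
    (w : components A 'M[R]_4) (rho : 'rV[R]_2 -> M -> M)
    (mu : M -> 'rV[R]_2) (xi : 'M[R]_2) (N : set M)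
    (J : components A 'M[R]_4) : Prop :=
  GK w rho N J /\
  forall i p, Mring mu p -> dom (A i) p ->
    (Kdist rho xi i p *m w_adjoint w J i p == Kdist rho xi i p *m J i p)%MS.

(** * Admissible coordinates *)

(* Coordinates of a 4-dimensional chart come in two pairs:
   [(u^1, u^2, t^1, t^2)] or [(mu^1, mu^2, t^1, t^2)]. *)
Definition fst2 (j : 'I_2) : 'I_4 := @lshift 2 2 j.
Definition snd2 (j : 'I_2) : 'I_4 := @rshift 2 2 j.

(* Local [J1]-holomorphic coordinates [u^j + i t^j]. *)
Definition holomorphic_ut (R : realType) (M : topologicalType)
    (A : atlas R M 4) (rho : 'rV[R]_2 -> M -> M) (xi : 'M[R]_2)
    (J1 : components A 'M[R]_4) (c : chart R M 4) : Prop :=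
  local_coordinates A c /\
  forall i p (j : 'I_2), dom c p -> dom (A i) p ->
    [/\ coord_field c (A i) (fst2 j) p *m J1 i p
          = coord_field c (A i) (snd2 j) p,
        coord_field c (A i) (fst2 j) p = - (Kfield rho xi j i p *m J1 i p) &
        coord_field c (A i) (snd2 j) p = Kfield rho xi j i p].

(* [c] is obtained from such coordinates on its domain by replacing each [u^j]
   by [mu^j]. *)
Definition admissible_chart (R : realType) (M : topologicalType)
    (A : atlas R M 4) (rho : 'rV[R]_2 -> M -> M) (mu : M -> 'rV[R]_2)
    (xi : 'M[R]_2) (J1 : components A 'M[R]_4) (c : chart R M 4) : Prop :=
  [/\ local_coordinates A c, dom c `<=` Mring mu,
      forall p (j : 'I_2), dom c p ->
        crd c p 0 (fst2 j) = pairing (mu p) (row j xi) &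
      exists c0 : chart R M 4,
        [/\ holomorphic_ut rho xi J1 c0, dom c0 = dom c &
            forall p (j : 'I_2), dom c p ->
              crd c p 0 (snd2 j) = crd c0 p 0 (snd2 j)]].

(* Admissible coordinates on the open part of [M] are given by a family [C] of
   charts, all induced by one [J1], whose domains cover it.  The functions
   [t^j] are only local, but their differentials and the coordinate fields do
   not depend on the chart in [C]. *)
Definition admissible_coordinates (R : realType) (M : topologicalType)
    (A : atlas R M 4) (w : components A 'M[R]_4) (rho : 'rV[R]_2 -> M -> M)
    (mu : M -> 'rV[R]_2) (xi : 'M[R]_2) (C : set (chart R M 4)) : Prop :=
  exists J1 : components A 'M[R]_4,
    [/\ DGK w rho mu xi setT J1,
        forall c, C c -> admissible_chart rho mu xi J1 c &
        forall p, Mring mu p -> exists2 c, C c & dom c p].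

(* [J = sum Psi_ab d/dt^a (x) dmu^b - sum (Psi^-1)_ab d/dmu^a (x) dt^b]. *)
Definition given_by (R : realType) (M : topologicalType) (A : atlas R M 4)
    (mu : M -> 'rV[R]_2) (C : set (chart R M 4)) (J : components A 'M[R]_4)
    (Psi : 'rV[R]_2 -> 'M[R]_2) : Prop :=
  forall c, C c -> forall i p v, dom c p -> dom (A i) p ->
    Psi (mu p) \in unitmx /\
    v *m J i p =
      \sum_(a < 2) \sum_(b < 2)
         (Psi (mu p) a b * coord_form c (A i) (fst2 b) p v)
           *: coord_field c (A i) (snd2 a) p
      - \sum_(a < 2) \sum_(b < 2)
         (invmx (Psi (mu p)) a b * coord_form c (A i) (snd2 b) p v)
           *: coord_field c (A i) (fst2 a) p.

(* [F] is relevant on the interior of the polytope [D] only; a smooth function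
   on [D] is the restriction of a smooth function on the whole space. *)
Definition extends_smoothly (R : realType) (D : set 'rV[R]_2)
    (F : 'rV[R]_2 -> 'M[R]_2) : Prop :=
  exists G : 'rV[R]_2 -> 'M[R]_2,
    smooth_on setT G /\ forall x, interior D x -> G x = F x.

(* Main.v *)
(* On the open part of [M] let [K_j] be the torus fields, [adj J] the [w]-adjoint
   of [J], and [d mu^k o J] the composition of a form with [J].  There
     [J0 = J + sum (Psi0 - Psi)_jk K_j (x) d mu^k
             + sum (Psi^T Psi0^-1 Psi - Psi^T)_jk (adj J)K_j (x) (d mu^k o J)],
   and by C1 and C2 the right-hand side is smooth on [M]; call it [J'].

   The open part is dense: at a point where the [K_j] are dependent, a line of
   the Lie algebra fixes the point, hence so does one of the three elements of
   order 2 of the torus, and an involution of the action that fixes an open set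
   is the identity.  So every closed condition on [J'] follows by continuity.

   Only tameness on the boundary is an open condition.  By continuity
   [w(v, J'v) >= 0], so it is enough that [J' - adj J'] is invertible.  On the
   open part its square is [-4 (1 - h0)], where [h0 = a0^2 / det Psi0] and [a0] is
   the antisymmetric part of [Psi0].  Let [a] and [h] be the same data for [Psi],
   and [D = 1 / det Psi].  The functions [D], [h] and [a D] are smooth on [M], and
   [D = 0] on the boundary because the [K_j] are dependent there.  Integrability
   of [J] and [adj J] makes [a] locally constant, so [D / h = 1 / a^2] is locally
   constant where [h <> 0]; since [D] does not vanish on a dense set, this forces
   [h = 0] on the boundary.  As [a0 - a] and [det Psi / det Psi0] extend
   continuously, [h0 = 0] on the boundary too. *)
Require Import Defs.
From mathcomp Require Import all_boot all_order all_algebra.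
From mathcomp Require Import all_classical all_reals all_analysis.
Import numFieldNormedType.Exports.
From mathcomp Require Import ring lra zify.

Set Implicit Arguments.
Unset Strict Implicit.
Unset Printing Implicit Defensive.
Import Order.TTheory GRing.Theory Num.Theory.
Local Open Scope classical_set_scope.
Local Open Scope ring_scope.

(** * Calculus in coordinate spaces *)

(** Origin of C2: on the open part [d mu o J] is a combination of the [dt] and [(adj J) K] one of
    the [d/dmu], both with coefficients from [Psi^-1]. Pulling these factors out of
    [Psi0^-1 - Psi^-1] leaves the matrix of C2. As [Psi] is not symmetric, [J] on one side and
    [adj J] on the other produce the pair [Psi^T], [Psi]. The block form of [adj J] requires
    [w = sum d mu /\ dt] in the coordinates; the missing isotropy of the [d/dmu] comes from the
    condition on [adj J] in [DGK]. Obstacle at the boundary: [a] is locally constant on the open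
    part only, and no connectedness of that part near a boundary point is available, so nothing
    bounds [a] there. Hence the ratio [D / h], which is C1 across the boundary wherever [h <> 0]. To
    make sense on all of [M], the data are built without a frame: [Q = - d mu (J K)] extends the
    transpose of [Psi^-1], [D = det Q], [a D] is the antisymmetric part of [Q], and [h] comes from
    the trace of [J] times [adj J]. *)

Lemma derive_shift_scale (R : realType) (V W : normedModType R) (f : V -> W)
    (x v : V) (t : R) :
  derivable f (x + t *: v) v ->
  is_derive t (1 : R) (fun s : R => f (x + s *: v)) ('D_v f (x + t *: v)).
Proof.
move=> df.
have E : (fun h : R => h^-1 *: (((fun s : R => f (x + s *: v)) \o shift t) (h *: (1 : R))
     - f (x + t *: v))) = (fun h : R => h^-1 *: ((f \o shift (x + t *: v)) (h *: v)
     - f (x + t *: v))).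
  apply/funext => h /=; congr (_ *: (f _ - _)).
  by rewrite [h *: 1]mulr1 scalerDl addrCA addrC.
split; last by rewrite /derive E.
by rewrite /derivable E.
Qed.

(** The two conditions on [t] say that [t] lies between 0 and [d] for either sign of [d], so that a
    path may also run backwards. *)
Lemma line_MVT (R : realType) (V : normedModType R) (f : V -> R)
    (x v : V) (d : R) :
  (forall t, 0 <= t * d -> `|t| <= `|d| -> derivable f (x + t *: v) v) ->
  exists2 t, 0 <= t * d /\ `|t| <= `|d| & f (x + d *: v) - f x = d * 'D_v f (x + t *: v).
Proof.
move=> df.
pose g (s : R) := f (x + s *: v).
have dg t : 0 <= t * d /\ `|t| <= `|d| -> is_derive t (1 : R) g ('D_v f (x + t *: v)).
  by move=> -[td /(df _ td)]; exact: derive_shift_scale.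
have gc (t : R) : 0 <= t * d /\ `|t| <= `|d| -> {for t, continuous g}.
  move=> /dg [dgt _]; apply: differentiable_continuous.
  exact/derivable1_diffP.
have g0 : f x = g 0 by rewrite /g scale0r addr0.
have [d0|d0] := leP 0 d.
  have B t : t \in `[0, d] -> 0 <= t * d /\ `|t| <= `|d|.
    by rewrite in_itv /= => /andP[t0 td]; rewrite !ger0_norm // mulr_ge0.
  have [||t /B tB E] := @MVT_segment R g (fun t => 'D_v f (x + t *: v)) 0 d d0.
  - by move=> t /subset_itv_oo_cc /B; exact: dg.
  - by apply: continuous_in_subspaceT => t; rewrite inE => /B; exact: gc.
  exists t => //.
  by rewrite g0 -/(g d) E subr0 mulrC.
have B t : t \in `[d, 0] -> 0 <= t * d /\ `|t| <= `|d|.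
  rewrite in_itv /= => /andP[t0 td]; rewrite !ler0_norm ?lerN2 ?(ltW d0) //.
  by rewrite mulr_le0 // ltW.
have [||t /B tB E] := @MVT_segment R g (fun t => 'D_v f (x + t *: v)) d 0 (ltW d0).
- by move=> t /subset_itv_oo_cc /B; exact: dg.
- by apply: continuous_in_subspaceT => t; rewrite inE => /B; exact: gc.
exists t => //.
by rewrite g0 -/(g d) -opprB E sub0r mulrN opprK mulrC.
Qed.

Lemma ler_row_norm (R : realType) m n (x : 'M[R]_(m, n)) i j : `|x i j| <= `|x|.
Proof.
by rewrite [leRHS]mx_normrE (le_bigmax _ (fun ij => `|x ij.1 ij.2|) (i, j)).
Qed.

Lemma row_norm_le (R : realType) m n (x : 'M[R]_(m, n)) (e : R) :
  0 <= e -> (forall i j, `|x i j| <= e) -> `|x| <= e.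
Proof.
by move=> e0 xe; rewrite [leLHS]mx_normrE; apply: bigmax_le => // -[i j] _.
Qed.

(* The path from [z] to [y] changes one coordinate at a time, so that it stays
   in the (cubic) ball and the mean value theorem applies on each edge. *)
Lemma strict_differentiability (R : realType) n (f : 'rV[R]_n -> R)
    (U : set 'rV[R]_n) (x0 : 'rV[R]_n) :
  open U -> U x0 ->
  (forall x a, U x -> derivable f x (delta_mx 0 a)) ->
  (forall a, continuous_at x0 (fun x => 'D_(delta_mx 0 a) f x)) ->
  forall e : R, 0 < e -> exists2 r : R, 0 < r &
    ball x0 r `<=` U /\ forall y z, ball x0 r y -> ball x0 r z ->
    `|f y - f z - \sum_a (y - z) 0 a * 'D_(delta_mx 0 a) f x0| <= e * `|y - z|.
Proof.
move=> oU Ux0 df cf e e0.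
(* The error is shared among the [n] edges; [n.+1] keeps [e'] meaningful in dimension 0. *)
pose e' := e / n.+1%:R.
have e'0 : 0 < e' by rewrite divr_gt0 // ltr0n.
have : \forall x \near x0, U x /\ forall a : 'I_n,
    `|'D_(delta_mx 0 a) f x - 'D_(delta_mx 0 a) f x0| <= e'.
  apply: filterI; first exact: open_nbhs_nbhs.
  apply: (@filter_forall _ _ (fun (a : 'I_n) x =>
    `|'D_(delta_mx 0 a) f x - 'D_(delta_mx 0 a) f x0| <= e') (nbhs x0) _) => a.
  have /cvgrPdist_le /(_ _ e'0) := cf a.
  by apply: filterS => x; rewrite distrC.
move=> /nbhs_ballP[r r0 B].
exists r => //; split; first by move=> x /B [].
move=> y z yr zr.
pose p (k : nat) : 'rV[R]_n := \row_a (if (a < k)%N then y 0 a else z 0 a).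
have p0 : p 0%N = z by apply/rowP => a; rewrite mxE ltn0.
have pn : p n = y by apply/rowP => a; rewrite mxE ltn_ord.
have step (k : 'I_n) : p k.+1 = p k + (y - z) 0 k *: delta_mx 0 k.
  apply/rowP => a; rewrite !mxE eqxx /= ltnS leq_eqVlt.
  have [->|ak] := eqVneq a k; first by rewrite eqxx ltnn mulr1 addrC subrK.
  by rewrite -[(a : nat) == k]/(a == k) (negbTE ak) mulr0 addr0.
have -> : f y - f z = \sum_(k < n) (f (p k.+1) - f (p k)).
  by rewrite -(big_mkord xpredT (fun k => f (p k.+1) - f (p k))) telescope_sumr // p0 pn.
rewrite -sumrB (le_trans (ler_norm_sum _ _ _)) //.
have -> : e * `|y - z| = n.+1%:R * (e' * `|y - z|).
  by rewrite /e' mulrA mulrCA mulfV ?pnatr_eq0 // mulr1.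
have : \sum_(k < n) `|f (p k.+1) - f (p k) - (y - z) 0 k * 'D_(delta_mx 0 k) f x0|
   <= \sum_(k < n) (e' * `|y - z|).
  apply: ler_sum => k _; rewrite step.
  have inB t : 0 <= t * (y - z) 0 k -> `|t| <= `|(y - z) 0 k| ->
      ball x0 r (p k + t *: delta_mx 0 k).
    move=> td tl; split=> // i b; rewrite (ord1 i) {i}.
    have := yr.2 0 b; have := zr.2 0 b.
    rewrite /ball /= !mxE eqxx /= mulr_natr => zb yb.
    have [bk|bk] := eqVneq b k; last first.
      by rewrite mulr0n addr0; case: ifP.
    subst b; rewrite ltnn mulr1n.
    move: td tl; rewrite !mxE => td tl.
    have [d0|d0] := leP 0 (y 0 k - z 0 k).
      have t0 : 0 <= t.
        move: d0; rewrite le_eqVlt => /predU1P[d0|d0].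
          by move: tl; rewrite -d0 normr0 normr_le0 => /eqP->.
        by move: td; rewrite pmulr_lge0.
      move: tl; rewrite (ger0_norm t0) (ger0_norm d0) => tl.
      move: yb zb; rewrite !ltr_distl => /andP[y1 y2] /andP[z1 z2].
      by apply/andP; split; lra.
    have t0 : t <= 0 by move: td; rewrite nmulr_lge0.
    move: tl; rewrite (ler0_norm t0) (ler0_norm (ltW d0)) => tl.
    move: yb zb; rewrite !ltr_distl => /andP[y1 y2] /andP[z1 z2].
    by apply/andP; split; lra.
  have [|t [td tl] ->] := @line_MVT R _ f (p k) (delta_mx 0 k) ((y - z) 0 k).
    by move=> t td tl; apply: df; apply: (B _ (inB _ td tl)).1.
  rewrite -mulrBr normrM mulrC ler_pM //; last exact: ler_row_norm.
  exact: (B _ (inB _ td tl)).2.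
move=> /le_trans; apply.
rewrite sumr_const card_ord -[leLHS]mulr_natl ler_wpM2r ?ler_nat //.
by rewrite mulr_ge0 // ltW.
Qed.

(** The hypothesis makes the zero map the differential. It serves for the remainder after a linear
    part is removed, and for the difference of two functions that agree near a point. *)
Lemma differentiable_flat (R : realType) (V W : normedModType R) (g : V -> W) x0 :
  (forall e : R, 0 < e -> \forall x \near x0, `|g x - g x0| <= e * `|x - x0|) ->
  differentiable g x0.
Proof.
move=> H.
have H0 : g \o shift x0 = cst (g x0) + (\0 : {linear V -> W}) +o_ 0 id.
  apply/eqaddoP => e e0.
  have := H e e0; rewrite (near_shift 0 x0) /= subr0.
  apply: filterS => y /=.
  rewrite /shift /= addrK.
  by rewrite !fctE /= addr0.
have c0 : continuous (\0 : {linear V -> W}) by move=> ?; exact: cvg_cst.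
apply/diff_locallyP; rewrite (diff_unique c0 H0).
by split.
Qed.

Lemma differentiable_linear_form (R : realType) n (c : 'I_n -> R) (x : 'rV[R]_n) :
  differentiable (fun y : 'rV[R]_n => \sum_a y 0 a * c a) x.
Proof.
have -> : (fun y : 'rV[R]_n => \sum_a y 0 a * c a)
        = \sum_(a < n) (fun y : 'rV[R]_n => c a * y 0 a).
  apply/funext => y; rewrite fct_sumE.
  by apply: eq_bigr => a _; rewrite mulrC.
apply: differentiable_sum => a.
exact/differentiableZ/differentiable_coord.
Qed.

(** By strict differentiability, [f] minus the linear form of its partial derivatives is flat at
    [x0]. *)
Lemma C1_differentiable_scalar (R : realType) n (f : 'rV[R]_n -> R)
    (U : set 'rV[R]_n) (x0 : 'rV[R]_n) :
  open U -> U x0 -> Ck_on 1 U f -> differentiable f x0.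
Proof.
move=> oU Ux0 [fc f1].
pose L (y : 'rV[R]_n) := \sum_a y 0 a * 'D_(delta_mx 0 a) f x0.
have -> : f = (fun y => f y - L y) + L by apply/funext => y; rewrite !fctE subrK.
apply: differentiableD; last exact: differentiable_linear_form.
apply: differentiable_flat => e e0.
have [] := @strict_differentiability R n f U x0 oU Ux0 _ _ e e0.
- by move=> x a; case: (f1 a) => /(_ x).
- by move=> a; case: (f1 a) => _ [+ _]; apply.
move=> r r0 [_ rB]; near=> y.
have -> : f y - L y - (f x0 - L x0) = f y - f x0 - (L y - L x0).
  by rewrite !opprB addrACA [- L y + _]addrC addrACA.
rewrite -sumrB.
under eq_bigr do rewrite -mulrBl.
have := rB y x0 _ (ballxx _ r0).
have -> : \sum_a (y - x0) 0 a * 'D_(delta_mx 0 a) f x0 =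
  \sum_(i < n) (y 0 i - x0 0 i) * 'D_(delta_mx 0 i) f x0.
  by apply: eq_bigr => a _; rewrite !mxE.
apply; near: y; exact: nbhsx_ballx.
Unshelve. all: by end_near. Qed.

Lemma differentiable_mx (R : realType) (V : normedModType R) m k
    (f : V -> 'M[R]_(m, k)) x :
  (forall i j, differentiable (fun y => f y i j) x) -> differentiable f x.
Proof.
move=> df.
have -> : f = \sum_(i < m) \sum_(j < k) (fun y => f y i j *: delta_mx i j).
  apply/funext => y; rewrite fct_sumE {1}[f y]matrix_sum_delta.
  by apply: eq_bigr => i _; rewrite fct_sumE.
apply: differentiable_sum => i; apply: differentiable_sum => j.
exact: differentiableZl.
Qed.

Lemma differentiable_entry (R : realType) (V : normedModType R) m k
    (f : V -> 'M[R]_(m, k)) x i j :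
  differentiable f x -> differentiable (fun y => f y i j) x.
Proof.
move=> df; apply: (differentiable_comp (g := fun M : 'M[R]_(m, k) => M i j)) => //.
exact: differentiable_coord.
Qed.

Lemma continuous_entry (R : realType) (T : topologicalType) m k
    (f : T -> 'M[R]_(m, k)) x i j :
  continuous_at x f -> continuous_at x (fun y => f y i j).
Proof.
move=> cf; apply: (@continuous_comp _ _ _ f (fun M : 'M[R]_(m, k) => M i j)) => //.
exact: coord_continuous.
Qed.

Lemma continuous_mx (R : realType) (T : topologicalType) m k
    (f : T -> 'M[R]_(m, k)) x :
  (forall i j, continuous_at x (fun y => f y i j)) -> continuous_at x f.
Proof.
move=> cf; apply/cvgrPdist_le => e e0.
apply: (@filterS _ _ _ (fun y => forall i, forall j, `|f x i j - f y i j| <= e)).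
  by move=> y H; apply: row_norm_le (ltW e0) _ => i j; rewrite !mxE.
apply: (@filter_forall _ _ (fun i y => forall j, `|f x i j - f y i j| <= e)
  (nbhs x) _) => i.
apply: (@filter_forall _ _ (fun j y => `|f x i j - f y i j| <= e)
  (nbhs x) _) => j.
by have /cvgrPdist_le/(_ _ e0) := cf i j.
Qed.

(** * Stability of C^k maps under algebraic operations *)

Section CkAlgebra.
Variables (R : realType) (n : nat).
Implicit Types (U : set 'rV[R]_n) (k : nat).

Lemma near_open (T : topologicalType) (U : set T) (P : T -> Prop) x :
  open U -> U x -> (forall y, U y -> P y) -> \forall y \near x, P y.
Proof. by move=> oU Ux UP; apply: filterS UP _; apply: open_nbhs_nbhs. Qed.

Lemma continuous_at_near (T T' : topologicalType) (f g : T -> T') x :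
  (\forall y \near x, f y = g y) -> continuous_at x f -> continuous_at x g.
Proof.
move=> fg; rewrite /continuous_at -(nbhs_singleton fg) => fc.
by apply: cvg_trans fc; exact: near_eq_cvg.
Qed.

Lemma Ck_on_congr k (V : normedModType R) U (f g : 'rV[R]_n -> V) :
  open U -> (forall x, U x -> f x = g x) -> Ck_on k U f -> Ck_on k U g.
Proof.
elim: k f g => [|k IH] f g oU fg [fc].
  move=> _; split=> // x Ux; apply: continuous_at_near (fc x Ux).
  exact: near_open fg.
move=> fk; split=> [x Ux|a].
  by apply: continuous_at_near (fc x Ux); exact: near_open fg.
have [fd fk'] := fk a; split=> [x Ux|].
  by apply: near_eq_derivable (fd x Ux); exact: near_open fg.
apply: IH fk' => // x Ux; apply: near_eq_derive; exact: near_open fg.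
Qed.

Lemma Ck_on_sub k (V : normedModType R) U U' (f : 'rV[R]_n -> V) :
  U' `<=` U -> Ck_on k U f -> Ck_on k U' f.
Proof.
move=> UU'; elim: k f => [|k IH] f [fc fk]; split=> [x /UU' /fc //|] // a.
have [fd fk'] := fk a; split=> [x /UU' /fd//|]; exact: IH.
Qed.

Lemma Ck_onW k (V : normedModType R) U (f : 'rV[R]_n -> V) :
  Ck_on k.+1 U f -> Ck_on k U f.
Proof.
elim: k f => [|k IH] f [fc fk]; split=> //= a.
by have [fd fk'] := fk a; split=> //; apply: IH.
Qed.

Lemma Ck_on_mxP k m l U (f : 'rV[R]_n -> 'M[R]_(m, l)) : open U ->
  Ck_on k U f <-> forall i j, Ck_on k U (fun x => f x i j : R).
Proof.
move=> oU; elim: k f => [|k IH] f.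
  split=> [[fc _] i j|fc]; split=> // x Ux.
    exact/continuous_entry/fc.
  by apply: continuous_mx => i j; case: (fc i j) => /(_ x Ux).
split=> [[fc fk] i j|fk].
  split=> [x Ux|a]; first exact/continuous_entry/fc.
  have [fd fk'] := fk a; split=> [x Ux|].
    exact: (derivable_mxP _ _ _).1 (fd x Ux) i j.
  apply: Ck_on_congr ((IH _).1 fk' i j) => // x Ux.
  by rewrite (derive_mx (fd x Ux)) mxE.
split=> [x Ux|a].
  by apply: continuous_mx => i j; case: (fk i j) => /(_ x Ux).
have fd x : U x -> derivable f x (delta_mx 0 a).
  move=> Ux; apply/derivable_mxP => i j.
  by case: (fk i j) => _ /(_ a) [/(_ x Ux)].
split=> //; apply/IH => i j.
have [_ /(_ a) [_]] := fk i j.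
apply: Ck_on_congr => // x Ux.
by rewrite (derive_mx (fd x Ux)) mxE.
Qed.

Lemma Ck_on_cst k (V : normedModType R) U (c : V) : Ck_on k U (fun=> c).
Proof.
elim: k c => [|k IH] c; first by split=> // x _; exact: cst_continuous.
split=> [x _|a]; first exact: cst_continuous.
split=> [x _|]; first exact: derivable_cst.
rewrite (_ : (fun x => _) = fun=> (0 : V)); first exact: IH.
by apply/funext => x; exact: derive_cst.
Qed.

Lemma Ck_on_id k U : Ck_on k U (id : 'rV[R]_n -> 'rV[R]_n).
Proof.
case: k => [|k]; first by split=> // x _; exact: cvg_id.
split=> [x _|a]; first exact: cvg_id.
split=> [x _|]; first exact: derivable_id.
rewrite (_ : (fun x => _) = fun=> delta_mx 0 a); first exact: Ck_on_cst.
by apply/funext => x; rewrite derive_id.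
Qed.

Lemma Ck_on_add k (V : normedModType R) U (f g : 'rV[R]_n -> V) : open U ->
  Ck_on k U f -> Ck_on k U g -> Ck_on k U (fun x => f x + g x).
Proof.
move=> oU; elim: k f g => [|k IH] f g [fc fk] [gc gk].
  by split=> // x Ux; apply: continuousD; [exact: fc|exact: gc].
split=> [x Ux|a]; first by apply: continuousD; [exact: fc|exact: gc].
have [fd fk'] := fk a; have [gd gk'] := gk a.
split=> [x Ux|]; first by apply: derivableD; [exact: fd|exact: gd].
apply: Ck_on_congr (IH _ _ fk' gk') => // x Ux.
by rewrite -deriveD //; [exact: fd|exact: gd].
Qed.

Lemma Ck_on_sum k (V : normedModType R) U (I : Type) (r : seq I) (P : pred I)
    (f : I -> 'rV[R]_n -> V) : open U ->
  (forall i, Ck_on k U (f i)) -> Ck_on k U (fun x => \sum_(i <- r | P i) f i x).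
Proof.
move=> oU fk; elim: r => [|i r IH].
  under eq_fun do rewrite big_nil; exact: Ck_on_cst.
under eq_fun do rewrite big_cons.
by case: (P i) => //; apply: Ck_on_add.
Qed.

Lemma Ck_on_mul k U (f g : 'rV[R]_n -> R) : open U ->
  Ck_on k U f -> Ck_on k U g -> Ck_on k U (fun x => f x * g x).
Proof.
move=> oU; elim: k f g => [|k IH] f g F G; have [fc fk] := F; have [gc gk] := G.
  by split=> // x Ux; apply: continuousM; [exact: fc|exact: gc].
split=> [x Ux|a]; first by apply: continuousM; [exact: fc|exact: gc].
have [fd fk'] := fk a; have [gd gk'] := gk a.
split=> [x Ux|]; first by apply: derivableM; [exact: fd|exact: gd].
apply: (@Ck_on_congr k R U (fun x => f x * 'D_(delta_mx 0 a) g x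
   + g x * 'D_(delta_mx 0 a) f x)) => // [x Ux|].
  by symmetry; exact: (deriveM (fd x Ux) (gd x Ux)).
by apply: Ck_on_add => //; apply: IH => //; apply: Ck_onW.
Qed.

Lemma Ck_on_prod k U (I : Type) (r : seq I) (P : pred I)
    (f : I -> 'rV[R]_n -> R) : open U ->
  (forall i, Ck_on k U (f i)) -> Ck_on k U (fun x => \prod_(i <- r | P i) f i x).
Proof.
move=> oU fk; elim: r => [|i r IH].
  under eq_fun do rewrite big_nil; exact: Ck_on_cst.
under eq_fun do rewrite big_cons.
by case: (P i) => //; apply: Ck_on_mul.
Qed.

Lemma Ck_on_inv k U (f : 'rV[R]_n -> R) : open U -> (forall x, U x -> f x != 0) ->
  Ck_on k U f -> Ck_on k U (fun x => (f x)^-1).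
Proof.
move=> oU f0; elim: k f f0 => [|k IH] f f0 F; have [fc fk] := F.
  by split=> // x Ux; apply: continuousV; [exact: f0|exact: fc].
split=> [x Ux|a]; first by apply: continuousV; [exact: f0|exact: fc].
have [fd fk'] := fk a.
split=> [x Ux|]; first by apply: derivableV; [exact: f0|exact: fd].
apply: (@Ck_on_congr k R U (fun x => (-1) * ((f x)^-1 * (f x)^-1 *
   'D_(delta_mx 0 a) f x))) => // [x Ux|].
  rewrite mulN1r -mulNr -invfM -expr2.
  by symmetry; exact: (deriveV (f0 x Ux) (fd x Ux)).
have Fi := IH f f0 (Ck_onW F).
by do !apply: Ck_on_mul => //; exact: Ck_on_cst.
Qed.

Lemma Ck_on_mulmx k m l p U (f : 'rV[R]_n -> 'M[R]_(m, l)) (g : 'rV[R]_n -> 'M[R]_(l, p)) :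
  open U -> Ck_on k U f -> Ck_on k U g -> Ck_on k U (fun x => f x *m g x).
Proof.
move=> oU /(Ck_on_mxP _ _ oU) fk /(Ck_on_mxP _ _ oU) gk; apply/Ck_on_mxP => // i j.
under eq_fun do rewrite mxE.
by apply: Ck_on_sum => // a; apply: Ck_on_mul.
Qed.

Lemma Ck_on_trmx k m l U (f : 'rV[R]_n -> 'M[R]_(m, l)) :
  open U -> Ck_on k U f -> Ck_on k U (fun x => (f x)^T).
Proof.
move=> oU /(Ck_on_mxP _ _ oU) fk; apply/Ck_on_mxP => // i j.
by under eq_fun do rewrite mxE.
Qed.

Lemma Ck_on_opp k (V : normedModType R) U (f : 'rV[R]_n -> V) : open U ->
  Ck_on k U f -> Ck_on k U (fun x => - f x).
Proof.
move=> oU; elim: k f => [|k IH] f [fc fk].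
  by split=> // x Ux; apply: continuousN; exact: fc.
split=> [x Ux|a]; first by apply: continuousN; exact: fc.
have [fd fk'] := fk a.
split=> [x Ux|]; first by apply: derivableN; exact: fd.
apply: Ck_on_congr (IH _ fk') => // x Ux.
by rewrite -deriveN //; exact: fd.
Qed.

Lemma Ck_on_det k m U (f : 'rV[R]_n -> 'M[R]_m) :
  open U -> Ck_on k U f -> Ck_on k U (fun x => \det (f x)).
Proof.
move=> oU /(Ck_on_mxP _ _ oU) fk; apply: Ck_on_sum => // s.
apply: Ck_on_mul => //; first exact: Ck_on_cst.
by apply: Ck_on_prod => // i.
Qed.

Lemma Ck_on_invmx k m U (f : 'rV[R]_n -> 'M[R]_m) :
  open U -> (forall x, U x -> f x \in unitmx) ->
  Ck_on k U f -> Ck_on k U (fun x => invmx (f x)).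
Proof.
move=> oU fU fk; apply: (@Ck_on_congr k _ U (fun x => (\det (f x))^-1 *: \adj (f x))) => //.
  by move=> x Ux; rewrite /invmx fU.
apply/Ck_on_mxP => // i j; under eq_fun do rewrite mxE.
apply: Ck_on_mul => //.
  apply: Ck_on_inv => //; last exact: Ck_on_det.
  by move=> x /fU; rewrite unitmxE unitfE.
under eq_fun do rewrite mxE.
apply: Ck_on_mul => //; first exact: Ck_on_cst.
apply: Ck_on_det => //; apply/Ck_on_mxP => // a b.
under eq_fun do rewrite !mxE.
exact: (Ck_on_mxP _ _ oU).1.
Qed.

Lemma C1_differentiable U m l (f : 'rV[R]_n -> 'M[R]_(m, l)) x :
  open U -> U x -> Ck_on 1 U f -> differentiable f x.
Proof.
move=> oU Ux f1; apply: differentiable_mx => i j.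
by apply: (C1_differentiable_scalar oU Ux); exact: (Ck_on_mxP _ _ oU).1.
Qed.

End CkAlgebra.

Lemma derive_sum_coord (R : realType) m (W : normedModType R)
    (f : 'rV[R]_m -> W) y v :
  differentiable f y -> 'D_v f y = \sum_b v 0 b *: 'D_(delta_mx 0 b) f y.
Proof.
move=> df; rewrite deriveE // {1}[v]row_sum_delta linear_sum.
by apply: eq_bigr => b _; rewrite linearZ /= deriveE.
Qed.

Lemma derive_comp (R : realType) (V W X : normedModType R) (g : V -> W)
    (f : W -> X) x v :
  differentiable g x -> differentiable f (g x) ->
  'D_v (fun y => f (g y)) x = 'D_('D_v g x) f (g x).
Proof.
move=> dg df.
rewrite !deriveE //; last exact: (differentiable_comp dg df).
by rewrite [X in X v = _](diff_comp dg df).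
Qed.

(** By the chain rule a partial derivative of the composite is a sum of products of a derivative of
    [g] with a partial derivative of [f] taken at [g]; the latter is a composite of lower order,
    whence the induction with [f] general. *)
Lemma Ck_on_comp_scalar (R : realType) n m k (U : set 'rV[R]_n) (U' : set 'rV[R]_m)
    (g : 'rV[R]_n -> 'rV[R]_m) (f : 'rV[R]_m -> R) :
  open U -> open U' -> (forall x, U x -> U' (g x)) ->
  Ck_on k U g -> Ck_on k U' f -> Ck_on k U (fun x => f (g x)).
Proof.
move=> oU oU' gU; elim: k f => [|k IH] f G F; have [fc fk] := F; have [gc gk] := G.
  split=> // x Ux; apply: (@continuous_comp _ _ _ g f); first exact: gc.
  exact/fc/gU.
have C1W j (h : 'rV[R]_m -> R) (V : set _) : Ck_on j.+1 V h -> Ck_on 1 V h.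
  by elim: j => // j IHj /Ck_onW.
have C1W' j (h : 'rV[R]_n -> 'rV[R]_m) (V : set _) : Ck_on j.+1 V h -> Ck_on 1 V h.
  by elim: j => // j IHj /Ck_onW.
have df x : U x -> differentiable f (g x).
  by move=> /gU Ux; apply: C1_differentiable_scalar oU' Ux (C1W _ _ _ F).
have dg x : U x -> differentiable g x.
  by move=> Ux; apply: C1_differentiable oU Ux (C1W' _ _ _ G).
split=> [x Ux|a].
  apply: (@continuous_comp _ _ _ g f); first exact: gc.
  exact/fc/gU.
split=> [x Ux|].
  by apply: diff_derivable; apply: (differentiable_comp (dg _ Ux) (df _ Ux)).
apply: (@Ck_on_congr _ _ _ _ _ (fun x => \sum_b ('D_(delta_mx 0 a) g x) 0 b *
   'D_(delta_mx 0 b) f (g x))) => //.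
  by move=> x Ux; rewrite (derive_comp _ (dg _ Ux) (df _ Ux)) (derive_sum_coord _ (df _ Ux)).
apply: Ck_on_sum => // b; apply: Ck_on_mul => //.
  exact: (Ck_on_mxP k _ oU).1 (gk a).2 0 b.
exact: (IH (fun y => 'D_(delta_mx 0 b) f y) (Ck_onW G) (fk b).2).
Qed.

Lemma Ck_on_comp (R : realType) n m p l k (U : set 'rV[R]_n) (U' : set 'rV[R]_m)
    (g : 'rV[R]_n -> 'rV[R]_m) (f : 'rV[R]_m -> 'M[R]_(p, l)) :
  open U -> open U' -> (forall x, U x -> U' (g x)) ->
  Ck_on k U g -> Ck_on k U' f -> Ck_on k U (fun x => f (g x)).
Proof.
move=> oU oU' gU G /(Ck_on_mxP _ _ oU') F; apply/Ck_on_mxP => // i j.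
exact: Ck_on_comp_scalar (F i j).
Qed.

(** * Symmetry of second partial derivatives *)

Lemma derive_translate (R : realType) (V W : normedModType R) (f : V -> W) (c x v : V) :
  'D_v (fun y => f (y + c)) x = 'D_v f (x + c) /\
  (derivable f (x + c) v -> derivable (fun y => f (y + c)) x v).
Proof.
have E : (fun h : R => h^-1 *: (((fun y => f (y + c)) \o shift x) (h *: v) - f (x + c)))
   = (fun h : R => h^-1 *: ((f \o shift (x + c)) (h *: v) - f (x + c))).
  by apply/funext => h /=; rewrite addrA.
by split; rewrite /derive /derivable E.
Qed.

Lemma norm_delta_mx_le (R : realType) n (a : 'I_n) :
  `|delta_mx 0 a : 'rV[R]_n| <= 1.
Proof.
by apply: row_norm_le => // i j; rewrite mxE; case: (_ && _); rewrite ?normr1 ?normr0.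
Qed.

(** The mean value theorem is used in direction [a] on the increment of [f] in direction [b], then
    in direction [b] on the partial derivative along [a]. *)
Lemma second_difference (R : realType) n (f : 'rV[R]_n -> R) (U : set 'rV[R]_n)
    (x : 'rV[R]_n) (r h : R) (a b : 'I_n) :
  Ck_on 2 U f -> ball x r `<=` U -> 0 <= h -> h + h < r ->
  exists2 y, ball x r y &
    f (x + h *: delta_mx 0 a + h *: delta_mx 0 b) - f (x + h *: delta_mx 0 a)
    - (f (x + h *: delta_mx 0 b) - f x)
    = h * (h * 'D_(delta_mx 0 b) (fun z => 'D_(delta_mx 0 a) f z) y).
Proof.
move=> [_ f2] B h0 hr.
have [fa [_ fab]] := f2 a.
have inB (t s : R) : `|t| <= `|h| -> `|s| <= `|h| ->
    ball x r (x + t *: delta_mx 0 a + s *: delta_mx 0 b).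
  rewrite (ger0_norm h0) => th sh.
  rewrite -ball_normE /= -addrA opprD addNKr normrN.
  apply: le_lt_trans hr; rewrite (le_trans (ler_normD _ _)) // lerD //.
    by rewrite normrZ (le_trans _ th) // ler_piMr // norm_delta_mx_le.
  by rewrite normrZ (le_trans _ sh) // ler_piMr // norm_delta_mx_le.
pose g y := f (y + h *: delta_mx 0 b) - f y.
have dg t : `|t| <= `|h| ->
   derivable (fun y => f (y + h *: delta_mx 0 b)) (x + t *: delta_mx 0 a) (delta_mx 0 a)
   /\ derivable f (x + t *: delta_mx 0 a) (delta_mx 0 a).
  move=> th; split.
    by apply: (derive_translate _ _ _ _).2; apply/fa/B/inB.
  apply: fa; apply: B.
  by have := inB t 0 th; rewrite scale0r addr0; apply; rewrite normr0.
have [|t [_ th] E] := @line_MVT R _ g x (delta_mx 0 a) h.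
  by move=> t _ /dg[d1 d2]; exact: (derivableB d1 d2).
have [d1 d2] := dg t th.
move: E; rewrite /g [X in h * X](deriveB d1 d2) (derive_translate _ _ _ _).1 => E.
have [|s [_ sh] E2] := @line_MVT R _ (fun z => 'D_(delta_mx 0 a) f z)
   (x + t *: delta_mx 0 a) (delta_mx 0 b) h.
  by move=> s _ sh; apply: (fab b).1; apply/B/inB.
exists (x + t *: delta_mx 0 a + s *: delta_mx 0 b); first exact: inB.
by rewrite -E2 -E.
Qed.

(** The mean value theorem yields the two mixed derivatives at different points of a ball;
    continuity removes the difference as the radius shrinks. *)
Lemma eq_of_near_values (R : realType) (V : normedModType R) (G H : V -> R) x (U : set V) :
  open U -> U x -> continuous_at x G -> continuous_at x H ->
  (forall r, 0 < r -> ball x r `<=` U ->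
     exists y z, [/\ ball x r y, ball x r z & G y = H z]) ->
  G x = H x.
Proof.
move=> oU Ux cG cH K; apply/eqP; rewrite -subr_eq0 -normr_le0.
apply/ler_addgt0Pl => e e0; rewrite addr0.
have : \forall y \near x, U y /\ (`|G x - G y| <= e / 2 /\ `|H x - H y| <= e / 2).
  apply: filterI; first exact: open_nbhs_nbhs.
  by apply: filterI; [move: cG|move: cH] => /cvgrPdist_le; apply; rewrite divr_gt0.
move=> /nbhs_ballP[r /= r0 B].
have [|y [z [/B[_ [Gy _]] /B[_ [_ Hz]] E]]] := K r r0; first by move=> y /B[].
rewrite -(subrKA (H z)) -{1}E (le_trans (ler_normD _ _)) // [leRHS]splitr.
by rewrite lerD // distrC.
Qed.

Lemma second_difference_cancel (F : fieldType) (h p q s t u v : F) : h != 0 ->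
  p - q - (s - t) = h * (h * u) -> p - s - (q - t) = h * (h * v) -> u = v.
Proof.
move=> h0 Eu Ev; apply: (mulfI h0); apply: (mulfI h0).
by rewrite -Eu -Ev; ring.
Qed.

Lemma schwarz (R : realType) n (f : 'rV[R]_n -> R) (U : set 'rV[R]_n)
    (x : 'rV[R]_n) (a b : 'I_n) :
  open U -> U x -> Ck_on 2 U f ->
  'D_(delta_mx 0 b) (fun z => 'D_(delta_mx 0 a) f z) x =
  'D_(delta_mx 0 a) (fun z => 'D_(delta_mx 0 b) f z) x.
Proof.
move=> oU Ux f2.
have c2 i j : continuous_at x (fun y => 'D_(delta_mx 0 j) (fun z => 'D_(delta_mx 0 i) f z) y).
  by case: f2 => _ /(_ i)[_ [_ /(_ j)[_ [+ _]]]]; apply.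
apply: (eq_of_near_values oU Ux (c2 a b) (c2 b a)) => r r0 BU.
have h0 : 0 <= r / 3 by rewrite divr_ge0 // ltW.
have hr : r / 3 + r / 3 < r by lra.
have [y yr Ey] := @second_difference R n f U x r (r / 3) a b f2 BU h0 hr.
have [z zr Ez] := @second_difference R n f U x r (r / 3) b a f2 BU h0 hr.
exists y, z; split; [exact: yr|exact: zr|].
have h3 : r / 3 != 0 by rewrite mulf_neq0 ?invr_neq0 ?pnatr_eq0 ?gt_eqF.
move: Ez; rewrite (addrAC x (r / 3 *: delta_mx 0 b)) => Ez.
exact: (second_difference_cancel h3 Ey Ez).
Qed.

(** * Jacobians and local surjectivity *)

Lemma jacobianE (R : realType) n m (f : 'rV[R]_n -> 'rV[R]_m) x a b :
  differentiable f x -> 'J f x a b = 'D_(delta_mx 0 a) f x 0 b.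
Proof. by move=> df; rewrite (deriveEjacobian _ df) -rowE [RHS]mxE. Qed.

Lemma jacobian_row (R : realType) n m (f : 'rV[R]_n -> 'rV[R]_m) x a :
  differentiable f x -> row a ('J f x) = 'D_(delta_mx 0 a) f x.
Proof. by move=> df; rewrite deriveEjacobian // -rowE. Qed.

Lemma jacobianP (R : realType) n m (f : 'rV[R]_n -> 'rV[R]_m) x (A : 'M[R]_(n, m)) :
  (forall v, 'd f x v = v *m A) -> 'J f x = A.
Proof. by move=> H; apply/row_matrixP => i; rewrite !rowE mul_rV_lin1 H. Qed.

Lemma jacobian_comp (R : realType) n m l (f : 'rV[R]_n -> 'rV[R]_m)
    (g : 'rV[R]_m -> 'rV[R]_l) x :
  differentiable f x -> differentiable g (f x) ->
  'J (fun y => g (f y)) x = 'J f x *m 'J g (f x).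
Proof.
move=> df dg; apply: jacobianP => v.
rewrite -deriveE; last exact: (differentiable_comp df dg).
by rewrite (derive_comp _ df dg) !deriveEjacobian // mulmxA.
Qed.

Lemma near_eq_differentiable (R : realType) (V W : normedModType R) (f g : V -> W) x :
  (\forall y \near x, f y = g y) -> differentiable f x -> differentiable g x.
Proof.
move=> fg df.
have -> : g = (fun y => g y - f y) + f by apply/funext => y; rewrite !fctE subrK.
apply: (differentiableD _ df); apply: differentiable_flat => e e0.
move: fg => /[dup] /nbhs_singleton fgx.
apply: filterS => y fgy; rewrite -fgy -fgx !subrr normr0.
by rewrite mulr_ge0 // ltW.
Qed.

Lemma near_eq_jacobian (R : realType) n m (f g : 'rV[R]_n -> 'rV[R]_m) x :
  (\forall y \near x, f y = g y) -> differentiable f x ->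
  differentiable g x /\ 'J f x = 'J g x.
Proof.
move=> fg df.
have dg : differentiable g x := near_eq_differentiable fg df.
split; first exact: dg.
apply: jacobianP => v.
by rewrite -(deriveE v df) (near_eq_derive v fg) (deriveEjacobian v dg).
Qed.

Lemma Ck_onS1 (R : realType) n k (V : normedModType R) (U : set 'rV[R]_n)
  (f : 'rV[R]_n -> V) : Ck_on k.+1 U f -> Ck_on 1 U f.
Proof. by elim: k => // k IH /Ck_onW. Qed.

Lemma Ck_on_jacobian (R : realType) n m k (U : set 'rV[R]_n) (f : 'rV[R]_n -> 'rV[R]_m) :
  open U -> Ck_on k.+1 U f -> Ck_on k U (fun x => 'J f x).
Proof.
move=> oU fk; apply/Ck_on_mxP => // a b.
apply: (@Ck_on_congr _ _ k R U (fun x => 'D_(delta_mx 0 a) f x 0 b)) => // [x Ux|].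
  by rewrite jacobianE //; apply: (C1_differentiable oU Ux); apply: Ck_onS1 fk.
by apply: (Ck_on_mxP k _ oU).1; case: fk => _ /(_ a)[].
Qed.

(** Strict differentiability, and not mere differentiability, compares values at two moving points
    [y] and [z]; the vanishing Jacobian removes the linear term. *)
Lemma lipschitz_of_flat (R : realType) n m (f : 'rV[R]_n -> 'rV[R]_m)
    (U : set 'rV[R]_n) (x0 : 'rV[R]_n) :
  open U -> U x0 -> Ck_on 1 U f -> 'J f x0 = 0 ->
  forall e : R, 0 < e -> exists2 r : R, 0 < r & ball x0 r `<=` U /\
    forall y z, ball x0 r y -> ball x0 r z -> `|f y - f z| <= e * `|y - z|.
Proof.
move=> oU Ux0 f1 J0 e e0.
have df := C1_differentiable oU Ux0 f1.
pose P (b : 'I_m) (r : R) := forall y z, ball x0 r y -> ball x0 r z ->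
  `|f y 0 b - f z 0 b| <= e * `|y - z|.
have HP b : \forall r \near 0^'+, P b r.
  have [fbc fbd] := (Ck_on_mxP 1 f oU).1 f1 0 b.
  have [||r r0 [_ H]] := @strict_differentiability R n (fun x => f x 0 b) U x0 oU Ux0 _ _ e e0.
  - by move=> x a; case: (fbd a) => /(_ x).
  - by move=> a; case: (fbd a) => _ [+ _]; apply.
  near=> s.
  have sr : s <= r by near: s; apply: nbhs_right_le.
  move=> y z /(le_ball sr) yr /(le_ball sr) zr.
  have := H y z yr zr; rewrite big1 ?subr0 // => a _.
  have := derive_mx (@diff_derivable _ _ _ f x0 (delta_mx 0 a) df).
  rewrite -(jacobian_row _ df) J0 => /rowP/(_ b); rewrite !mxE => <-.
  by rewrite mulr0.
have : \forall r \near 0^'+, ball x0 r `<=` U /\ forall b, P b r.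
  apply: filterI; last exact: (@filter_forall _ _ P _ _ HP).
  have /nbhs_ballP[r /= r0 B] : nbhs x0 U by apply: open_nbhs_nbhs.
  near=> s; apply: subset_trans B; apply: le_ball.
  by near: s; apply: nbhs_right_le.
move=> H.
have : \forall r \near 0^'+, 0 < r /\ (ball x0 r `<=` U /\ forall b, P b r).
  by apply: filterI => //; apply: nbhs_right_gt.
move=> /filter_ex[r [r0 [BU HPr]]]; exists r => //; split=> // y z yr zr.
apply: row_norm_le; first by rewrite mulr_ge0 // ltW.
by move=> i b; rewrite (ord1 i) !mxE; apply: HPr.
Unshelve. all: by end_near. Qed.

(** Near [x0] the map [f = F - id] is 1/2-Lipschitz. Let [p] minimise the distance from [F p] to [z]
    on a compact cube. The Newton-like update [z - f p] stays in the cube and at least halves this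
    distance, so the minimum is 0 and [z] is attained. *)
Lemma open_map_id_jacobian (R : realType) n (F : 'rV[R]_n -> 'rV[R]_n)
    (U : set 'rV[R]_n) (x0 : 'rV[R]_n) :
  open U -> U x0 -> Ck_on 1 U F -> 'J F x0 = 1%:M -> nbhs (F x0) (F @` U).
Proof.
move=> oU Ux0 F1 J1.
pose f y := F y - y.
have fid : Ck_on 1 U (fun y : 'rV[R]_n => - y) by exact: (Ck_on_opp oU (@Ck_on_id _ _ 1 U)).
have f1 : Ck_on 1 U f := Ck_on_add oU F1 fid.
have dF := C1_differentiable oU Ux0 F1.
have df := C1_differentiable oU Ux0 f1.
have Jf : 'J f x0 = 0.
  apply/row_matrixP => a; rewrite (jacobian_row _ df) row0.
  have dFa := @diff_derivable _ _ _ F x0 (delta_mx 0 a) dF.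
  have idd : derivable (id : 'rV[R]_n -> 'rV[R]_n) x0 (delta_mx 0 a) by exact: derivable_id.
  rewrite [LHS](deriveB dFa idd) derive_id.
  by rewrite (deriveEjacobian _ dF) J1 mulmx1 subrr.
have h2 : 0 < 2^-1 :> R by rewrite invr_gt0.
have [r r0 [BU L]] := lipschitz_of_flat oU Ux0 f1 Jf h2.
(* With [z] at distance less than [r / 4] from [F x0], the map [y |-> z - f y] preserves the cube of
   radius [r / 2]: [r / 4] for [z] plus half of [r / 2] for [f]. *)
apply/nbhs_ballP; exists (r / 4); first by rewrite /= divr_gt0.
move=> z; rewrite -ball_normE /= => zr.
(* The closed ball of the sup norm, written as a product of segments so that its compactness is at
   hand. *)
pose B := [set y : 'rV[R]_n | forall i, `[x0 0 i - r / 2, x0 0 i + r / 2]%classic (y ord0 i)].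
have r2 : 0 < r / 2 by rewrite divr_gt0.
have BE y : B y <-> `|x0 - y| <= r / 2.
  split=> [yB|yB i].
    apply: row_norm_le => [|i j]; first exact: ltW.
    by rewrite (ord1 i) !mxE ler_distl; move: (yB j); rewrite /= in_itv /= lerBlDr lerBlDr andbC.
  have := le_trans (ler_row_norm (x0 - y) 0 i) yB.
  by rewrite /= in_itv /= !mxE ler_distl lerBlDr lerBlDr andbC.
have Bc : compact B by exact: (@rV_compact R n
  (fun i => `[x0 0 i - r / 2, x0 0 i + r / 2]%classic) (fun i => @segment_compact R _ _)).
have Bb y : B y -> ball x0 r y.
  move=> /BE yB; rewrite -ball_normE /=; apply: le_lt_trans yB _.
  by rewrite gtr_pMr // invf_lt1 // ltr1n.
have TB y : B y -> B (z - f y).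
  move=> yB; apply/BE.
  have -> : x0 - (z - f y) = (F x0 - z) + (f y - f x0).
    rewrite [f x0]/f !opprB; move: (f y) => u.
    by rewrite [u + _]addrCA [RHS]addrC -addrA subrKA.
  have := L _ _ (Bb _ yB) (ballxx x0 r0).
  move/BE: yB; rewrite -(distrC y) => yB yL.
  rewrite (le_trans (ler_normD _ _)) //.
  have -> : r / 2 = r / 4 + 2^-1 * (r / 2) by field.
  by apply: lerD; [exact: ltW|apply: le_trans yL _; rewrite ler_pM2l].
have cfB y : B y -> continuous_at y (fun y => `|z - F y|).
  move=> /Bb/BU Uy; apply: continuous_comp; last exact: norm_continuous.
  by apply: continuousB; [exact: cst_continuous|apply: F1.1].
have [|//||p pB pmin] := @EVT_min_rV R n (fun y => `|z - F y|) B.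
- by exists x0; apply/BE; rewrite subrr normr0 ltW.
- by apply: continuous_in_subspaceT => y; rewrite inE => /cfB.
have pT : B p by move: pB; rewrite inE.
exists p; first exact/BU/Bb.
apply/esym/eqP; rewrite -subr_eq0 -normr_le0.
have zF y : z - F y = (z - f y) - y by rewrite /f opprB addrA addrAC addrK.
have := pmin (z - f p); rewrite inE => /(_ (TB _ pT)).
have -> : z - F (z - f p) = f p - f (z - f p).
  by rewrite zF; move: (f (z - f p)) => u; rewrite opprB addrC subrKA.
have := L _ _ (Bb _ pT) (Bb _ (TB _ pT)).
have -> : `|p - (z - f p)| = `|z - F p| by rewrite zF distrC.
move: (`|z - F p|) (`|_ - _|) => u v uv vu.
by have := le_trans vu uv; lra.
Qed.

(** * Charts *)

Section Charts.
Variables (R : realType) (M : topologicalType) (n : nat).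
Implicit Types (c d e : chart R M n) (p : M) (x v : 'rV[R]_n).

Lemma par_dom c x : (crd c @` dom c) x -> dom c (par c x) /\ crd c (par c x) = x.
Proof. by move=> [p cp <-]; rewrite crdK. Qed.

Lemma crd_img c p (O : set M) : dom c p -> O p -> (crd c @` (dom c `&` O)) (crd c p).
Proof. by move=> cp Op; exists p. Qed.

Lemma crd_imgT c p : dom c p -> (crd c @` dom c) (crd c p).
Proof. by move=> cp; exists p. Qed.

Lemma par_nbhs c p (O : set M) : dom c p -> nbhs p O ->
  \forall x \near crd c p, dom c (par c x) /\ crd c (par c x) = x /\ O (par c x).
Proof.
move=> cp Op.
have H1 : nbhs (crd c p) (crd c @` dom c).
  by apply: open_nbhs_nbhs; split; [exact: img_open|exact: crd_imgT].
have H2 : \forall x \near crd c p, O (par c x).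
  by have := par_continuous (crd_imgT cp); rewrite /continuous_at crdK //; apply.
by apply: filterS (filterI H1 H2) => x [/par_dom[dx xE] Ox].
Qed.

Lemma crd_nbhs c p (V : set 'rV[R]_n) : dom c p -> nbhs (crd c p) V ->
  \forall q \near p, dom c q /\ V (crd c q).
Proof.
move=> cp Vp; apply: filterI; last exact: (crd_continuous cp).
by apply: open_nbhs_nbhs; split=> //; exact: dom_open.
Qed.

Lemma open_crd_img c (O : set M) : open O -> open (crd c @` (dom c `&` O)).
Proof.
move=> oO; rewrite openE => _ [p [cp Op] <-].
have := par_nbhs cp (open_nbhs_nbhs (conj oO Op)).
by apply: filterS => x [dx [xE Ox]]; exists (par c x).
Qed.

Lemma crd_img_par c (O : set M) x :
  (crd c @` (dom c `&` O)) x -> [/\ dom c (par c x), O (par c x) & crd c (par c x) = x].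
Proof. by move=> [p [cp Op] <-]; rewrite crdK. Qed.

(** Vectors are rows and matrices act on the right, so composites of transitions multiply from left
    to right. *)
Definition trans c d p : 'M[R]_n := 'J (crd d \o par c) (crd c p).

Lemma trans_differentiable c d p : smooth_transition c d -> dom c p -> dom d p ->
  differentiable (crd d \o par c) (crd c p).
Proof.
move=> cd cp dp; apply: (C1_differentiable _ (crd_img cp dp) (cd 1%N)).
by apply: open_crd_img; exact: dom_open.
Qed.

Lemma changeE c d p v : smooth_transition c d -> dom c p -> dom d p ->
  change c d p v = v *m trans c d p.
Proof.
by move=> cd cp dp; rewrite /change /tmap (deriveEjacobian _ (trans_differentiable cd cp dp)).
Qed.

Lemma coord_fieldE c d a p : smooth_transition c d -> dom c p -> dom d p ->
  coord_field c d a p = row a (trans c d p).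
Proof. by move=> cd cp dp; rewrite /coord_field changeE // -rowE. Qed.

Lemma coord_formE c d a p v : smooth_transition d c -> dom c p -> dom d p ->
  coord_form c d a p v = (v *m trans d c p) 0 a.
Proof.
move=> dc cp dp; have df := trans_differentiable dc dp cp.
rewrite -(deriveEjacobian _ df).
by rewrite (derive_mx (@diff_derivable _ _ _ (crd c \o par d) (crd d p) v df)) mxE.
Qed.

Lemma trans_comp c d e p : smooth_transition c d -> smooth_transition d e ->
  dom c p -> dom d p -> dom e p ->
  trans c e p = trans c d p *m trans d e p.
Proof.
move=> cd de cp dp ep; have d1 := trans_differentiable cd cp dp.
have d2 := trans_differentiable de dp ep.
have d2' : differentiable (crd e \o par d) ((crd d \o par c) (crd c p)) by rewrite /= crdK.
rewrite {1}/trans.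
have [|_ <-] := near_eq_jacobian (g := crd e \o par c) _ (differentiable_comp d1 d2').
  have : nbhs p (dom d) by apply: open_nbhs_nbhs; split=> //; exact: dom_open.
  by move=> /(par_nbhs cp); apply: filterS => x [_ [_ dx]] /=; rewrite crdK.
by rewrite [LHS](jacobian_comp d1 d2') /= crdK.
Qed.

Lemma trans_id c p : dom c p -> trans c c p = 1%:M.
Proof.
move=> cp; rewrite /trans.
have idd : differentiable (id : 'rV[R]_n -> 'rV[R]_n) (crd c p) by exact: ex_diff.
have [|_ <-] := near_eq_jacobian (g := crd c \o par c) _ idd.
  have : nbhs p setT by exact: filterT.
  by move=> /(par_nbhs cp); apply: filterS => x [_ [xE _]] /=; rewrite xE.
by apply: jacobianP => v; rewrite -(deriveE v idd) derive_id mulmx1.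
Qed.

Lemma transK c d p : smooth_transition c d -> smooth_transition d c ->
  dom c p -> dom d p -> trans c d p *m trans d c p = 1%:M.
Proof. by move=> cd dc cp dp; rewrite -trans_comp // trans_id. Qed.

End Charts.

(** * Density of the open orbits *)

(** Pigeonhole: among [N.+1] multiples of [f] two have fractional parts in the same interval of
    length [1 / N]. *)
Lemma dirichlet_approximation (R : realType) (f e : R) : 0 < e ->
  exists (n : nat) (m : int), (0 < n)%N /\ `|n%:R * f - m%:~R| < e.
Proof.
move=> e0.
pose N := (Num.trunc e^-1).+1.
have N0 : 0 < N%:R :> R by rewrite ltr0n.
have Ne : N%:R^-1 < e.
  rewrite -[ltRHS]invrK ltf_pV2 ?posrE ?invr_gt0 //.
  have e1 : 0 <= e^-1 by rewrite invr_ge0 ltW.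
  by have /andP[] := truncn_itv e1.
pose fr (i : nat) : R := i%:R * f - (Num.floor (i%:R * f))%:~R.
have fr01 i : 0 <= fr i < 1.
  have /andP[l1 l2] := floor_itv (i%:R * f).
  by rewrite /fr subr_ge0 l1 ltrBlDl; move: l2; rewrite intrD addrC.
have gN i : (Num.trunc (N%:R * fr i) < N)%N.
  have /andP[f0 f1] := fr01 i.
  rewrite -(ltr_nat R); apply: (@le_lt_trans _ _ (N%:R * fr i)).
    by have /andP[] := truncn_itv (mulr_ge0 (ltW N0) f0).
  by rewrite gtr_pMr.
pose g (i : 'I_N.+1) : 'I_N := Ordinal (gN i).
have : ~~ injectiveb g.
  by apply/negP => /injectiveP/leq_card; rewrite !card_ord ltnn.
case/injectivePn => i [j ij gij].
wlog lij : i j ij gij / (i < j)%N.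
  move=> H; case: (ltngtP i j) => [||/val_inj E]; first exact: (H i j).
    by apply: (H j i) => //; rewrite eq_sym.
  by rewrite E eqxx in ij.
exists (j - i)%N, (Num.floor (j%:R * f) - Num.floor (i%:R * f)).
split; first by rewrite subn_gt0.
have -> : (j - i)%:R * f - (Num.floor (j%:R * f) - Num.floor (i%:R * f))%:~R = fr j - fr i.
  by rewrite natrB ?(ltnW lij) // intrB /fr; ring.
apply: lt_trans Ne.
have /andP[i1 i2] := truncn_itv (mulr_ge0 (ltW N0) (proj1 (andP (fr01 i)))).
have /andP[j1 j2] := truncn_itv (mulr_ge0 (ltW N0) (proj1 (andP (fr01 j)))).
have E : Num.trunc (N%:R * fr i) = Num.trunc (N%:R * fr j) by move/(congr1 val): gij.
rewrite -(ltr_pM2l N0) mulfV ?gt_eqF // -[X in X * _]ger0_norm ?(ltW N0) // -normrM.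
rewrite ltr_norml mulrBr; move: i1 i2 j1 j2; rewrite E.
rewrite -[(Num.trunc _).+1]addn1 natrD.
have close (a b c : R) : a <= b -> b < a + 1 -> a <= c -> c < a + 1 -> -1 < c - b < 1.
  by move=> *; apply/andP; split; lra.
exact: close.
Qed.

(** While both numbers are even, halving them halves the error as well; this stops because [n]
    decreases and stays positive. *)
Lemma odd_approximation (R : realType) (f e : R) : 0 < e ->
  exists (n m : int), [|| odd `|n| | odd `|m|] /\ `|n%:~R * f - m%:~R| < e.
Proof.
move=> e0; have [n [m [n0 H]]] := dirichlet_approximation f e0.
elim/ltn_ind: n m n0 H => n IH m n0 H.
have [od|ev] := boolP (odd n || odd `|m|).
  by exists n, m.
move: ev; rewrite negb_or => /andP[en em].
have n2 : n = (n./2).*2 by rewrite even_halfK.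
have [m' m2] : exists m', m = m' *+ 2.
  have /dvdzP[m' ->] : (2 %| m)%Z by rewrite dvdzE /= dvdn2.
  by exists m'; rewrite mulr_natr.
have n20 : (0 < n./2)%N by rewrite -double_gt0 -n2.
apply: (IH n./2 _ m') => //.
  by rewrite {2}n2 -addnn -{1}[n./2]addn0 ltn_add2l.
move: H; rewrite {1}n2 m2 -addnn natrD rmorphMn /= mulr2n mulrDl => H.
move: (_ * f) (_%:~R) H => u v H.
have -> : u - v = 2^-1 * (u + u - (v + v)) by field.
rewrite normrM ger0_norm ?invr_ge0 // (le_lt_trans _ H) //.
by rewrite ler_piMl // invf_le1 // ler1n.
Qed.

(** These vectors represent the elements of order exactly 2 of the torus. *)
Definition half_lattice (R : realType) (s : 'rV[R]_2) : Prop :=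
  exists2 z : 'rV[int]_2, s = 2^-1 *: map_mx intr z & exists j, odd `|z 0 j|.

Lemma half_lattice_nint (R : realType) (s : 'rV[R]_2) :
  half_lattice s -> ~ integral_vector s.
Proof.
move=> [z -> [j oz]] [y /rowP/(_ j)]; rewrite !mxE => E.
have {}E : (z 0 j)%:~R = (2 * y 0 j)%:~R :> R.
  by rewrite intrM -E mulrA mulfV ?mul1r // pnatr_eq0.
by move/intr_inj: E oz => ->; rewrite abszM oddM.
Qed.

Lemma ord2_other (j : 'I_2) :
  exists2 k : 'I_2, j != k & forall i, i = j \/ i = k.
Proof.
exists (rev_ord j) => [|i]; first by case: j => -[|[|]].
case: (eqVneq i j) => [->|ij]; [by left|right; apply/val_inj].
by case: j i ij => -[|[|]] //= ? [[|[|]]].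
Qed.

Lemma line_near_half_lattice (R : realType) (s : 'rV[R]_2) (e : R) :
  s != 0 -> 0 < e -> exists t h, half_lattice h /\ `|t *: s - h| < e.
Proof.
move=> s0 e0.
have [j sj] : exists j, s 0 j != 0.
  apply: contrapT => H; move/eqP: s0; apply; apply/rowP => j; rewrite mxE.
  by apply/eqP; apply: contraPT isT => sj _; apply: H; exists j.
have [k jk allj] := ord2_other j.
have [n [m [od H]]] := odd_approximation (s 0 k / s 0 j) e0.
(* The multiple of [s] with [j]-th coordinate [n / 2] has as its other coordinate half of [n] times
   the slope, which [m / 2] approximates. One of [n], [m] being odd keeps the target off the
   lattice. *)
exists (n%:~R / s 0 j / 2), (2^-1 *: map_mx intr (\row_i if i == j then n else m)).
split.
  exists (\row_i if i == j then n else m) => //.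
  case/orP: od => od; [exists j|exists k]; rewrite mxE ?eqxx //.
  by rewrite eq_sym (negbTE jk).
apply: (@le_lt_trans _ _ (2^-1 * `|n%:~R * (s 0 k / s 0 j) - m%:~R|)); last first.
  rewrite (le_lt_trans _ H) //.
  by rewrite ler_piMl // invf_le1 // ler1n.
apply: row_norm_le => [|i b]; first by rewrite mulr_ge0 // invr_ge0.
rewrite (ord1 i) !mxE; case: (allj b) => ->.
  rewrite eqxx; have -> : n%:~R / s 0 j / 2 * s 0 j - 2^-1 * n%:~R = 0 by field.
  by rewrite normr0 mulr_ge0 // invr_ge0.
rewrite eq_sym (negbTE jk).
have -> : n%:~R / s 0 j / 2 * s 0 k - 2^-1 * m%:~R
  = 2^-1 * (n%:~R * (s 0 k / s 0 j) - m%:~R) by field.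
by rewrite normrM [`|2^-1|]ger0_norm // invr_ge0.
Qed.

Lemma continuous_at_pair (T U V : topologicalType) (f : T -> U) (g : T -> V) x :
  continuous_at x f -> continuous_at x g -> continuous_at x (fun y => (f y, g y)).
Proof. by move=> cf cg; exact: (cvg_pair cf cg). Qed.

(** * The torus action in charts *)

Section Flow.
Variables (R : realType) (M : topologicalType) (A : atlas R M 4).
Variables (rho : 'rV[R]_2 -> M -> M) (hact : smooth_action A rho).

Definition action_domain i j : set 'rV[R]_(2 + 4) :=
  [set z : 'rV[R]_(2 + 4) | (crd (A i) @` dom (A i)) (rsubmx z) /\
     dom (A j) (rho (lsubmx z) (par (A i) (rsubmx z)))].

Definition action_map i j (z : 'rV[R]_(2 + 4)) : 'rV[R]_4 :=
  crd (A j) (rho (lsubmx z) (par (A i) (rsubmx z))).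

Lemma open_action_domain i j : open (action_domain i j).
Proof.
case: hact => _ _ hc _.
rewrite openE => z [zi zj].
have ci : \forall z' \near z, (crd (A i) @` dom (A i)) (rsubmx z').
  have := @continuous_rsubmx R 1 2 4 z; apply.
  by apply: open_nbhs_nbhs; split=> //; exact: img_open.
have c1 : continuous_at z (fun z : 'rV[R]_(2 + 4) => (lsubmx z, par (A i) (rsubmx z))).
  apply: continuous_at_pair; first exact: continuous_lsubmx.
  apply: (@continuous_comp _ _ _ (fun z : 'rV[R]_(2+4) => rsubmx z) (par (A i))).
    exact: continuous_rsubmx.
  exact: par_continuous.
have c2 : continuous_at z (fun z : 'rV[R]_(2 + 4) => rho (lsubmx z) (par (A i) (rsubmx z))).
  by apply: (@continuous_comp _ _ _ _ (fun u : 'rV[R]_2 * M => rho u.1 u.2) z c1); exact: hc.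
have /c2 cj : nbhs (rho (lsubmx z) (par (A i) (rsubmx z))) (dom (A j)).
  by apply: open_nbhs_nbhs; split=> //; exact: dom_open.
by apply: filterS (filterI ci cj).
Qed.

Lemma action_domain_crd i j s p : dom (A i) p -> dom (A j) (rho s p) ->
  action_domain i j (row_mx s (crd (A i) p)).
Proof.
by move=> ip jp; rewrite /action_domain /= row_mxKl row_mxKr crdK //; split=> //; exact: crd_imgT.
Qed.

Lemma Ck_on_action k i j : Ck_on k (action_domain i j) (action_map i j).
Proof. by case: hact => _ _ _ /(_ i j); apply. Qed.

Lemma rho_continuous s : continuous (rho s).
Proof.
case: hact => _ _ hc _ p.
apply: (@continuous_comp _ _ _ (fun q => (s, q)) (fun u : 'rV[R]_2 * M => rho u.1 u.2)).
  by apply: continuous_at_pair; [exact: cst_continuous|exact: cvg_id].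
exact: hc.
Qed.

Lemma rho_continuousl p : continuous (rho^~ p).
Proof.
case: hact => _ _ hc _ s.
apply: (@continuous_comp _ _ _ (fun q => (q, p)) (fun u : 'rV[R]_2 * M => rho u.1 u.2)).
  by apply: continuous_at_pair; [exact: cvg_id|exact: cst_continuous].
exact: hc.
Qed.

Definition shift_domain i j s : set 'rV[R]_4 :=
  crd (A i) @` (dom (A i) `&` rho s @^-1` dom (A j)).

Definition shift_map i j s (x : 'rV[R]_4) : 'rV[R]_4 :=
  crd (A j) (rho s (par (A i) x)).

Lemma open_shift_domain i j s : open (shift_domain i j s).
Proof.
apply: open_crd_img; apply: open_comp; last exact: dom_open.
by move=> p _; exact: rho_continuous.
Qed.

Lemma Ck_on_shift k i j s : Ck_on k (shift_domain i j s) (shift_map i j s).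
Proof.
apply: (@Ck_on_congr _ _ _ _ _ (fun x => action_map i j (row_mx s x))).
- exact: open_shift_domain.
- by move=> x _; rewrite /action_map row_mxKl row_mxKr.
apply: (@Ck_on_comp _ _ _ _ _ k _ (action_domain i j) (fun x => row_mx s x)
  (action_map i j) (@open_shift_domain i j s) (@open_action_domain i j)).
- by move=> x /crd_img_par[ix jx <-]; exact: action_domain_crd.
- apply/Ck_on_mxP; first exact: open_shift_domain.
  move=> a b; rewrite (ord1 a); case: (split_ordP b) => c ->.
    rewrite (_ : (fun x => _) = fun=> s 0 c); first exact: Ck_on_cst.
    by apply/funext => x; rewrite row_mxEl.
  rewrite (_ : (fun x => _) = fun x : 'rV[R]_4 => x 0 c).
    exact: (Ck_on_mxP k _ (@open_shift_domain i j s)).1 (@Ck_on_id _ _ _ _) 0 c.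
  by apply/funext => x; rewrite row_mxEr.
exact: Ck_on_action.
Qed.

Lemma shift_differentiable i j s p : dom (A i) p -> dom (A j) (rho s p) ->
  differentiable (shift_map i j s) (crd (A i) p).
Proof.
move=> ip jp; apply: (C1_differentiable (@open_shift_domain i j s) _ (@Ck_on_shift 1 i j s)).
by exists p.
Qed.

Lemma tmapE i j s p v : dom (A i) p -> dom (A j) (rho s p) ->
  tmap (A i) (A j) (rho s) p v = v *m 'J (shift_map i j s) (crd (A i) p).
Proof. by move=> ip jp; rewrite -(deriveEjacobian _ (shift_differentiable ip jp)). Qed.

Lemma orbit_differentiable j s p (t : R) : dom (A j) (rho (t *: s) p) ->
  differentiable (fun h : R => crd (A j) (rho (h *: s) p)) t.
Proof.
move=> jp; have [i ip] := cht_cover A p.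
have := @action_domain_crd i j (t *: s) p ip jp.
move=> /(fun z => C1_differentiable (@open_action_domain i j) z (@Ck_on_action 1 i j)) dZ.
have dr : differentiable (fun h : R => row_mx (h *: s) (crd (A i) p)) t.
  apply: differentiable_mx => a b; rewrite (ord1 a); case: (split_ordP b) => c ->.
    rewrite (_ : (fun x => _) = (fun x : R => s 0 c * id x)).
      by apply: differentiableZ; exact: ex_diff.
    by apply/funext => h; rewrite row_mxEl mxE mulrC.
  rewrite (_ : (fun x => _) = cst (crd (A i) p 0 c)); first exact: differentiable_cst.
  by apply/funext => h; rewrite row_mxEr.
rewrite (_ : (fun h => _) = action_map i j \o (fun h : R => row_mx (h *: s) (crd (A i) p))).
  exact: (differentiable_comp dr dZ).
by apply/funext => h; rewrite /= /action_map row_mxKl row_mxKr crdK.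
Qed.

Lemma near_orbit (s : 'rV[R]_2) p (O : set M) (t : R) : nbhs (rho (t *: s) p) O ->
  \forall h \near t, O (rho (h *: s) p).
Proof.
move=> Op.
apply: (@continuous_comp _ _ _ (fun h : R => h *: s) (rho^~ p) t) Op.
  by apply: cvgZl; exact: cvg_id.
exact: rho_continuousl.
Qed.

(** From [rho ((h + t) *: s) p = rho (t *: s) (rho (h *: s) p)]: the velocity at time [t] is the
    velocity at time 0, moved by the differential of [rho (t *: s)]. A zero of the induced field is
    therefore at rest. *)
Lemma orbit_derive i j s p (t : R) : dom (A i) p -> dom (A j) (rho (t *: s) p) ->
  'D_1 (fun h : R => crd (A j) (rho (h *: s) p)) t
  = induced_field rho s i p *m 'J (shift_map i j (t *: s)) (crd (A i) p).
Proof.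
move=> ip jp; have [r0 rD _ _] := hact.
have ip0 : dom (A i) (rho ((0 : R) *: s) p) by rewrite scale0r r0.
have d0 := orbit_differentiable ip0.
have dT := shift_differentiable ip jp.
rewrite -(deriveEjacobian _ dT) /induced_field derive1E.
have dT' : differentiable (shift_map i j (t *: s)) (crd (A i) (rho ((0 : R) *: s) p)).
  by rewrite scale0r r0.
have := @derive_comp R R _ _ _ _ _ (1 : R) d0 dT'; rewrite scale0r r0 => <-.
have -> : 'D_1 (fun h : R => crd (A j) (rho (h *: s) p)) t
   = 'D_1 (fun h : R => crd (A j) (rho ((h + t) *: s) p)) 0.
  by have [-> _] := derive_translate (fun h : R => crd (A j) (rho (h *: s) p)) t 0 1; rewrite add0r.
apply: near_eq_derive.
have Oi : nbhs (rho ((0 : R) *: s) p) (dom (A i)).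
  by apply: open_nbhs_nbhs; split=> //; exact: dom_open.
apply: filterS (near_orbit Oi) => h ih.
by rewrite /shift_map crdK // -rD scalerDl addrC.
Qed.

End Flow.

Lemma derive_linear_map (R : realType) (V W : normedModType R) (f : V -> W) x v :
  linear f -> 'D_v f x = f v.
Proof.
move=> lf; rewrite /derive; apply: lim_near_cst; first exact: norm_hausdorff.
apply: filterS (nbhs_dnbhs_neq (0 : R)) => h h0 /=.
by rewrite lf addrK scalerA mulVf // scale1r.
Qed.

Lemma constant_of_derive0 (R : realType) n (f : R -> 'rV[R]_n) (e : R) :
  (forall t, `|t| < e -> derivable f t 1 /\ 'D_1 f t = 0) ->
  forall t, `|t| < e -> f t = f 0.
Proof.
move=> df t te; apply/rowP => b; apply/eqP; rewrite -subr_eq0; apply/eqP.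
have dfb s : `|s| <= `|t| -> derivable (fun s => f s 0 b) s 1 /\
   'D_1 (fun s => f s 0 b) s = 0.
  move=> /le_lt_trans/(_ te)/df[d1 d2]; split; first exact: (derivable_mxP _ _ _).1 d1 0 b.
  by have := derive_mx d1; rewrite d2 => /rowP/(_ b); rewrite !mxE.
have sE (s : R) : 0 + s *: (1 : R) = s by rewrite add0r; exact: mulr1.
have [s _ st|s [_ st]] := @line_MVT R R (fun s => f s 0 b) 0 1 t.
  by rewrite sE; exact: (dfb s st).1.
by rewrite !sE (dfb s st).2 mulr0.
Qed.

(** Representatives modulo the lattice, indexed by the parities of the doubled coordinates. The pair
    [(false, false)] gives 0, so statements about these vectors also carry [half_lattice]. *)
Definition half_vector (R : realType) (j : bool * bool) : 'rV[R]_2 :=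
  2^-1 *: map_mx intr (\row_k (if k == 0 then (j.1 : nat)%:Z else (j.2 : nat)%:Z)).

Lemma half_lattice_rep (R : realType) (h : 'rV[R]_2) : half_lattice h ->
  exists j (y : 'rV[int]_2), half_lattice (half_vector R j) /\
    h = half_vector R j + map_mx intr y.
Proof.
move=> [z -> [k oz]].
exists (odd `|z 0 0|, odd `|z 0 1|), (\row_i divz (z 0 i) 2).
pose o : 'rV[int]_2 := \row_i Posz (odd `|z 0 i|).
have oE : half_vector R (odd `|z 0 0|, odd `|z 0 1|) = 2^-1 *: map_mx intr o.
  congr (_ *: map_mx _ _); apply/rowP => k'; rewrite !mxE.
  by case: (unliftP 0 k') => [k1|] ->; rewrite // (ord1 k1) /=; congr (Posz (odd `|z _ _|)); apply/val_inj.
rewrite oE; split.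
  by exists o => //; exists k; rewrite mxE /=; case: (odd _) oz.
apply/rowP => i; rewrite !mxE.
have zE : z 0 i = Posz (odd `|z 0 i|) + 2 * divz (z 0 i) 2 by move: (z 0 i) => u; lia.
by rewrite {1}zE intrD intrM; field.
Qed.

(** * Stabilizers of the points where an induced field vanishes *)

Section Stabilizers.
Variables (R : realType) (M : topologicalType) (A : atlas R M 4).
Variables (rho : 'rV[R]_2 -> M -> M) (hact : smooth_action A rho).

Lemma stab_small i s p : dom (A i) p -> induced_field rho s i p = 0 ->
  exists2 e : R, 0 < e & forall t, `|t| < e -> rho (t *: s) p = p.
Proof.
move=> ip K0; have [r0 rD _ _] := hact.
have : nbhs (rho ((0 : R) *: s) p) (dom (A i)).
  by apply: open_nbhs_nbhs; split; [exact: dom_open|rewrite scale0r r0].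
move=> /(near_orbit hact) /nbhs_ballP[e /= e0 B].
exists e => // t te.
have inB u : `|u| < e -> dom (A i) (rho (u *: s) p).
  by move=> ue; apply: B; rewrite -ball_normE /= sub0r normrN.
have := @constant_of_derive0 R 4 (fun h : R => crd (A i) (rho (h *: s) p)) e _ t te.
rewrite scale0r r0 => H.
have : crd (A i) (rho (t *: s) p) = crd (A i) p.
  apply: H => u ue; split.
    by have /(@diff_derivable _ _ _ _ _ (1 : R)) := orbit_differentiable hact (inB u ue).
  by rewrite (orbit_derive hact ip (inB u ue)) K0 mul0mx.
by move=> /(congr1 (par (A i))); rewrite !crdK //; apply: inB.
Qed.

(** Only for short times is the orbit curve known to stay in the chart; any time is an integral
    multiple of a short one. *)
Lemma stab_line i s p (t : R) : dom (A i) p -> induced_field rho s i p = 0 ->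
  rho (t *: s) p = p.
Proof.
move=> ip K0; have [r0 rD _ _] := hact.
have [e e0 He] := stab_small ip K0.
pose n := (Num.trunc (`|t| / e)).+1.
have n0 : 0 < n%:R :> R by rewrite ltr0n.
have tn : `|t / n%:R| < e.
  rewrite normrM normfV [`|n%:R|]ger0_norm ?ltW // ltr_pdivrMr // mulrC -ltr_pdivrMr //.
  have te : 0 <= `|t| / e by rewrite divr_ge0 // ltW.
  by have /andP[] := truncn_itv te.
have iter k : rho ((k%:R * (t / n%:R)) *: s) p = p.
  elim: k => [|k IH]; first by rewrite mul0r scale0r r0.
  by rewrite -[k.+1]addn1 natrD mulrDl mul1r scalerDl rD He.
by rewrite -[RHS](iter n) mulrCA mulfV ?gt_eqF // mulr1.
Qed.

(** The stabilizer of [p] is closed and contains the lattice and the line of [s], and this line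
    comes arbitrarily close to half-lattice points. If no element of order 2 fixed [p], none of the
    finitely many representatives would do so after a small perturbation [u]; but [u = t *: s - h]
    is such a perturbation and lands in the stabilizer. *)
Lemma stab_half i s p : hausdorff_space M ->
  (forall u, integral_vector u -> forall q, rho u q = q) ->
  dom (A i) p -> s != 0 -> induced_field rho s i p = 0 ->
  exists j, half_lattice (half_vector R j) /\ rho (half_vector R j) p = p.
Proof.
move=> hausM hint ip s0 K0; have [r0 rD _ _] := hact.
apply: contrapT => nex.
pose P j (u : 'rV[R]_2) := half_lattice (half_vector R j) ->
  rho (half_vector R j + u) p <> p.
have P0 j : \forall u \near (0 : 'rV[R]_2), P j u.
  have [hj|nhj] := pselect (half_lattice (half_vector R j)); last first.
    by apply: filterE => u /nhj.
  have c : continuous_at (0 : 'rV[R]_2) (fun u => rho (half_vector R j + u) p).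
    apply: (@continuous_comp _ _ _ (fun u => half_vector R j + u) (rho^~ p)).
      by apply: continuousD; [exact: cst_continuous|exact: cvg_id].
    exact: rho_continuousl hact _ _.
  have /c : nbhs (rho (half_vector R j + 0) p) (~` [set p]).
    apply: open_nbhs_nbhs; split; last by rewrite addr0 => E; apply: nex; exists j.
    by apply: closed_openC; apply: accessible_closed_set1; exact: hausdorff_accessible.
  by move=> H; apply: (@filterS _ _ _ _ (P j) _ H) => u nu _ /nu.
have /nbhs_ballP[e /= e0 B] : \forall u \near (0 : 'rV[R]_2), forall j, P j u.
  exact: (@filter_forall _ _ P (nbhs (0 : 'rV[R]_2)) _ P0).
have [t [h [hh te]]] := line_near_half_lattice s0 e0.
have [j [y [hj hE]]] := half_lattice_rep hh.
have iy : integral_vector (map_mx intr (- y) : 'rV[R]_2) by exists (- y).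
apply: (B (t *: s - h) _ j hj).
  by rewrite -ball_normE /= sub0r normrN.
rewrite -[RHS](stab_line t ip K0) -[RHS](hint _ iy) -rD; congr (rho _ p).
by rewrite hE map_mxN opprD addrCA addNKr addrC.
Qed.

End Stabilizers.

Lemma derive_linear_form (R : realType) n (c : 'I_n -> R) (x v : 'rV[R]_n) :
  'D_v (fun y : 'rV[R]_n => \sum_a y 0 a * c a) x = \sum_a v 0 a * c a.
Proof.
apply: (@derive_linear_map R _ R) => k u u'.
by rewrite /= scaler_sumr -big_split; apply: eq_bigr => a _; rewrite !mxE mulrDl -mulrA.
Qed.

Lemma mulmx_row_linear (R : realType) m n (B : 'M[R]_(m, n)) :
  linear (fun y : 'rV[R]_m => y *m B).
Proof. by move=> k u v; rewrite mulmxDl scalemxAl. Qed.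

Lemma derive_affine (R : realType) (V W : normedModType R) (f : V -> W) (c : W) x v :
  linear f -> 'D_v (fun y => c + f y) x = f v.
Proof.
move=> lf; rewrite -(derive_linear_map x v lf) /derive.
have E : (fun h : R => h^-1 *: (((fun y => c + f y) \o shift x) (h *: v) - (c + f x)))
    = (fun h => h^-1 *: ((f \o shift x) (h *: v) - f x)).
  by apply/funext => h /=; rewrite opprD addrACA subrr add0r.
by rewrite E.
Qed.

(** * The differential of the moment map *)

Section Toric.
Variables (R : realType) (M : topologicalType) (A : atlas R M 4).
Variables (w : components A 'M[R]_4) (rho : 'rV[R]_2 -> M -> M).
Variables (mu : M -> 'rV[R]_2) (hM : symplectic_toric w rho mu).

Let hact : smooth_action A rho. Proof. by case: hM => _ [_ [? _] _ _]. Qed.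
Let hausM : hausdorff_space M. Proof. by case: hM => [[]]. Qed.

Lemma rho_integral u : integral_vector u -> forall q, rho u q = q.
Proof. by case: hM => _ [_ [_ h] _ _] /h. Qed.

Lemma rho_trivial_integral u : (forall q, rho u q = q) -> integral_vector u.
Proof. by case: hM => _ [_ [_ h] _ _] /h. Qed.

Lemma mu_rho s p : mu (rho s p) = mu p.
Proof. by case: hM => _ [_ _ _ [_ + _]]; apply. Qed.

Lemma w_unit i p : dom (A i) p -> w i p \in unitmx.
Proof. by case: hM => _ [[_ _ + _] _ _ _]; apply. Qed.

Lemma w_skew i p : dom (A i) p -> (w i p)^T = - w i p.
Proof. by case: hM => _ [[_ + _ _] _ _ _]; apply. Qed.

Lemma mu_smooth i : smooth_on (crd (A i) @` dom (A i)) (mu \o par (A i)).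
Proof.
by have [_ [_ _ _ [ms _ _]]] := hM; have := ms i; rewrite setIT.
Qed.

Lemma w_smooth i : smooth_on (crd (A i) @` dom (A i)) (w i \o par (A i)).
Proof.
by have [_ [[[_ ws] _ _ _] _ _ _]] := hM; have := ws i; rewrite setIT.
Qed.

Lemma mu_differentiable i p : dom (A i) p -> differentiable (mu \o par (A i)) (crd (A i) p).
Proof.
by move=> ip; exact: (C1_differentiable (@img_open _ _ _ (A i)) (crd_imgT ip) (mu_smooth i 1%N)).
Qed.

Definition Jmu i p : 'M[R]_(4, 2) := 'J (mu \o par (A i)) (crd (A i) p).

Lemma dfun_pairing s i p v : dom (A i) p ->
  dfun (A i) (fun q => pairing (mu q) s) p v = (v *m Jmu i p *m s^T) 0 0.
Proof.
move=> ip; have df := mu_differentiable ip.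
rewrite -(deriveEjacobian _ df) [RHS]mxE.
under eq_bigr do rewrite [s^T _ _]mxE.
rewrite -(derive_linear_form (fun a => s 0 a) ((mu \o par (A i)) (crd (A i) p))).
rewrite -(derive_comp _ df); last exact: differentiable_linear_form.
rewrite /dfun; congr ('D_v _ _); apply/funext => x /=.
by rewrite /pairing mxE; apply: eq_bigr => a _; rewrite mxE.
Qed.

Lemma induced_field_w s i p : dom (A i) p ->
  induced_field rho s i p *m w i p = - (s *m (Jmu i p)^T).
Proof.
move=> ip; apply/rowP => a.
have [_ _ /(_ s i p (delta_mx 0 a) ip)] : moment_map w rho mu by case: hM => _ [].
rewrite dfun_pairing // /bil trmx_delta -colE mxE => ->.
rewrite -rowE 2!mxE; congr (- _); rewrite !mxE; apply: eq_bigr => j _.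
by rewrite !mxE mulrC.
Qed.

Lemma induced_fieldE s i p : dom (A i) p ->
  induced_field rho s i p = - (s *m (Jmu i p)^T) *m invmx (w i p).
Proof. by move=> ip; rewrite -induced_field_w // mulmxK // w_unit. Qed.

(** [mu] is constant along orbits. *)
Lemma induced_field_mu s i p : dom (A i) p -> induced_field rho s i p *m Jmu i p = 0.
Proof.
move=> ip; have [r0 _ _ _] := hact.
have ip0 : dom (A i) (rho ((0 : R) *: s) p) by rewrite scale0r r0.
have d0 := orbit_differentiable hact ip0.
have df : differentiable (mu \o par (A i)) (crd (A i) (rho ((0 : R) *: s) p)).
  exact: mu_differentiable.
have := @derive_comp R R _ _ _ _ _ (1 : R) d0 df.
rewrite scale0r r0 (deriveEjacobian _ (mu_differentiable ip)) => E.
rewrite /induced_field /Jmu derive1E -E.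
rewrite -[RHS](@derive_cst R R _ (mu p) 0 1); apply: near_eq_derive.
have Oi : nbhs (rho ((0 : R) *: s) p) (dom (A i)).
  by apply: open_nbhs_nbhs; split=> //; exact: dom_open.
apply: filterS (near_orbit hact Oi) => h ih.
by rewrite /= crdK // mu_rho.
Qed.

(** A right inverse [B] of the differential spans a slice through [p] on which [mu] becomes a map of
    the plane with Jacobian 1. Such a map is open at the point, so [mu p] is interior to the
    image. *)
Lemma regular_Mring i p : dom (A i) p -> row_free (Jmu i p)^T -> Mring mu p.
Proof.
move=> ip /row_freeP[B0 HB0].
pose B := B0^T.
have HB : B *m Jmu i p = 1%:M by rewrite -[Jmu i p]trmxK -trmx_mul HB0 trmx1.
pose L (y : 'rV[R]_2) := crd (A i) p + y *m B.
pose U := L @^-1` (crd (A i) @` dom (A i)).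
have CL k V : open V -> Ck_on k V L.
  move=> oV; apply: (Ck_on_add oV); first exact: Ck_on_cst.
  by apply: (Ck_on_mulmx oV); [exact: Ck_on_id|exact: Ck_on_cst].
have Lc : continuous L by move=> x; have [+ _] := CL 0%N setT openT; apply.
have oU : open U by apply: open_comp => [x _|]; [exact: Lc|exact: img_open].
have L0 : L 0 = crd (A i) p by rewrite /L mul0mx addr0.
have U0 : U 0 by rewrite /U /= L0; exact: crd_imgT.
have dL : differentiable L 0 := C1_differentiable openT (I : setT 0) (CL 1%N setT openT).
have dmu' : differentiable (mu \o par (A i)) (L 0) by rewrite L0; exact: mu_differentiable.
pose F y := (mu \o par (A i)) (L y).
have FC : Ck_on 1 U F.
  exact: (Ck_on_comp oU (@img_open _ _ _ (A i)) (fun x => id) (CL 1%N U oU) (mu_smooth i 1%N)).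
have JF : 'J F 0 = 1%:M.
  rewrite [LHS](jacobian_comp dL dmu') L0 -HB; congr (_ *m _).
  apply: jacobianP => v; rewrite -(deriveE v dL).
  exact: (derive_affine _ _ _ (mulmx_row_linear B)).
have := open_map_id_jacobian oU U0 FC JF.
rewrite {1}/F L0 /= crdK //; apply: filterS => _ [y _ <-].
by exists (par (A i) (L y)).
Qed.

End Toric.

(** * Fixed points of involutions and density of the open part *)

Lemma closed_fixpoints (T : topologicalType) (g : T -> T) :
  hausdorff_space T -> continuous g -> closed [set q | g q = q].
Proof.
move=> hT gc p cp; apply: hT => U V Up Vp.
have gU : nbhs p (g @^-1` U) := gc _ _ Up.
have [q [qF [qU qV]]] := cp (g @^-1` U `&` V) (filterI gU Vp).
by exists q; split=> //; move: qU; rewrite /= qF.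
Qed.

(** The finite case of the Baire argument: if [O] is not inside the first closed set, what remains
    of [O] outside it is open, nonempty and covered by the others. *)
Lemma finite_closed_cover (T : topologicalType) (I : eqType) (l : seq I)
    (P : I -> set T) (O : set T) :
  (forall i, closed (P i)) -> open O -> O !=set0 ->
  (forall q, O q -> exists2 i, i \in l & P i q) ->
  exists i O', [/\ open O', O' !=set0 & O' `<=` P i].
Proof.
move=> cP; elim: l O => [|j l IH] O oO [q Oq] cov.
  by have [] := cov q Oq.
have [OP|nOP] := pselect (O `<=` P j); first by exists j, O; split=> //; exists q.
apply: (IH (O `&` ~` P j)).
- by apply: openI => //; exact: closed_openC.
- apply: contrapT => H; apply: nOP => x Ox; apply: contrapT => nP.
  by apply: H; exists x.
- move=> x [Ox nP]; have [i] := cov x Ox.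
  by rewrite inE => /predU1P[->//|il Pi]; exists i.
Qed.

Section Density.
Variables (R : realType) (M : topologicalType) (A : atlas R M 4).
Variables (w : components A 'M[R]_4) (rho : 'rV[R]_2 -> M -> M).
Variables (mu : M -> 'rV[R]_2) (hM : symplectic_toric w rho mu).

Let hact : smooth_action A rho. Proof. by case: hM => _ [_ [? _] _ _]. Qed.
Let hausM : hausdorff_space M. Proof. by case: hM => [[]]. Qed.

(** The Jacobian is 1 on the interior of the fixed set, and it depends continuously on the point. *)
Lemma involution_jacobian s p i :
  dom (A i) p -> rho s p = p -> closure (interior [set q | rho s q = q]) p ->
  'J (shift_map rho i i s) (crd (A i) p) = 1%:M.
Proof.
move=> ip sp clp; apply: contrapT => J1.
have oD := @open_shift_domain _ _ _ _ hact i i s.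
have Dp : shift_domain rho i i s (crd (A i) p) by exists p => //; split=> //=; rewrite sp.
have JC := Ck_on_jacobian oD (@Ck_on_shift _ _ _ _ hact 1 i i s).
have := JC.1 _ Dp => Jc.
have : nbhs ('J (shift_map rho i i s) (crd (A i) p)) (~` [set (1%:M : 'M[R]_4)]).
  apply: open_nbhs_nbhs; split=> //; apply: closed_openC.
  by apply: accessible_closed_set1; apply: hausdorff_accessible; exact: norm_hausdorff.
move=> /Jc /(crd_nbhs ip) /clp[q [Fq [iq /= Jq]]]; apply: Jq.
have sq : rho s q = q := interior_subset Fq.
have idd : differentiable (id : 'rV[R]_4 -> 'rV[R]_4) (crd (A i) q) by exact: ex_diff.
have [|_ <-] := near_eq_jacobian (g := shift_map rho i i s) _ idd.
  move: Fq => /(par_nbhs iq); apply: filterS => x [dx [xE /= fx]].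
  by rewrite /shift_map fx xE.
by apply: jacobianP => v; rewrite -(deriveE v idd) derive_id mulmx1.
Qed.

Lemma norm_double_small (V : normedModType R) (u : V) : `|u + u| <= 2^-1 * `|u| -> u = 0.
Proof.
rewrite -[u + u]mulr2n -scaler_nat normrZ ger0_norm // => H.
by apply/eqP; rewrite -normr_le0; lra.
Qed.

(** Let [p] be in the closure of the interior of the fixed set and [T] the involution in a chart.
    Its Jacobian at [p] is 1, so [f = T - id] is 1/2-Lipschitz near [p]. As [T (T x) = x], the
    difference [f x - f (T x)] is twice [T x - x], while its norm is at most half of [|T x - x|]; so
    [T x = x]. Hence that interior is also closed, and [M] is connected. *)
Lemma involution_trivial s (O : set M) :
  (forall q, rho s (rho s q) = q) -> open O -> O !=set0 ->
  (forall q, O q -> rho s q = q) -> forall q, rho s q = q.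
Proof.
move=> inv oO [q0 Oq0] Ofix.
have cM : connected [set: M] by case: hM => [[]].
pose F := interior [set q | rho s q = q].
suff : F = [set: M] by move=> FT q; apply: (@interior_subset _ [set q | rho s q = q]); rewrite -/F FT.
apply: cM.
- by exists q0; apply: (filterS Ofix); exact: open_nbhs_nbhs.
- by exists F; rewrite ?setTI //; exact: open_interior.
exists F; rewrite ?setTI // => p clp.
have sp : rho s p = p.
  apply: (closed_fixpoints hausM (@rho_continuous _ _ _ _ hact s)).
  by apply: closure_subset clp; exact: interior_subset.
have [i ip] := cht_cover A p.
have J1 := involution_jacobian ip sp clp.
have oD := @open_shift_domain _ _ _ _ hact i i s.
pose T := shift_map rho i i s; pose D := shift_domain rho i i s.
have Dp : D (crd (A i) p) by exists p => //; split=> //=; rewrite sp.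
have TC : Ck_on 1 D T := @Ck_on_shift _ _ _ _ hact 1 i i s.
have fid : Ck_on 1 D (fun y : 'rV[R]_4 => - y) := Ck_on_opp oD (@Ck_on_id _ _ 1 D).
pose f y := T y - y.
have fC : Ck_on 1 D f := Ck_on_add oD TC fid.
have dT := C1_differentiable oD Dp TC.
have df := C1_differentiable oD Dp fC.
have Jf : 'J f (crd (A i) p) = 0.
  apply/row_matrixP => a; rewrite (jacobian_row _ df) row0.
  have dTa := @diff_derivable _ _ _ T (crd (A i) p) (delta_mx 0 a) dT.
  have idd : derivable (id : 'rV[R]_4 -> 'rV[R]_4) (crd (A i) p) (delta_mx 0 a) by exact: derivable_id.
  rewrite [LHS](deriveB dTa idd) derive_id.
  by rewrite (deriveEjacobian _ dT) J1 mulmx1 subrr.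
have h2 : 0 < 2^-1 :> R by rewrite invr_gt0.
have [r r0 [BD L]] := lipschitz_of_flat oD Dp fC Jf h2.
have Tp : T (crd (A i) p) = crd (A i) p by rewrite /T /shift_map crdK // sp.
have Tc := TC.1 _ Dp.
have Br : nbhs (T (crd (A i) p)) (ball (crd (A i) p) r) by rewrite Tp; exact: nbhsx_ballx.
have Tn : nbhs (crd (A i) p) (T @^-1` ball (crd (A i) p) r) := Tc _ Br.
have near1 : nbhs (crd (A i) p) (ball (crd (A i) p) r `&` T @^-1` ball (crd (A i) p) r).
  by apply: filterI Tn; exact: nbhsx_ballx.
suff fixp : \forall q \near p, rho s q = q by exact: fixp.
apply: filterS (crd_nbhs ip near1) => q [iq [xB /= TB]].
have [ix jx _] := crd_img_par (BD _ xB).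
have TT : T (T (crd (A i) q)) = crd (A i) q.
  by rewrite /T /shift_map crdK // crdK ?inv //; move: jx; rewrite /= crdK.
have := L _ _ xB TB; rewrite /f TT.
rewrite (opprB (crd (A i) q)) (distrC (crd (A i) q)) => /norm_double_small /eqP.
rewrite subr_eq0 /T /shift_map crdK // => /eqP /(congr1 (par (A i))).
by rewrite !crdK //; move: jx; rewrite /= crdK.
Qed.

Lemma Mring_dense (O : set M) : open O -> O !=set0 -> exists2 q, O q & Mring mu q.
Proof.
move=> oO O0; apply: contrapT => nO.
pose P (j : bool * bool) := [set q | half_lattice (half_vector R j) /\
                                     rho (half_vector R j) q = q].
have cP j : closed (P j).
  have [hj|nhj] := pselect (half_lattice (half_vector R j)).
    rewrite (_ : P j = [set q | rho (half_vector R j) q = q]).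
      exact: closed_fixpoints (@rho_continuous _ _ _ _ hact _).
    by apply/seteqP; split=> q /=; [case|].
  by rewrite (_ : P j = set0); [exact: closed0|apply/seteqP; split=> // q []].
have cov q : O q -> exists2 j, j \in enum {: bool * bool} & P j q.
  move=> Oq; have [i iq] := cht_cover A q.
  have : ~~ row_free (Jmu mu i q)^T.
    by apply/negP => rf; apply: nO; exists q => //; exact: (regular_Mring hM iq rf).
  rewrite -kermx_eq0 => /rowV0Pn[s /sub_kermxP sJ s0].
  have [|j Pj] := stab_half hact hausM (rho_integral hM) iq s0.
    by rewrite (induced_fieldE hM) // sJ oppr0 mul0mx.
  by exists j => //; rewrite mem_enum.
(* Finitely many closed fixed-point sets cover [O], so one of them contains a nonempty open set. *)
have [j [V' [oV [q V'q] V'P]]] := finite_closed_cover cP oO O0 cov.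
have [hj _] := V'P _ V'q.
have inv x : rho (half_vector R j) (rho (half_vector R j) x) = x.
  have [_ rD _ _] := hact; rewrite -rD; apply: (rho_integral hM).
  by have [z zE _] := hj; exists z; rewrite zE; apply/rowP => b; rewrite !mxE; field.
apply: (half_lattice_nint hj); apply: (rho_trivial_integral hM).
apply: (@involution_trivial _ V') => //; first by exists q.
by move=> x /V'P[].
Qed.

End Density.

(** * Adapted frames *)

Lemma ord2P (i : 'I_2) : i = 0 \/ i = 1.
Proof. by case: i => -[|[|//]] ?; [left|right]; apply/val_inj. Qed.

Section Mx2.
Variable F : fieldType.
Implicit Types P : 'M[F]_2.

Lemma mx2_eq P (Q : 'M[F]_2) : P 0 0 = Q 0 0 -> P 0 1 = Q 0 1 ->
  P 1 0 = Q 1 0 -> P 1 1 = Q 1 1 -> P = Q.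
Proof.
move=> e00 e01 e10 e11; apply/matrixP => i j.
by case: (ord2P i) => ->; case: (ord2P j) => ->.
Qed.

Lemma sum2 (f : 'I_2 -> F) : \sum_i f i = f 0 + f 1.
Proof.
by rewrite !big_ord_recl big_ord0 addr0; congr (f _ + f _); apply/val_inj.
Qed.

Lemma det2 P : \det P = P 0 0 * P 1 1 - P 0 1 * P 1 0.
Proof.
rewrite (expand_det_row _ 0) sum2 /cofactor !det_mx11 !mxE /=.
have -> : lift 0 0 = 1 :> 'I_2 by apply/val_inj.
have -> : lift 1 0 = 0 :> 'I_2 by apply/val_inj.
by rewrite expr0 expr1 mul1r mulN1r mulrN.
Qed.

Lemma invmx2 P : P \in unitmx ->
  [/\ invmx P 0 0 = P 1 1 / \det P, invmx P 0 1 = - P 0 1 / \det P,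
      invmx P 1 0 = - P 1 0 / \det P & invmx P 1 1 = P 0 0 / \det P].
Proof.
move=> PU; have d0 : \det P != 0 by rewrite -unitfE -unitmxE.
pose Q : 'M[F]_2 := \matrix_(i, j) (if i == 0 then (if j == 0 then P 1 1 else - P 0 1)
   else (if j == 0 then - P 1 0 else P 0 0)).
have E : P *m Q = (\det P)%:M.
  by apply: mx2_eq; rewrite !mxE sum2 !mxE /= det2; ring.
have -> : invmx P = (\det P)^-1 *: Q.
  rewrite -[Q](mulKmx PU) E mul_mx_scalar scalerA mulVf // scale1r //.
by split; rewrite !mxE /= mulrC.
Qed.
End Mx2.

(** * Linear algebra in a frame of dual fields and forms *)

Section Frame.
Variable F : numFieldType.
Variables (U K : 'M[F]_(2, 2 + 2)) (m tau : 'M[F]_(2 + 2, 2)).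
Hypothesis frameK : col_mx U K *m row_mx m tau = 1%:M.
Hypothesis frameV : row_mx m tau *m col_mx U K = 1%:M.

(** The endomorphism with matrix [B] in the frame. The rows of [U] and [K] stand for the fields
    [d/dmu] and [d/dt], the columns of [m] and [tau] for the forms [d mu] and [dt]. *)
Definition fr (B : 'M[F]_(2 + 2)) : 'M[F]_(2 + 2) := row_mx m tau *m B *m col_mx U K.

Lemma frM B B' : fr B *m fr B' = fr (B *m B').
Proof. by rewrite /fr !mulmxA -(mulmxA _ (col_mx U K)) frameK mulmx1. Qed.

Lemma frD B B' : fr B + fr B' = fr (B + B').
Proof. by rewrite /fr mulmxDr mulmxDl. Qed.

Lemma frN B : - fr B = fr (- B).
Proof. by rewrite /fr mulmxN mulNmx. Qed.

Lemma frB B B' : fr B - fr B' = fr (B - B').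
Proof. by rewrite frN frD. Qed.

Lemma fr_scalar a : fr a%:M = a%:M.
Proof. by rewrite /fr mul_mx_scalar -scalemxAl frameV scalemx1. Qed.

Lemma fr_block (X Y Z W : 'M[F]_2) :
  fr (block_mx X Y Z W) = m *m X *m U + tau *m Z *m U + (m *m Y *m K + tau *m W *m K).
Proof. by rewrite /fr mul_row_block mul_row_col !mulmxDl. Qed.

Lemma mxtrace_fr B : \tr (fr B) = \tr B.
Proof. by rewrite /fr mxtrace_mulC mulmxA frameK mul1mx. Qed.

(** The rows are the images of the frame fields, whence the transposes. The block of the adjoint
    below is the same block for [- P^T] in place of [P]. *)
Definition Jblock (P : 'M[F]_2) : 'M[F]_(2 + 2) := block_mx 0 P^T (- (invmx P)^T) 0.
Definition Jblock_adj (P : 'M[F]_2) : 'M[F]_(2 + 2) := block_mx 0 (- P) (invmx P) 0.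

Lemma frameE : [/\ U *m m = 1%:M, U *m tau = 0, K *m m = 0 & K *m tau = 1%:M].
Proof.
by move: frameK; rewrite mul_col_row scalar_mx_block => /eq_block_mx.
Qed.

Lemma fr_Jblock P : fr (Jblock P) = m *m P^T *m K - tau *m (invmx P)^T *m U.
Proof. by rewrite fr_block !mulmx0 !mul0mx add0r addr0 mulmxN mulNmx addrC. Qed.

(** This block is read off with [K] and [m] alone, the half of the frame that makes sense on all of
    [M]. *)
Lemma K_fr_m (X Y Z W : 'M[F]_2) : K *m fr (block_mx X Y Z W) *m m = Z.
Proof.
have [Um Ut Km Kt] := frameE.
rewrite fr_block !mulmxDr !mulmxDl !mulmxA Km Kt !mul0mx !mul1mx.
by rewrite -!(mulmxA _ _ m) Um Km !mulmx0 !mulmx1 !addr0 add0r.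
Qed.

Definition Omega : 'M[F]_(2 + 2) := block_mx 0 1%:M (- 1%:M) 0.

(** The moment map equation [K *m w = - m^T] determines every block of [w] except the one of [U]
    against itself, which the last hypothesis supplies. *)
Lemma skew_frame (w : 'M[F]_(2 + 2)) : w^T = - w -> K *m w = - m^T -> U *m w *m U^T = 0 ->
  w = row_mx m tau *m Omega *m (row_mx m tau)^T.
Proof.
move=> wT Kw UwU; have [Um Ut Km Kt] := frameE.
have E : col_mx U K *m w *m (col_mx U K)^T = Omega.
  rewrite tr_col_mx mul_col_mx mul_col_row UwU Kw.
  have -> : - m^T *m K^T = 0 by rewrite mulNmx -trmx_mul Km trmx0 oppr0.
  have -> : - m^T *m U^T = - 1%:M by rewrite mulNmx -trmx_mul Um trmx1.
  have wK : w *m K^T = m by rewrite -[w]opprK -wT mulNmx -trmx_mul Kw linearN /= trmxK opprK.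
  by rewrite -mulmxA wK Um.
rewrite -E !mulmxA frameV mul1mx -mulmxA -trmx_mul frameV trmx1 mulmx1 //.
Qed.

Lemma fr_adjoint (w : 'M[F]_(2 + 2)) (P : 'M[F]_2) :
  w = row_mx m tau *m Omega *m (row_mx m tau)^T -> w \in unitmx ->
  w^T = - w -> (invmx w *m fr (Jblock P) *m w)^T = fr (Jblock_adj P).
Proof.
move=> wE wU wT.
have wTU : w^T \in unitmx by rewrite unitmx_tr.
rewrite !trmx_mul trmx_inv mulmxA; apply: (can_inj (mulmxK wTU)).
rewrite mulmxKV // wT mulNmx mulmxN; congr (- _).
rewrite {1}wE wE /fr !mulmxA.
rewrite -!(mulmxA _ (row_mx m tau)^T (col_mx U K)^T) -trmx_mul frameK trmx1 mulmx1.
rewrite -!(mulmxA _ (col_mx U K) (row_mx m tau)) frameK mulmx1.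
congr (_ *m _); rewrite -!mulmxA; congr (_ *m _).
rewrite /Omega /Jblock /Jblock_adj tr_block_mx !mulmx_block !trmx0 trmxK.
rewrite !mul0mx !mulmx0 !mul1mx !addr0 !add0r !mulmx1 !mulmxN !mulmx1 !linearN /= trmxK.
by rewrite !opprK mulNmx mul1mx opprK.
Qed.

(** With [J = fr (Jblock P)], one has [J *m m = - tau *m (invmx P)^T] and
    [K *m adj J = invmx P *m U]. Between these factors, the transpose of the matrix of C2 becomes
    [(invmx P0)^T - (invmx P)^T], exactly the change of the lower left block; C1 gives the change of
    the upper right one. *)
Lemma fr_update (P P0 : 'M[F]_2) : P \in unitmx -> P0 \in unitmx ->
  fr (Jblock P) + m *m (P0 - P)^T *m K
   + fr (Jblock P) *m m *m (P^T *m invmx P0 *m P - P^T)^T *m K *m fr (Jblock_adj P)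
  = fr (Jblock P0).
Proof.
move=> PU P0U.
have E (X : 'M[F]_2) : m *m X *m K = fr (block_mx 0 X 0 0).
  by rewrite fr_block !mulmx0 !mul0mx !addr0 !add0r.
have E3 X : fr (Jblock P) *m m *m X *m K *m fr (Jblock_adj P)
    = fr (Jblock P *m block_mx 0 X 0 0 *m Jblock_adj P).
  by rewrite -!frM -E !mulmxA.
rewrite E3 E !frD; congr fr.
rewrite /Jblock /Jblock_adj !mulmx_block !add_block_mx.
rewrite !mulmx0 !mul0mx !addr0 !add0r.
have PtU : P^T \in unitmx by rewrite unitmx_tr.
congr block_mx; rewrite ?mul0mx //.
  by rewrite addr0 linearB /= addrC subrK.
rewrite mulNmx mulNmx -opprD; congr (- _).
rewrite [(P^T *m _ *m P - _)^T]linearB /= !trmx_mul trmxK !trmx_inv mulmxBr mulmxBl.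
rewrite !mulmxA mulVmx // mul1mx mulmxK // -mulmxA mulmxV // mulmx1.
by rewrite addrC subrK.
Qed.

(** Let [S] be the symmetric part of [P] and [a] the antisymmetric entry. In size 2 the adjugate is
    linear, so the symmetric part of [invmx P] is the adjugate of [S] over [det P]; the product is
    the scalar [det S / det P = 1 - h], because [det P = det S + a^2]. The trace formula recovers
    [h] from [J] and its adjoint without a frame. *)
Lemma frame_tamed_defect (P : 'M[F]_2) : P \in unitmx ->
  let h := ((P 0 1 - P 1 0) / 2) ^+ 2 / \det P in
  (fr (Jblock P) - fr (Jblock_adj P)) *m (fr (Jblock P) - fr (Jblock_adj P))
    = (- 4 * (1 - h))%:M
  /\ \tr (fr (Jblock P) *m fr (Jblock_adj P)) = 4 - 8 * h.
Proof.
move=> PU h.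
have d0 : P 0 0 * P 1 1 - P 0 1 * P 1 0 != 0 by rewrite -det2 -unitfE -unitmxE.
have [i00 i01 i10 i11] := invmx2 PU.
rewrite frB !frM mxtrace_fr; split.
  rewrite -fr_scalar; congr fr.
  rewrite /Jblock /Jblock_adj opp_block_mx add_block_mx mulmx_block.
  rewrite !oppr0 !addr0 !mulmx0 !mul0mx !addr0 !add0r opprK scalar_mx_block.
  congr block_mx; apply: mx2_eq; rewrite !mxE !sum2 !mxE ?i00 ?i01 ?i10 ?i11 /h ?det2 /=; field;
    exact: d0.
rewrite /Jblock /Jblock_adj mulmx_block mxtrace_block !mul0mx !addr0 !add0r.
rewrite /mxtrace !sum2 !mxE !sum2 !mxE ?i00 ?i01 ?i10 ?i11 /h ?det2; field; exact: d0.
Qed.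

End Frame.

(** * The frame of an admissible chart *)

Section ToricFrame.
Variables (R : realType) (M : topologicalType) (A : atlas R M 4).
Variables (w : components A 'M[R]_4) (rho : 'rV[R]_2 -> M -> M).
Variables (mu : M -> 'rV[R]_2) (hM : symplectic_toric w rho mu).
Variable xi : 'M[R]_2.

Definition dmu i p : 'M[R]_(2 + 2, 2) := Jmu (A := A) mu i p *m xi^T.

Lemma dmuE i p v a : dom (A i) p ->
  (v *m dmu i p) 0 a = dfun (A i) (fun q => pairing (mu q) (row a xi)) p v.
Proof.
move=> ip; rewrite (dfun_pairing hM) // /dmu mulmxA !mxE.
by apply: eq_bigr => j _; rewrite !mxE.
Qed.

Lemma Kdist_w i p : dom (A i) p -> Kdist rho xi i p *m w i p = - (dmu i p)^T.
Proof.
move=> ip; apply/row_matrixP => j.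
rewrite row_mul rowK (induced_field_w hM) // /dmu trmx_mul trmxK -row_mul.
by apply/rowP => b; rewrite !mxE.
Qed.

Lemma Kdist_dmu i p : dom (A i) p -> Kdist rho xi i p *m dmu i p = 0.
Proof.
move=> ip; apply/row_matrixP => j.
by rewrite row_mul rowK /dmu mulmxA (induced_field_mu hM) // mul0mx row0.
Qed.

Lemma KdistE i p : dom (A i) p -> Kdist rho xi i p = - (dmu i p)^T *m invmx (w i p).
Proof. by move=> ip; rewrite -Kdist_w // mulmxK // (w_unit hM). Qed.

Lemma near_dfun i p (f g : M -> R) v : dom (A i) p ->
  (\forall q \near p, f q = g q) -> dfun (A i) f p v = dfun (A i) g p v.
Proof.
move=> ip fg; apply: near_eq_derive.
by have := par_nbhs ip fg; apply: filterS => x [_ [_]].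
Qed.

(** The lower rows need an argument, since replacing the other two coordinates can change the fields
    [d/dt]. Here [d mu (K) = 0], and [dt (K) = 1] is computed in the holomorphic chart [c0], which
    has the same [t]; these values determine [K]. *)
Lemma admissible_frame (J1 : components A 'M[R]_4) c i p :
  admissible_chart rho mu xi J1 c -> dom c p -> dom (A i) p ->
  (trans c (A i) p : 'M[R]_(2 + 2)) =
    col_mx (usubmx (trans c (A i) p : 'M[R]_(2 + 2))) (Kdist rho xi i p)
  /\ (trans (A i) c p : 'M[R]_(2 + 2)) =
    row_mx (dmu i p) (rsubmx (trans (A i) c p : 'M[R]_(2 + 2))).
Proof.
move=> [lc cring cmu [c0 [[lc0 hol] c0c ct]]] cp ip.
have c0p : dom c0 p by rewrite c0c.
have [sic sci] := lc i; have [sic0 sc0i] := lc0 i.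
have nc (P : M -> Prop) : (forall q, dom c q -> P q) -> \forall q \near p, P q.
  by move=> H; apply: filterS H _; apply: open_nbhs_nbhs; split=> //; exact: dom_open.
pose T : 'M[R]_(2 + 2) := trans (A i) c p.
have lT : lsubmx T = dmu i p.
  apply/matrixP => b a; rewrite [LHS]mxE.
  have -> : T b (lshift 2 a) = ((delta_mx 0 b : 'rV[R]_4) *m T) 0 (fst2 a) by rewrite -rowE [RHS]mxE.
  rewrite /T -(coord_formE _ _ sic cp ip) /coord_form.
  rewrite (near_dfun (g := fun q => pairing (mu q) (row a xi))) //; last first.
    by apply: nc => q cq; rewrite cmu.
  by rewrite -dmuE // -rowE mxE.
have Kt : Kdist rho xi i p *m rsubmx T = 1%:M.
  apply/matrixP => j k.
  have -> : (Kdist rho xi i p *m rsubmx T) j k = (row j (Kdist rho xi i p) *m T) 0 (snd2 k).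
    by rewrite !mxE; apply: eq_bigr => a _; rewrite !mxE.
  rewrite rowK /T -(coord_formE _ _ sic cp ip) /coord_form.
  rewrite (near_dfun (g := fun q => crd c0 q 0 (snd2 k))) //; last first.
    by apply: nc => q cq; rewrite ct.
  rewrite -/(coord_form c0 (A i) (snd2 k) p _) (coord_formE _ _ sic0 c0p ip).
  have [_ _ <-] := hol i p j c0p ip.
  rewrite (coord_fieldE _ sc0i c0p ip) -row_mul (transK sc0i sic0 c0p ip) !mxE.
  by rewrite (inj_eq (@rshift_inj 2 2)).
have TE : T = row_mx (dmu i p) (rsubmx T) by rewrite -lT hsubmxK.
split=> //.
pose S : 'M[R]_(2 + 2) := trans c (A i) p.
have TS : T *m S = 1%:M := transK sic sci ip cp.
rewrite -/S -{1}[S]vsubmxK; congr col_mx.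
have -> : dsubmx S = row_mx 0 1%:M *m S.
  by rewrite -[S in RHS]vsubmxK mul_row_col mul0mx mul1mx add0r.
have <- : Kdist rho xi i p *m T = row_mx 0 1%:M.
  by rewrite TE mul_mx_row Kdist_dmu // Kt.
by rewrite -mulmxA TS mulmx1.
Qed.

Lemma given_by_frame (C : set (chart R M 4)) (J1 J : components A 'M[R]_4) Psi c i p :
  admissible_chart rho mu xi J1 c -> given_by mu C J Psi -> C c -> dom c p -> dom (A i) p ->
  Psi (mu p) \in unitmx /\
  J i p = fr (usubmx (trans c (A i) p : 'M[R]_(2 + 2))) (Kdist rho xi i p)
     (dmu i p) (rsubmx (trans (A i) c p : 'M[R]_(2 + 2))) (Jblock (Psi (mu p))).
Proof.
move=> ac gJ Cc cp ip; have [cE dE] := admissible_frame ac cp ip.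
have [sic sci] : smooth_transition (A i) c /\ smooth_transition c (A i) by case: ac => /(_ i).
have [PU _] := gJ c Cc i p 0 cp ip; split=> //.
rewrite fr_Jblock.
set U := usubmx _; set tau := rsubmx _.
have F1 v b : coord_form c (A i) (fst2 b) p v = (v *m dmu i p) 0 b.
  rewrite (coord_formE _ _ sic cp ip) dE -/tau.
  transitivity ((row_mx (v *m dmu i p) (v *m tau)) 0 (lshift 2 b)); last by rewrite row_mxEl.
  by rewrite -mul_mx_row.
have F2 v b : coord_form c (A i) (snd2 b) p v = (v *m tau) 0 b.
  rewrite (coord_formE _ _ sic cp ip) dE -/tau.
  transitivity ((row_mx (v *m dmu i p) (v *m tau)) 0 (rshift 2 b)); last by rewrite row_mxEr.
  by rewrite -mul_mx_row.
have F3 a : coord_field c (A i) (fst2 a) p = row a U.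
  by rewrite (coord_fieldE _ sci cp ip) cE -/U; apply/rowP => b; rewrite [LHS]mxE [RHS]mxE; exact: (@col_mxEu _ 2 2 4 U).
have F4 a : coord_field c (A i) (snd2 a) p = row a (Kdist rho xi i p).
  by rewrite (coord_fieldE _ sci cp ip) cE; apply/rowP => b; rewrite [LHS]mxE [RHS]mxE; exact: (@col_mxEd _ 2 2 4 U).
have S (P : 'M[R]_2) (Y : 'M[R]_(2, 4)) (f : 'I_2 -> R) (g : 'I_2 -> 'rV[R]_4) (u : 'rV[R]_2) :
    (forall b, f b = u 0 b) -> (forall a, g a = row a Y) ->
    \sum_(a < 2) \sum_(b < 2) (P a b * f b) *: g a = u *m P^T *m Y.
  move=> fE gE; rewrite [RHS]mulmx_sum_row; apply: eq_bigr => a _.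
  rewrite -scaler_suml gE; congr (_ *: _); rewrite [RHS]mxE.
  by apply: eq_bigr => b _; rewrite fE [P^T _ _]mxE mulrC.
apply/row_matrixP => a; rewrite rowE [RHS]rowE.
move: (delta_mx 0 a : 'rV[R]_4) => v.
have [_ ->] := gJ c Cc i p v cp ip.
rewrite mulmxBr !mulmxA; congr (_ - _).
  by apply: S => b; [rewrite F1 /dmu mulmxA|exact: F4].
apply: S => b; [exact: F2|exact: F3].
Qed.

End ToricFrame.

Section FrameDGK.
Variable F : numFieldType.
Variables (U K : 'M[F]_(2, 2 + 2)) (m tau : 'M[F]_(2 + 2, 2)).
Hypothesis frameK : col_mx U K *m row_mx m tau = 1%:M.

(* [J^* K = J K] makes the span of the [d/dmu^j], which is [J K], isotropic. *)
Lemma DGK_isotropic (w J : 'M[F]_(2 + 2)) (P : 'M[F]_2) :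
  w \in unitmx -> K *m w = - m^T -> P \in unitmx ->
  J = fr U K m tau (Jblock P) -> J *m J = - 1%:M ->
  (K *m (invmx w *m J *m w)^T == K *m J)%MS ->
  w^T = - w -> U *m w *m U^T = 0.
Proof.
move=> wU Kw PU JE JJ /andP[_ /submxP[Z ZE]] wT.
have [Um Ut Km Kt] := frameE frameK.
set S := (invmx w *m J *m w)^T in ZE.
have wTU : w^T \in unitmx by rewrite unitmx_tr.
have Sw : S *m w = w *m J^T.
  apply: oppr_inj; rewrite -mulmxN -mulNmx -wT.
  by rewrite /S !trmx_mul trmx_inv mulmxA mulmxKV // wT !mulNmx.
have SS : S *m S = - 1%:M.
  apply: (can_inj (mulmxK wU)); rewrite -mulmxA Sw mulmxA Sw -mulmxA -trmx_mul JJ.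
  by rewrite linearN /= trmx1 mulmxN mulmx1 mulNmx mul1mx.
have UE : U = - P^T *m (K *m J).
  rewrite JE fr_Jblock mulmxBr !mulmxA Km Kt mul1mx !mul0mx sub0r mulmxN mulNmx opprK.
  by rewrite mulmxA -trmx_mul mulVmx // trmx1 mul1mx.
(* [w(JK, JK) = w((adj J) JK, K)]; writing [JK] as [Z] times [(adj J) K] turns [(adj J) JK] into
   [- Z K], and [w(K, K) = 0]. *)
have X0 : K *m J *m w *m J^T *m K^T = 0.
  rewrite -(mulmxA _ w) -Sw ZE -!mulmxA (mulmxA S S) SS mulNmx mul1mx mulmxN (mulmxA K) Kw.
  by rewrite mulNmx -trmx_mul Km trmx0 oppr0 oppr0 mulmx0.
have -> : U *m w *m U^T = - P^T *m (K *m J *m w *m J^T *m K^T) *m (- P^T)^T.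
  by rewrite UE !trmx_mul !mulmxA.
by rewrite X0 mulmx0 mul0mx.
Qed.

End FrameDGK.

Section MringFrame.
Variables (R : realType) (M : topologicalType) (A : atlas R M 4).
Variables (w : components A 'M[R]_4) (rho : 'rV[R]_2 -> M -> M).
Variables (mu : M -> 'rV[R]_2) (hM : symplectic_toric w rho mu).
Variables (xi : 'M[R]_2) (C : set (chart R M 4)).
Hypothesis hC : admissible_coordinates w rho mu xi C.
Variables (N : set M) (J : components A 'M[R]_4) (Psi : 'rV[R]_2 -> 'M[R]_2).
Hypotheses (hJ : DGK w rho mu xi N J) (hPsi : given_by mu C J Psi).

Definition adapted_frame i p (U K : 'M[R]_(2, 2 + 2)) (m tau : 'M[R]_(2 + 2, 2)) :=
  [/\ col_mx U K *m row_mx m tau = 1%:M, row_mx m tau *m col_mx U K = 1%:M,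
      K = Kdist rho xi i p, m = dmu (A := A) mu xi i p & 
      (w i p : 'M[R]_(2 + 2)) = row_mx m tau *m Omega R *m (row_mx m tau)^T].

Lemma adapted_form U K m tau i p : dom (A i) p -> adapted_frame i p U K m tau ->
  forall P, J i p = fr U K m tau (Jblock P) ->
  w_adjoint w J i p = fr U K m tau (Jblock_adj P).
Proof.
move=> ip [fK fV _ _ wE] P JE; rewrite /w_adjoint JE.
by apply: fr_adjoint => //; [exact: (w_unit hM)|exact: (w_skew hM)].
Qed.

(** The duality of fields and forms comes from the chart, the standard form of [w] from
    [DGK_isotropic] applied to [J]. The set [N] is general so that both given structures are
    covered, in the same frame. *)
Lemma Mring_frame c i p : N p -> Mring mu p -> C c -> dom c p -> dom (A i) p ->
  Psi (mu p) \in unitmx /\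
  let U := usubmx (trans c (A i) p : 'M[R]_(2 + 2)) in
  let tau := rsubmx (trans (A i) c p : 'M[R]_(2 + 2)) in
  adapted_frame i p U (Kdist rho xi i p) (dmu mu xi i p) tau /\
  J i p = fr U (Kdist rho xi i p) (dmu mu xi i p) tau (Jblock (Psi (mu p))).
Proof.
move=> Np Rp Cc cp ip.
have [J1 [_ /(_ c Cc) ac _]] := hC.
have [PU JE] := given_by_frame hM ac hPsi Cc cp ip.
split=> // U tau; split=> //.
have [cE dE] := admissible_frame hM ac cp ip.
have [sic sci] : smooth_transition (A i) c /\ smooth_transition c (A i) by case: ac => /(_ i).
have fK : col_mx U (Kdist rho xi i p) *m row_mx (dmu mu xi i p) tau = 1%:M.
  by rewrite -cE -dE; exact: transK.
have fV : row_mx (dmu mu xi i p) tau *m col_mx U (Kdist rho xi i p) = 1%:M.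
  by rewrite -cE -dE; exact: transK.
split=> //.
have wT := w_skew hM ip; have wU := w_unit hM ip.
have [[[_ JJ] _ _ _ _] /(_ i p Rp ip) dgk] := hJ.
have Kw := Kdist_w hM xi ip.
apply: (skew_frame fK fV wT Kw).
exact: (DGK_isotropic fK wU Kw PU JE (JJ _ _ Np ip) dgk wT).
Qed.

End MringFrame.

(** * The Nijenhuis tensor in admissible coordinates *)

Lemma differentiable_mulmx (R : realType) (V : normedModType R) m n l
    (f : V -> 'M[R]_(m, n)) (g : V -> 'M[R]_(n, l)) x :
  differentiable f x -> differentiable g x -> differentiable (fun y => f y *m g y) x.
Proof.
move=> df dg; apply: differentiable_mx => a b.
rewrite (_ : (fun y => _) = \sum_(j < n) ((fun y => f y a j) * (fun y => g y j b))).
  by apply: differentiable_sum => j; apply: differentiableM; exact: differentiable_entry.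
by apply/funext => y; rewrite mxE fct_sumE.
Qed.

Lemma derive_mulmx (R : realType) (V : normedModType R) m n l
    (f : V -> 'M[R]_(m, n)) (g : V -> 'M[R]_(n, l)) x v :
  differentiable f x -> differentiable g x ->
  'D_v (fun y => f y *m g y) x = 'D_v f x *m g x + f x *m 'D_v g x.
Proof.
move=> df dg.
have dfe i j : derivable (fun y => f y i j) x v.
  exact/diff_derivable/differentiable_entry.
have dge i j : derivable (fun y => g y i j) x v.
  exact/diff_derivable/differentiable_entry.
have E i k : (fun y => (f y *m g y) i k) = \sum_(j < n) ((fun y => f y i j) * (fun y => g y j k)).
  by apply/funext => y; rewrite mxE fct_sumE.
have dp i k (j : 'I_n) : derivable ((fun y => f y i j) * (fun y => g y j k)) x v.
  exact: derivableM.
have dfg : derivable (fun y => f y *m g y) x v.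
  by apply/derivable_mxP => i k; rewrite E; apply: derivable_sum => j; exact: dp.
rewrite (derive_mx dfg) (derive_mx (diff_derivable df)) (derive_mx (diff_derivable dg)).
apply/matrixP => i k; rewrite !mxE E derive_sum; last by move=> j; exact: dp.
rewrite -big_split; apply: eq_bigr => j _; rewrite !mxE.
rewrite (deriveM (dfe i j) (dge j k)) addrC; congr (_ + _).
by rewrite [LHS]mulrC.
Qed.

Lemma derive_entry (R : realType) (V : normedModType R) m n (f : V -> 'M[R]_(m, n))
    x v i j : differentiable f x -> ('D_v f x) i j = 'D_v (fun y => f y i j) x.
Proof. by move=> df; rewrite (derive_mx (@diff_derivable _ _ _ _ _ v df)) mxE. Qed.

Lemma sub_add_eq (V : zmodType) (a b u v : V) : u = v -> a + u - (b + v) = a - b.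
Proof. by move=> ->; rewrite opprD addrACA subrr addr0. Qed.

(** * Lie brackets in arbitrary local coordinates *)

Section Bracket.
Variables (R : realType) (M : topologicalType) (A : atlas R M 4) (c : chart R M 4).
Hypothesis lc : local_coordinates A c.

Let sic i : smooth_transition (A i) c. Proof. by case: (lc i). Qed.
Let sci i : smooth_transition c (A i). Proof. by case: (lc i). Qed.

Let open_ci i : open (crd c @` (dom c `&` dom (A i))).
Proof. by apply: open_crd_img; exact: dom_open. Qed.

Let open_ic i : open (crd (A i) @` (dom (A i) `&` dom c)).
Proof. by apply: open_crd_img; exact: dom_open. Qed.

Definition Tmx i (y : 'rV[R]_4) : 'M[R]_4 := 'J (crd (A i) \o par c) y.

Lemma Ck_on_Tmx k i : Ck_on k (crd c @` (dom c `&` dom (A i))) (Tmx i).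
Proof. exact: (@Ck_on_jacobian R 4 4 k _ (crd (A i) \o par c) (@open_ci i) (@sci i k.+1)). Qed.

(** Fields with constant components in [c], written in the charts of [A], since integrability is
    tested on fields given there. *)
Definition cst_field (v : 'rV[R]_4) : components A 'rV[R]_4 :=
  fun i p => v *m trans c (A i) p.

Lemma vector_field_cst v : vector_field (dom c) (cst_field v).
Proof.
split=> [i j p cp ip jp|i k].
  have sij : smooth_transition (A i) (A j) := cht_transition i j.
  by rewrite /cst_field (changeE _ sij ip jp) -mulmxA -trans_comp.
have H : Ck_on k (crd (A i) @` (dom (A i) `&` dom c))
    (fun x => Tmx i ((crd c \o par (A i)) x)).
  apply: (Ck_on_comp (@open_ic i) (@open_ci i) _ (@sic i k) (@Ck_on_Tmx k i)).
  by move=> x /crd_img_par[ix cx <-] /=; rewrite crdK //; exists (par (A i) x).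
apply: (Ck_on_congr (@open_ic i) _ (Ck_on_mulmx (@open_ic i)
  (Ck_on_cst k (crd (A i) @` (dom (A i) `&` dom c)) v) H)).
by move=> x _.
Qed.

Lemma field_derive i p (X : 'rV[R]_4) (Y : components A 'rV[R]_4) VX (VY : 'rV[R]_4 -> 'rV[R]_4) :
  dom c p -> dom (A i) p -> X = VX *m trans c (A i) p ->
  (forall q, dom c q -> dom (A i) q -> Y i q = VY (crd c q) *m trans c (A i) q) ->
  differentiable VY (crd c p) ->
  'D_X (Y i \o par (A i)) (crd (A i) p)
  = 'D_VX VY (crd c p) *m Tmx i (crd c p) + VY (crd c p) *m 'D_VX (Tmx i) (crd c p).
Proof.
move=> cp ip XE YE dVY.
have dT : differentiable (Tmx i) (crd c p).
  exact: (C1_differentiable (@open_ci i) (crd_img cp ip) (@Ck_on_Tmx 1 i)).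
have dpsi := trans_differentiable (@sic i) ip cp.
pose G y := VY y *m Tmx i y.
have pE : (crd c \o par (A i)) (crd (A i) p) = crd c p by rewrite /= crdK.
have dG : differentiable G (crd c p) := differentiable_mulmx dVY dT.
have dF : differentiable G ((crd c \o par (A i)) (crd (A i) p)) by rewrite pE; exact: dG.
have EX : 'D_X (crd c \o par (A i)) (crd (A i) p) = VX.
  by rewrite (deriveEjacobian _ dpsi) XE -/(trans (A i) c p) -mulmxA transK // mulmx1.
rewrite -[RHS](derive_mulmx VX dVY dT) -/G -pE -EX -[RHS](derive_comp X dpsi dF).
apply: near_eq_derive.
have cn : nbhs p (dom c) by apply: open_nbhs_nbhs; split; [exact: dom_open|exact: cp].
have := par_nbhs ip cn; apply: filterS => x [ix [xE cx]].
exact: (YE _ cx ix).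
Qed.

(** Symmetry of the Hessian of the transition map: the second-order terms in the two halves of a
    bracket cancel, so brackets may be computed in [c]. *)
Lemma hessian_sym i p u v : dom c p -> dom (A i) p ->
  u *m 'D_v (Tmx i) (crd c p) = v *m 'D_u (Tmx i) (crd c p).
Proof.
move=> cp ip.
have pU := crd_img cp ip.
have dT : differentiable (Tmx i) (crd c p).
  exact: (C1_differentiable (@open_ci i) pU (@Ck_on_Tmx 1 i)).
pose D d := 'D_(delta_mx 0 d) (Tmx i) (crd c p).
have E u' : 'D_u' (Tmx i) (crd c p) = \sum_d u' 0 d *: D d by exact: derive_sum_coord.
have S a d b : D d a b = D a d b.
  have fb := (Ck_on_mxP 2 (crd (A i) \o par c) (@open_ci i)).1 (@sci i 2%N) 0 b.
  have Te a' d' : ('D_(delta_mx 0 d') (Tmx i) (crd c p)) a' b =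
     'D_(delta_mx 0 d') (fun z => 'D_(delta_mx 0 a') (fun y => (crd (A i) \o par c) y 0 b) z) (crd c p).
    rewrite (derive_entry _ _ _ dT).
    apply: near_eq_derive; apply: (near_open (@open_ci i) pU) => y Uy.
    have dy := C1_differentiable (@open_ci i) Uy (@sci i 1%N).
    rewrite /Tmx (jacobianE _ _ dy).
    exact: (derive_entry _ _ _ dy).
  have sw := @schwarz R 4 (fun y => (crd (A i) \o par c) y 0 b) _ (crd c p) a d (@open_ci i) pU fb.
  exact: (etrans (Te a d) (etrans sw (esym (Te d a)))).
rewrite (E u) (E v) {E}; clearbody D.
apply/rowP => b; rewrite !mulmx_sumr !summxE.
under eq_bigr do rewrite -scalemxAr !mxE big_distrr /=.
under [RHS]eq_bigr do rewrite -scalemxAr !mxE big_distrr /=.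
rewrite exchange_big /=; apply: eq_bigr => d _; apply: eq_bigr => a _.
by rewrite S mulrCA.
Qed.

Lemma bracketE i p (X Y : components A 'rV[R]_4) (VX VY : 'rV[R]_4 -> 'rV[R]_4) :
  dom c p -> dom (A i) p ->
  (forall q, dom c q -> dom (A i) q -> X i q = VX (crd c q) *m trans c (A i) q) ->
  (forall q, dom c q -> dom (A i) q -> Y i q = VY (crd c q) *m trans c (A i) q) ->
  differentiable VX (crd c p) -> differentiable VY (crd c p) ->
  lie_bracket X Y i p =
    ('D_(VX (crd c p)) VY (crd c p) - 'D_(VY (crd c p)) VX (crd c p)) *m trans c (A i) p.
Proof.
move=> cp ip XE YE dX dY; rewrite /lie_bracket.
rewrite (field_derive cp ip (XE p cp ip) YE dY) (field_derive cp ip (YE p cp ip) XE dX).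
rewrite mulmxBl; apply: sub_add_eq.
exact: (hessian_sym (VY (crd c p)) (VX (crd c p)) cp ip).
Qed.

End Bracket.

Lemma derive_mulmxl (R : realType) (V : normedModType R) m n l
    (e : 'M[R]_(m, n)) (g : V -> 'M[R]_(n, l)) x v :
  differentiable g x -> 'D_v (fun y => e *m g y) x = e *m 'D_v g x.
Proof.
move=> dg; have dc : differentiable (cst e : V -> 'M[R]_(m, n)) x by exact: differentiable_cst.
rewrite (derive_mulmx v dc dg).
have E : 'D_v (cst e : V -> 'M[R]_(m, n)) x = 0 by exact: derive_cst.
by rewrite E mul0mx add0r.
Qed.

Lemma derive_block0 (R : realType) (V : normedModType R)
    (X Y : V -> 'M[R]_2) x v : differentiable X x -> differentiable Y x ->
  differentiable (fun y => block_mx 0 (X y) (Y y) 0 : 'M[R]_(2 + 2)) x /\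
  'D_v (fun y => block_mx 0 (X y) (Y y) 0 : 'M[R]_(2 + 2)) x
     = block_mx 0 ('D_v X x) ('D_v Y x) 0.
Proof.
move=> dX dY.
have d00 : differentiable (fun=> 0 : R) x by exact: differentiable_cst.
pose B y : 'M[R]_(2 + 2) := block_mx 0 (X y) (Y y) 0.
have e00 a b : (fun y => B y (lshift 2 a) (lshift 2 b)) = fun=> 0.
  by apply/funext => y; rewrite /B block_mxEul mxE.
have e01 a b : (fun y => B y (lshift 2 a) (rshift 2 b)) = fun y => X y a b.
  by apply/funext => y; rewrite /B block_mxEur.
have e10 a b : (fun y => B y (rshift 2 a) (lshift 2 b)) = fun y => Y y a b.
  by apply/funext => y; rewrite /B block_mxEdl.
have e11 a b : (fun y => B y (rshift 2 a) (rshift 2 b)) = fun=> 0.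
  by apply/funext => y; rewrite /B block_mxEdr mxE.
have dB : differentiable B x.
  apply: differentiable_mx => a b.
  case: (split_ordP a) => a' ->; case: (split_ordP b) => b' ->.
  - by rewrite e00.
  - by rewrite e01; exact: differentiable_entry.
  - by rewrite e10; exact: differentiable_entry.
  - by rewrite e11.
split; first exact: dB.
apply/matrixP => a b; rewrite (derive_entry v a b dB).
case: (split_ordP a) => a' ->; case: (split_ordP b) => b' ->.
- by rewrite e00 block_mxEul mxE derive_cst.
- by rewrite e01 block_mxEur (derive_entry v a' b' dX).
- by rewrite e10 block_mxEdl (derive_entry v a' b' dY).
- by rewrite e11 block_mxEdr mxE derive_cst.
Qed.

Section Integrable.
Variables (R : realType) (M : topologicalType) (A : atlas R M 4) (c : chart R M 4).
Hypothesis lc : local_coordinates A c.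

(** In admissible coordinates these are the directions tangent to the orbits. *)
Definition vertical (v : 'rV[R]_4) := lsubmx (v : 'rV[R]_(2 + 2)) = 0.

(* In the coordinates of [c] the Nijenhuis tensor at the [a]-th and [b]-th
   coordinate fields is [e_a (D_b B) - e_b (D_a B)], composed with [J]. *)
Lemma integrable_block (J : components A 'M[R]_4) (N : set M) (X Y : 'rV[R]_4 -> 'M[R]_2) i p :
  integrable_endo N J -> dom c `<=` N -> dom c p -> dom (A i) p ->
  (forall q, dom c q -> dom (A i) q ->
     trans c (A i) q *m J i q = (block_mx 0 (X (crd c q)) (Y (crd c q)) 0 : 'M[R]_(2 + 2)) *m trans c (A i) q) ->
  J i p *m J i p = - 1%:M ->
  differentiable X (crd c p) -> differentiable Y (crd c p) ->
  (forall v, vertical v -> 'D_v X (crd c p) = 0 /\ 'D_v Y (crd c p) = 0) ->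
  forall a b : 'I_2,
    row a ('D_(delta_mx 0 (fst2 b)) X (crd c p)) = row b ('D_(delta_mx 0 (fst2 a)) X (crd c p)).
Proof.
move=> hN cN cp ip JT JJ dX dY vert a b.
pose B y : 'M[R]_(2 + 2) := block_mx 0 (X y) (Y y) 0.
have [dB DB] : differentiable B (crd c p) /\ forall v, 'D_v B (crd c p) = block_mx 0 ('D_v X (crd c p)) ('D_v Y (crd c p)) 0.
  split; first exact: (derive_block0 0 dX dY).1.
  by move=> v; exact: (derive_block0 v dX dY).2.
pose ea (d : 'I_2) : 'rV[R]_(2 + 2) := delta_mx 0 (fst2 d).
have dcst d : differentiable (cst (ea d) : 'rV[R]_4 -> 'rV[R]_4) (crd c p) by exact: differentiable_cst.
have dB' d : differentiable (fun y => ea d *m B y) (crd c p).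
  exact: (differentiable_mulmx (dcst d) dB).
have eB d y : ea d *m B y = row_mx 0 (row d (X y)).
  rewrite -rowE /B; apply/rowP => k; rewrite mxE.
  by case: (split_ordP k) => k' ->; rewrite ?block_mxEul ?block_mxEur ?row_mxEl ?row_mxEr !mxE.
have Dcst d v : 'D_v (cst (ea d) : 'rV[R]_4 -> 'rV[R]_4) (crd c p) = 0 by exact: derive_cst.
(* [J] sends the first two coordinate fields to vertical ones, along which the blocks are constant;
   this kills the bracket of the two images. *)
have vB d d' : 'D_(ea d *m B (crd c p)) (fun y => ea d' *m B y) (crd c p) = 0.
  rewrite (derive_mulmxl _ _ dB) DB.
  have [|-> ->] := vert (ea d *m B (crd c p)); first by rewrite /vertical eB row_mxKl.
  by rewrite block_mx0 mulmx0.
pose F d : components A 'rV[R]_4 := cst_field c (ea d).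
have FE d q : dom c q -> dom (A i) q -> F d i q = cst (ea d) (crd c q) *m trans c (A i) q by [].
have JFE d q : dom c q -> dom (A i) q -> endo_apply J (F d) i q = (ea d *m B (crd c q)) *m trans c (A i) q.
  by move=> cq iq; rewrite /endo_apply /F /cst_field -mulmxA JT // mulmxA.
have z (u v u' v' : 'rV[R]_4) T : u = u' -> v = v' -> (u - v) *m T = (u' - v') *m T :> 'rV[R]_4.
  by move=> -> ->.
have D0 d v : 'D_v (fun y => ea d *m B y) (crd c p) = ea d *m 'D_v B (crd c p).
  exact: derive_mulmxl.
have b1 := etrans (bracketE lc cp ip (JFE a) (JFE b) (dB' a) (dB' b)) (z _ _ _ _ _ (vB a b) (vB b a)).
have b2 := etrans (bracketE lc cp ip (JFE a) (FE b) (dB' a) (dcst b)) (z _ _ _ _ _ (Dcst b _) (D0 a _)).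
have b3 := etrans (bracketE lc cp ip (FE a) (JFE b) (dcst a) (dB' b)) (z _ _ _ _ _ (D0 b _) (Dcst a _)).
have b4 := etrans (bracketE lc cp ip (FE a) (FE b) (dcst a) (dcst b)) (z _ _ _ _ _ (Dcst b _) (Dcst a _)).
have := hN (dom c) (F a) (F b) (@dom_open _ _ _ c) cN (vector_field_cst lc (ea a))
  (vector_field_cst lc (ea b)) i p cp ip.
rewrite b1 b2 b3 b4 subrr !mul0mx sub0r !subr0 sub0r /cst /= !mulNmx opprK.
have [sic sci] := lc i.
(* The two surviving terms both carry the transition matrix and [J], which are invertible and can be
   cancelled. *)
have H (u v : 'rV[R]_4) : u *m trans c (A i) p *m J i p - v *m trans c (A i) p *m J i p = 0 -> u = v.
  rewrite -!mulmxBl => E; apply/eqP; rewrite -subr_eq0; apply/eqP.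
  have : (u - v) *m trans c (A i) p *m J i p *m J i p = 0 by rewrite E mul0mx.
  rewrite -mulmxA JJ mulmxN mulmx1 => /eqP; rewrite oppr_eq0 => /eqP E2.
  by rewrite -[LHS]mulmx1 -(transK sci sic cp ip) mulmxA E2 mul0mx.
move=> /H; rewrite !DB /ea => E.
have eD d (Z W : 'M[R]_2) : rsubmx ((delta_mx 0 (fst2 d) : 'rV[R]_(2 + 2)) *m block_mx 0 Z W 0) = row d Z.
  by rewrite -rowE; apply/rowP => k; rewrite [LHS]mxE [LHS]mxE [RHS]mxE; exact: (@block_mxEur _ 2 2 2 2).
have E3 := congr1 (fun u : 'rV[R]_(2 + 2) => rsubmx u) E.
exact: (etrans (esym (eD a _ _)) (etrans E3 (eD b _ _))).
Qed.
End Integrable.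

Lemma derive_invariant (R : realType) (V W : normedModType R) (f : V -> W) x v :
  (forall h : R, f (h *: v + x) = f x) -> 'D_v f x = 0.
Proof.
move=> fv; rewrite /derive; apply: lim_near_cst; first exact: norm_hausdorff.
by apply: filterE => h /=; rewrite fv subrr scaler0.
Qed.

(** The first relation says that the rows of [P] are closed 1-forms in [mu], the second that its
    columns are. Hence the derivatives of [P 0 1] and [P 1 0] along the coordinate 0 both equal that
    of [P 0 0] along the coordinate 1, and symmetrically with [P 1 1]. *)
Lemma asym_derive0 (R : realType) (P : 'rV[R]_4 -> 'M[R]_2) x :
  differentiable P x ->
  (forall v, vertical v -> 'D_v P x = 0) ->
  (forall a b, row a ('D_(delta_mx 0 (fst2 b)) (fun y => (P y)^T) x) =
               row b ('D_(delta_mx 0 (fst2 a)) (fun y => (P y)^T) x)) ->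
  (forall a b, row a ('D_(delta_mx 0 (fst2 b)) (fun y => - P y) x) =
               row b ('D_(delta_mx 0 (fst2 a)) (fun y => - P y) x)) ->
  differentiable (fun y => P y 0 1 - P y 1 0) x /\
  forall v, 'D_v (fun y => P y 0 1 - P y 1 0) x = 0.
Proof.
move=> dP vP r1 r2.
have dij i j : differentiable (fun y => P y i j) x by exact: differentiable_entry.
have dT : differentiable (fun y => (P y)^T) x.
  apply: differentiable_mx => i j.
  by rewrite (_ : (fun y => _) = (fun y => P y j i)) //; apply/funext => y; rewrite mxE.
have dN : differentiable (fun y => - P y) x by exact: (differentiableN dP).
pose D (d i j : 'I_2) := 'D_(delta_mx 0 (fst2 d)) (fun y => P y i j) x.
have DT d i j : ('D_(delta_mx 0 (fst2 d)) (fun y => (P y)^T) x) i j = D d j i.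
  have E : (fun y => (P y)^T i j) = (fun y => P y j i) by apply/funext => y; rewrite mxE.
  exact: (etrans (derive_entry _ i j dT) (congr1 (fun f => 'D_(delta_mx 0 (fst2 d)) f x) E)).
have DN d i j : ('D_(delta_mx 0 (fst2 d)) (fun y => - P y) x) i j = - D d i j.
  have E : (fun y => (- P y) i j) = - (fun y => P y i j) by apply/funext => y; rewrite mxE.
  apply: (etrans (derive_entry _ i j dN)).
  apply: (etrans (congr1 (fun f => 'D_(delta_mx 0 (fst2 d)) f x) E)).
  exact: (deriveN (diff_derivable (dij i j))).
have re (k : 'I_2) (B : 'M[R]_2) j : row k B 0 j = B k j by rewrite mxE.
have s1 j : D 1 j 0 = D 0 j 1.
  have H := etrans (esym (re 0 _ j)) (etrans (congr1 (fun B : 'rV_2 => B 0 j) (r1 0 1)) (re 1 _ j)).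
  exact: etrans (esym (DT 1 0 j)) (etrans H (DT 0 1 j)).
have s2 j : D 1 0 j = D 0 1 j.
  have H := etrans (esym (re 0 _ j)) (etrans (congr1 (fun B : 'rV_2 => B 0 j) (r2 0 1)) (re 1 _ j)).
  apply: oppr_inj; exact: etrans (esym (DN 1 0 j)) (etrans H (DN 0 1 j)).
have dd := differentiableB (dij 0 1) (dij 1 0).
split; first exact: dd.
have DB v : 'D_v (fun y => P y 0 1 - P y 1 0) x =
    'D_v (fun y => P y 0 1) x - 'D_v (fun y => P y 1 0) x.
  exact: (deriveB (diff_derivable (dij 0 1)) (diff_derivable (dij 1 0))).
move=> v; apply: etrans (derive_sum_coord v dd) _.
apply: big1 => d _.
have -> : 'D_(delta_mx 0 d) ((fun y => P y 0 1) - (fun y => P y 1 0)) x = 0; last by rewrite scaler0.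
apply: etrans (DB _) _.
case: (@split_ordP 2 2 d) => d' ->; last first.
  have vd : vertical (delta_mx 0 (rshift 2 d') : 'rV[R]_4).
    by apply/rowP => k; rewrite !mxE (eq_lrshift k).
  have E i j : 'D_(delta_mx 0 (rshift 2 d')) (fun y => P y i j) x = 0.
    apply: etrans (esym (derive_entry _ i j dP)) _.
    by rewrite (vP _ vd) mxE.
  by apply: etrans (congr2 (fun a b => a - b) (E 0 1) (E 1 0)) _; rewrite subrr.
case: (ord2P d') => ->.
  by apply: etrans (congr2 (fun a b => a - b) (esym (s1 0)) (esym (s2 0))) _; rewrite subrr.
by apply: etrans (congr2 (fun a b => a - b) (s2 1) (s1 1)) _; rewrite subrr.
Qed.

Lemma adjoint_sqr (R : realType) (M : topologicalType) (A : atlas R M 4)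
    (w J : components A 'M[R]_4) i p :
  w i p \in unitmx -> J i p *m J i p = - 1%:M ->
  w_adjoint w J i p *m w_adjoint w J i p = - 1%:M.
Proof.
move=> wU JJ; rewrite /w_adjoint -trmx_mul !mulmxA mulmxK //.
by rewrite -(mulmxA _ (J i p) (J i p)) JJ mulmxN mulmx1 mulNmx mulVmx // linearN /= trmx1.
Qed.

(** * Smooth data on the whole manifold *)

Section Smoothness.
Variables (R : realType) (M : topologicalType) (A : atlas R M 4).
Variables (w : components A 'M[R]_4) (rho : 'rV[R]_2 -> M -> M).
Variables (mu : M -> 'rV[R]_2) (hM : symplectic_toric w rho mu).
Variable xi : 'M[R]_2.

Local Notation W i := (crd (A i) @` dom (A i)).
Let oW i : open (W i) := @img_open _ _ _ (A i).

Lemma Ck_on_dmu k i : Ck_on k (W i) (fun x => dmu mu xi i (par (A i) x)).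
Proof.
have H : Ck_on k (W i) (fun x => 'J (mu \o par (A i)) x *m xi^T).
  apply: (Ck_on_mulmx (@oW i)); last exact: Ck_on_cst.
  exact: (@Ck_on_jacobian R 4 2 k _ (mu \o par (A i)) (@oW i) (mu_smooth hM i k.+1)).
apply: (Ck_on_congr (@oW i) _ H) => x /par_dom[_ xE].
by rewrite /dmu /Jmu xE.
Qed.

Lemma Ck_on_w k i : Ck_on k (W i) (fun x => w i (par (A i) x)).
Proof. exact: (w_smooth hM i k). Qed.

Lemma Ck_on_invw k i : Ck_on k (W i) (fun x => invmx (w i (par (A i) x))).
Proof.
apply: (Ck_on_invmx (@oW i)); last exact: Ck_on_w.
by move=> x /par_dom[ix _]; exact: (w_unit hM).
Qed.

Lemma Ck_on_Kdist k i : Ck_on k (W i) (fun x => Kdist rho xi i (par (A i) x)).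
Proof.
apply: (@Ck_on_congr _ _ _ _ _ (fun x => - (dmu mu xi i (par (A i) x))^T *m invmx (w i (par (A i) x))) _ (@oW i)).
  by move=> x /par_dom[ix _]; rewrite (KdistE hM).
apply: (Ck_on_mulmx (@oW i)); last exact: Ck_on_invw.
by apply: (Ck_on_opp (@oW i)); apply: (Ck_on_trmx (@oW i)); exact: Ck_on_dmu.
Qed.

Lemma Ck_on_adjoint k i (J : components A 'M[R]_4) :
  Ck_on k (W i) (fun x => J i (par (A i) x)) ->
  Ck_on k (W i) (fun x => w_adjoint w J i (par (A i) x)).
Proof.
move=> Jk; apply: (Ck_on_trmx (@oW i)); apply: (Ck_on_mulmx (@oW i)); last exact: Ck_on_w.
by apply: (Ck_on_mulmx (@oW i)); [exact: Ck_on_invw|].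
Qed.

(** Built from [K], [J] and [d mu], so it is smooth up to the boundary, where [Psi] itself has no
    meaning. It extends the transpose of the inverse of [Psi]. *)
Definition Qmx (J : components A 'M[R]_4) i p : 'M[R]_2 :=
  - (Kdist rho xi i p *m J i p *m dmu mu xi i p).

Lemma Ck_on_Qmx k i (J : components A 'M[R]_4) :
  Ck_on k (W i) (fun x => J i (par (A i) x)) ->
  Ck_on k (W i) (fun x => Qmx J i (par (A i) x)).
Proof.
move=> Jk; apply: (Ck_on_opp (@oW i)).
apply: (Ck_on_mulmx (@oW i)); last exact: Ck_on_dmu.
by apply: (Ck_on_mulmx (@oW i)); [exact: Ck_on_Kdist|].
Qed.

Lemma Qmx_fr U m tau i p J P : dom (A i) p ->
  adapted_frame w rho mu xi i p U (Kdist rho xi i p) m tau ->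
  J i p = fr U (Kdist rho xi i p) m tau (Jblock P) -> Qmx J i p = (invmx P)^T.
Proof.
move=> ip [fK fV _ mE wE] JE.
by rewrite /Qmx -mE JE (K_fr_m fK) opprK.
Qed.

End Smoothness.

(** * The antisymmetric part of [Psi] is locally constant *)

Section AsymDerive.
Variables (R : realType) (M : topologicalType) (A : atlas R M 4).
Variables (w : components A 'M[R]_4) (rho : 'rV[R]_2 -> M -> M).
Variables (mu : M -> 'rV[R]_2) (hM : symplectic_toric w rho mu).
Variables (xi : 'M[R]_2) (hxi : xi \in unitmx) (C : set (chart R M 4)).
Hypothesis hC : admissible_coordinates w rho mu xi C.
Variables (J : components A 'M[R]_4) (Psi : 'rV[R]_2 -> 'M[R]_2).
Hypotheses (hJ : DGK w rho mu xi setT J) (hPsi : given_by mu C J Psi).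

Local Notation W i := (crd (A i) @` dom (A i)).

Lemma Ck_on_J k i : Ck_on k (W i) (fun x => J i (par (A i) x)).
Proof.
have [[[[_ Js] _] _ _ _ _] _] := hJ.
by have := Js i k; rewrite setIT.
Qed.

Lemma admissible_local c : C c -> local_coordinates A c.
Proof. by have [J1 [_ H _]] := hC => /H[]. Qed.

Lemma admissible_ring c : C c -> dom c `<=` Mring mu.
Proof. by have [J1 [_ H _]] := hC => /H[]. Qed.

Lemma mu_admissible c x : C c -> (crd c @` dom c) x ->
  mu (par c x) = lsubmx (x : 'rV[R]_(2 + 2)) *m invmx xi^T.
Proof.
have [J1 [_ H _]] := hC => Cc; have [_ _ cmu _] := H c Cc.
move=> /par_dom[cx xE]; apply: (can_inj (mulmxK (_ : xi^T \in unitmx))); first by rewrite unitmx_tr.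
rewrite mulmxKV ?unitmx_tr //; apply/rowP => j.
rewrite [RHS]mxE -[in RHS]xE -/(fst2 j) cmu // /pairing !mxE.
by apply: eq_bigr => a _; rewrite !mxE.
Qed.

(** [Psi] is given without any regularity; it inherits that of [J] through [Qmx], by inverting and
    transposing. The last clause has an arbitrary [g] so that it covers transposes, inverses and
    signs at once. *)
Lemma Psi_chart c i p : C c -> dom c p -> dom (A i) p ->
  [/\ differentiable (fun y => Psi (mu (par c y))) (crd c p),
      differentiable (fun y => (invmx (Psi (mu (par c y))))) (crd c p) &
      forall (V : normedModType R) (g : 'M[R]_2 -> V) v, vertical v ->
        'D_v (fun y => g (Psi (mu (par c y)))) (crd c p) = 0].
Proof.
move=> Cc cp ip; have lc := admissible_local Cc; have [sic sci] := lc i.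
pose O := crd c @` (dom c `&` dom (A i)).
have oO : open O by apply: open_crd_img; exact: dom_open.
have pO : O (crd c p) by exact: crd_img.
have Qc k : Ck_on k O (fun y => Qmx rho mu xi J i (par (A i) ((crd (A i) \o par c) y))).
  apply: (@Ck_on_comp R 4 4 2 2 k O _ (crd (A i) \o par c)
    (fun x => Qmx rho mu xi J i (par (A i) x)) oO (@img_open _ _ _ (A i)) _ (sci k)
    (Ck_on_Qmx hM xi (@Ck_on_J k i))).
  by move=> y /crd_img_par[cy iy _] /=; exact: crd_imgT.
have QE y : O y -> Qmx rho mu xi J i (par (A i) ((crd (A i) \o par c) y)) =
    (invmx (Psi (mu (par c y))))^T /\ Psi (mu (par c y)) \in unitmx.
  move=> /crd_img_par[cy iy yE] /=; rewrite crdK //.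
  have [PU [frm JE]] := Mring_frame hM hC hJ hPsi I (admissible_ring Cc cy) Cc cy iy.
  by split=> //; exact: Qmx_fr iy frm JE.
have invC : Ck_on 1 O (fun y => invmx (Psi (mu (par c y)))).
  apply: (Ck_on_congr oO _ (Ck_on_trmx oO (Qc 1%N))) => y /QE[-> _].
  by rewrite trmxK.
have PC : Ck_on 1 O (fun y => Psi (mu (par c y))).
  have iU y : O y -> invmx (Psi (mu (par c y))) \in unitmx.
    by move=> /QE[_]; rewrite unitmx_inv.
  by apply: (Ck_on_congr oO _ (Ck_on_invmx oO iU invC)) => y _; rewrite invmxK.
split.
- exact: (C1_differentiable oO pO PC).
- exact: (C1_differentiable oO pO invC).
move=> V g v vv.
(* Near the point [mu] is a function of the first two coordinates. The total function [f] is
   invariant under all vertical translations, even those that leave the chart. *)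
pose f (y : 'rV[R]_4) := g (Psi (lsubmx (y : 'rV[R]_(2 + 2)) *m invmx xi^T)).
have E : \forall y \near crd c p, g (Psi (mu (par c y))) = f y.
  apply: (near_open oO pO) => y [q [cq _] <-].
  by rewrite /f -(mu_admissible Cc (crd_imgT cq)).
apply: (etrans (near_eq_derive v E)).
apply: derive_invariant => h; rewrite /f; congr (g (Psi (_ *m _))).
have -> : lsubmx (h *: v + crd c p : 'rV[R]_(2 + 2)) =
   h *: lsubmx (v : 'rV[R]_(2 + 2)) + lsubmx (crd c p : 'rV[R]_(2 + 2)).
  by apply/rowP => k; rewrite !mxE.
by rewrite (vv : lsubmx (v : 'rV[R]_(2 + 2)) = 0) scaler0 add0r.
Qed.

Lemma trans_adapted c i p : C c -> dom c p -> dom (A i) p ->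
  trans c (A i) p *m J i p = (Jblock (Psi (mu p)) : 'M[R]_(2 + 2)) *m trans c (A i) p /\
  trans c (A i) p *m w_adjoint w J i p =
    (Jblock_adj (Psi (mu p)) : 'M[R]_(2 + 2)) *m trans c (A i) p.
Proof.
move=> Cc cp ip.
have [PU [frm JE]] := Mring_frame hM hC hJ hPsi I (admissible_ring Cc cp) Cc cp ip.
have [J1 [_ H _]] := hC.
have [cE _] := admissible_frame hM (H c Cc) cp ip.
have JaE := adapted_form hM ip frm JE.
have [fK _ _ _ _] := frm.
move: JE JaE fK cE; rewrite /fr.
set U := usubmx _; set tau := rsubmx _ => JE JaE fK cE.
have frE B : col_mx U (Kdist rho xi i p) *m fr U (Kdist rho xi i p) (dmu mu xi i p) tau B
   = B *m col_mx U (Kdist rho xi i p).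
  by rewrite /fr !mulmxA fK mul1mx.
by split; rewrite ?JE ?JaE cE frE.
Qed.

Lemma asym_chart c i p : C c -> dom c p -> dom (A i) p ->
  differentiable (fun y => Psi (mu (par c y)) 0 1 - Psi (mu (par c y)) 1 0) (crd c p) /\
  forall v, 'D_v (fun y => Psi (mu (par c y)) 0 1 - Psi (mu (par c y)) 1 0) (crd c p) = 0.
Proof.
move=> Cc cp ip; have [dP dV vert] := Psi_chart Cc cp ip.
pose P y := Psi (mu (par c y)).
have dPT : differentiable (fun y => (P y)^T) (crd c p).
  apply: differentiable_mx => a b.
  rewrite (_ : (fun y => _) = (fun y => P y b a)); first exact: differentiable_entry.
  by apply/funext => y; rewrite mxE.
have dVT : differentiable (fun y => - (invmx (P y))^T) (crd c p).
  apply: differentiable_mx => a b.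
  rewrite (_ : (fun y => _) = - (fun y => invmx (P y) b a)).
    by apply: differentiableN; exact: differentiable_entry.
  by apply/funext => y; rewrite !mxE.
have dN : differentiable (fun y => - P y) (crd c p) by exact: (differentiableN dP).
have [[[_ JJ] _ iJ iJa _] _] := hJ.
have lc := admissible_local Cc.
have JJp : J i p *m J i p = - 1%:M by exact: JJ.
apply: (asym_derive0 dP).
- by move=> v vv; exact: (vert _ id v vv).
- apply: (integrable_block lc iJ (@subsetT _ _) cp ip _ JJp dPT dVT).
    by move=> q cq iq; have [-> _] := trans_adapted Cc cq iq; rewrite /P crdK.
  by move=> v vv; split; [exact: (vert _ (fun B => B^T) v vv)|exact: (vert _ (fun B => - (invmx B)^T) v vv)].
apply: (integrable_block lc iJa (@subsetT _ _) cp ip _ _ dN dV).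
- by move=> q cq iq; have [_ ->] := trans_adapted Cc cq iq; rewrite /P crdK.
- by apply: adjoint_sqr => //; exact: (w_unit hM).
- by move=> v vv; split; [exact: (vert _ (fun B => - B) v vv)|exact: (vert _ (fun B => invmx B) v vv)].
Qed.

Lemma asym_derive i p : dom (A i) p -> Mring mu p ->
  differentiable (fun x => Psi (mu (par (A i) x)) 0 1 - Psi (mu (par (A i) x)) 1 0) (crd (A i) p) /\
  forall v, 'D_v (fun x => Psi (mu (par (A i) x)) 0 1 - Psi (mu (par (A i) x)) 1 0) (crd (A i) p) = 0.
Proof.
move=> ip Rp; have [J1 [_ _ /(_ p Rp)[c Cc cp]]] := hC.
have [dF DF] := asym_chart Cc cp ip.
have [sic sci] := admissible_local Cc i.
have dpsi := trans_differentiable sic ip cp.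
pose F y : R := Psi (mu (par c y)) 0 1 - Psi (mu (par c y)) 1 0.
have pE : (crd c \o par (A i)) (crd (A i) p) = crd c p by rewrite /= crdK.
have dF' : differentiable F ((crd c \o par (A i)) (crd (A i) p)) by rewrite pE; exact: dF.
have cn : nbhs p (dom c) by apply: open_nbhs_nbhs; split; [exact: dom_open|exact: cp].
have E : \forall x \near crd (A i) p, F ((crd c \o par (A i)) x) =
    Psi (mu (par (A i) x)) 0 1 - Psi (mu (par (A i) x)) 1 0.
  have := par_nbhs ip cn; apply: filterS => x [ix [xE cx]].
  by rewrite /F /= crdK.
split.
  exact: (near_eq_differentiable E (differentiable_comp dpsi dF')).
move=> v; apply: (etrans (esym (near_eq_derive v E))).
apply: (etrans (derive_comp v dpsi dF')); rewrite pE; exact: DF.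
Qed.

End AsymDerive.

(** * Extension across the boundary *)

Section DefectAlgebra.
Variable F : numFieldType.

(** The last equation expresses the defect of [P0] through quantities that extend. It is
    [(a + c)^2 / det P0] with [a0 = a + c], expanded by means of [e = a D]; the determinant factor
    is [det P / det P0], because [1 + Q G2 = P0^-1 P]. *)
Lemma defect_algebra (P P0 : 'M[F]_2) : P \in unitmx -> P0 \in unitmx ->
  let Q := (invmx P)^T in let G1 := P0 - P in
  let G2 := P^T *m invmx P0 *m P - P^T in
  let a := (P 0 1 - P 1 0) / 2 in let a0 := (P0 0 1 - P0 1 0) / 2 in
  let h := a ^+ 2 / \det P in let D := \det Q in
  let e := (Q 0 1 - Q 1 0) / 2 in let c := (G1 0 1 - G1 1 0) / 2 in
  [/\ D != 0, h = a ^+ 2 * D, e ^+ 2 = h * D &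
      a0 ^+ 2 / \det P0 = (h + 2 * c * e + c ^+ 2 * D) * \det (1%:M + Q *m G2)].
Proof.
move=> PU P0U Q G1 G2 a a0 h D e c.
have d0 : \det P != 0 by rewrite -unitfE -unitmxE.
have d00 : \det P0 != 0 by rewrite -unitfE -unitmxE.
have DE : D = (\det P)^-1 by rewrite /D /Q det_tr det_inv.
have [i00 i01 i10 i11] := invmx2 PU.
have eE : e = a * D.
  by rewrite /e /Q !mxE i01 i10 DE /a; field.
have kE : \det (1%:M + Q *m G2) = \det P / \det P0.
  have -> : 1%:M + Q *m G2 = invmx P0 *m P.
    have QP : Q *m P^T = 1%:M by rewrite /Q -trmx_mul mulmxV // trmx1.
    by rewrite /G2 mulmxBr !mulmxA QP mul1mx addrC subrK.
  by rewrite det_mulmx det_inv mulrC.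
have cE : c = a0 - a by rewrite /c /G1 !mxE /a0 /a; field.
have hE : h = a ^+ 2 * D by rewrite DE.
split=> //.
- by rewrite DE invr_neq0.
- by rewrite eE hE; ring.
rewrite kE hE eE cE DE; move: (a) (a0) (\det P) (\det P0) d0 d00 => x y d d' dn dn'.
by field; rewrite dn dn'.
Qed.

End DefectAlgebra.

(** * Closed conditions extend from the open part *)

Section DensityPrinciple.
Variables (R : realType) (M : topologicalType) (A : atlas R M 4).
Variables (w : components A 'M[R]_4) (rho : 'rV[R]_2 -> M -> M).
Variables (mu : M -> 'rV[R]_2) (hM : symplectic_toric w rho mu).

Lemma Mring_dense_nbhs (p : M) (V : set M) : nbhs p V -> exists2 q, V q & Mring mu q.
Proof.
move=> Vp; have [q Vq Rq] := Mring_dense hM (@open_interior _ V) (ex_intro _ p Vp).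
by exists q => //; exact: interior_subset Vq.
Qed.

Lemma mu_continuous : continuous mu.
Proof.
move=> p; have [i ip] := cht_cover A p.
have c1 : continuous_at (crd (A i) p) (mu \o par (A i)).
  exact: (mu_smooth hM i 0%N).1 _ (crd_imgT ip).
have c2 : continuous_at p ((mu \o par (A i)) \o crd (A i)).
  by apply: continuous_comp => //; exact: crd_continuous.
apply: (continuous_at_near _ c2).
have : nbhs p (dom (A i)) by apply: open_nbhs_nbhs; split=> //; exact: dom_open.
by apply: filterS => q iq; rewrite /= crdK.
Qed.

Lemma open_Mring : open (Mring mu).
Proof. by apply: open_comp => [p _|]; [exact: mu_continuous|exact: open_interior]. Qed.

Lemma chart_density i (V : normedModType R) (f g : 'rV[R]_4 -> V) (O : set 'rV[R]_4) x :
  open O -> O x -> O `<=` crd (A i) @` dom (A i) ->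
  continuous_at x f -> continuous_at x g ->
  (forall p, dom (A i) p -> Mring mu p -> O (crd (A i) p) ->
     f (crd (A i) p) = g (crd (A i) p)) ->
  f x = g x.
Proof.
move=> oO Ox OW cf cg fg; apply: contrapT => nfg.
have [ix xE] := par_dom (OW _ Ox).
have cfg : continuous_at x (fun y => f y - g y) by apply: continuousB.
have fgx : nbhs (f x - g x) (~` [set (0 : V)]).
  apply: open_nbhs_nbhs; split; last by move=> /= /eqP; rewrite subr_eq0 => /eqP.
  apply: closed_openC; apply: accessible_closed_set1.
  by apply: hausdorff_accessible; exact: norm_hausdorff.
have H : nbhs (crd (A i) (par (A i) x)) (O `&` [set y | f y - g y <> 0]).
  by rewrite xE; apply: filterI; [exact: open_nbhs_nbhs|exact: cfg _ fgx].
have [q [iq [Oq]]] := Mring_dense_nbhs (crd_nbhs ix H).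
by move=> /= fgq Rq; apply: fgq; rewrite fg // subrr.
Qed.

Lemma ring_density i (V : normedModType R) (f g : M -> V) p : dom (A i) p ->
  continuous_at (crd (A i) p) (fun x => f (par (A i) x)) ->
  continuous_at (crd (A i) p) (fun x => g (par (A i) x)) ->
  (forall q, dom (A i) q -> Mring mu q -> f q = g q) -> f p = g p.
Proof.
move=> ip cf cg fg; rewrite -(crdK ip).
apply: (chart_density (@img_open _ _ _ (A i)) (crd_imgT ip) (@subset_refl _ _) cf cg).
by move=> q iq Rq _; rewrite (crdK iq); exact: fg.
Qed.

(** Invertibility of the product forces the fields [K_j] to be independent, hence [d mu] to have
    rank 2. *)
Lemma regular_of_det (xi : 'M[R]_2) i p (X : 'M[R]_(4, 2)) :
  dom (A i) p -> \det (Kdist rho xi i p *m X) != 0 -> Mring mu p.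
Proof.
move=> ip; rewrite -unitfE -unitmxE => u; apply: (regular_Mring hM ip).
apply/row_freeP.
have := mulmxV u; rewrite -mulmxA; move: (X *m invmx _) => Z.
rewrite (KdistE hM) // /dmu trmx_mul trmxK => E.
exists (- (invmx (w i p) *m Z) *m xi); rewrite mulmxA; apply: mulmx1C.
by rewrite -[RHS]E mulmxN mulmxN !mulNmx !mulmxA.
Qed.

End DensityPrinciple.

(** * The glued structure and its defect at the boundary *)

Section Glued.
Variables (R : realType) (M : topologicalType) (A : atlas R M 4).
Variables (w : components A 'M[R]_4) (rho : 'rV[R]_2 -> M -> M).
Variables (mu : M -> 'rV[R]_2) (hM : symplectic_toric w rho mu).
Variables (xi : 'M[R]_2) (hxi : xi \in unitmx) (C : set (chart R M 4)).
Hypothesis hC : admissible_coordinates w rho mu xi C.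
Variables (J J0 : components A 'M[R]_4) (Psi Psi0 : 'rV[R]_2 -> 'M[R]_2).
Hypotheses (hJ : DGK w rho mu xi setT J) (hJ0 : DGK w rho mu xi (Mring mu) J0).
Hypotheses (hPsi : given_by mu C J Psi) (hPsi0 : given_by mu C J0 Psi0).
Variables (G1 G2 : 'rV[R]_2 -> 'M[R]_2).
Hypotheses (sG1 : smooth_on setT G1) (sG2 : smooth_on setT G2).
Hypothesis hG1 : forall x, interior (moment_polytope mu) x -> G1 x = Psi0 x - Psi x.
Hypothesis hG2 : forall x, interior (moment_polytope mu) x ->
  G2 x = (Psi x)^T *m invmx (Psi0 x) *m Psi x - (Psi x)^T.

Local Notation W i := (crd (A i) @` dom (A i)).
Let oW i : open (W i) := @img_open _ _ _ (A i).

Definition Jglue : components A 'M[R]_4 := fun i p =>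
  J i p + dmu mu xi i p *m (G1 (mu p))^T *m Kdist rho xi i p
  + J i p *m dmu mu xi i p *m (G2 (mu p))^T *m Kdist rho xi i p *m w_adjoint w J i p.

Lemma two_frames i p : dom (A i) p -> Mring mu p ->
  exists (U : 'M[R]_(2, 2 + 2)) (tau : 'M[R]_(2 + 2, 2)),
    [/\ Psi (mu p) \in unitmx /\ Psi0 (mu p) \in unitmx,
        adapted_frame w rho mu xi i p U (Kdist rho xi i p) (dmu mu xi i p) tau,
        J i p = fr U (Kdist rho xi i p) (dmu mu xi i p) tau (Jblock (Psi (mu p))) &
        J0 i p = fr U (Kdist rho xi i p) (dmu mu xi i p) tau (Jblock (Psi0 (mu p)))].
Proof.
move=> ip Rp; have [J1 [_ _ /(_ p Rp)[c Cc cp]]] := hC.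
have [PU [frm JE]] := Mring_frame hM hC hJ hPsi I Rp Cc cp ip.
have [P0U [_ J0E]] := Mring_frame hM hC hJ0 hPsi0 Rp Rp Cc cp ip.
by exists (usubmx (trans c (A i) p : 'M[R]_(2 + 2))), (rsubmx (trans (A i) c p : 'M[R]_(2 + 2))).
Qed.

Lemma Jglue_ring i p : dom (A i) p -> Mring mu p -> Jglue i p = J0 i p.
Proof.
move=> ip Rp; have [U [tau [[PU P0U] frm JE J0E]]] := two_frames ip Rp.
have JaE := adapted_form hM ip frm JE.
have [fK fV _ _ _] := frm.
rewrite /Jglue hG1 // hG2 // JaE J0E JE.
exact: (fr_update fK PU P0U).
Qed.

Lemma Ck_on_mu_comp k i (G : 'rV[R]_2 -> 'M[R]_2) :
  smooth_on setT G -> Ck_on k (W i) (fun x => G (mu (par (A i) x))).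
Proof.
move=> sG.
by apply: (@Ck_on_comp R 4 2 2 2 k (W i) setT (mu \o par (A i)) G (@oW i) openT
  (fun _ _ => I) (mu_smooth hM i k) (sG k)).
Qed.

Lemma Ck_on_Jglue k i : Ck_on k (W i) (fun x => Jglue i (par (A i) x)).
Proof.
have Jk := Ck_on_J hJ k i.
have Kk := Ck_on_Kdist hM xi k i.
have mk := Ck_on_dmu hM xi k i.
have ak := Ck_on_adjoint hM Jk.
have g1 := Ck_on_trmx (@oW i) (@Ck_on_mu_comp k i _ sG1).
have g2 := Ck_on_trmx (@oW i) (@Ck_on_mu_comp k i _ sG2).
have T1 := Ck_on_mulmx (@oW i) (Ck_on_mulmx (@oW i) mk g1) Kk.
have T2 := Ck_on_mulmx (@oW i) (Ck_on_mulmx (@oW i) (Ck_on_mulmx (@oW i) (Ck_on_mulmx (@oW i) Jk mk) g2) Kk) ak.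
exact: (Ck_on_add (@oW i) (Ck_on_add (@oW i) Jk T1) T2).
Qed.

Let Q i p := Qmx rho mu xi J i p.
(** The solution of [tr = 4 - 8 h] from [frame_tamed_defect]. *)
Let h i p : R := 2^-1 - 8^-1 * \tr (J i p *m w_adjoint w J i p).
Let D i p : R := \det (Q i p).
Let e i p : R := (Q i p 0 1 - Q i p 1 0) / 2.
Let cG p : R := (G1 (mu p) 0 1 - G1 (mu p) 1 0) / 2.
Let kap i p : R := \det (1%:M + Q i p *m G2 (mu p)).
Let h0 i p : R := (h i p + 2 * cG p * e i p + cG p ^+ 2 * D i p) * kap i p.
Let asym p : R := (Psi (mu p) 0 1 - Psi (mu p) 1 0) / 2.

Lemma ring_identities i p : dom (A i) p -> Mring mu p ->
  [/\ D i p != 0, h i p = asym p ^+ 2 * D i p, e i p ^+ 2 = h i p * D i p &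
      (Jglue i p - w_adjoint w Jglue i p) *m (Jglue i p - w_adjoint w Jglue i p)
        = (- 4 * (1 - h0 i p))%:M].
Proof.
move=> ip Rp; have [U [tau [[PU P0U] frm JE J0E]]] := two_frames ip Rp.
have JaE := adapted_form hM ip frm JE.
have J0aE := adapted_form hM ip frm J0E.
have [fK fV _ _ _] := frm.
have QE : Q i p = (invmx (Psi (mu p)))^T := Qmx_fr ip frm JE.
have [_ trE] := frame_tamed_defect fK fV PU.
have [sqE _] := frame_tamed_defect fK fV P0U.
have [D0 hE eE h0E] := defect_algebra PU P0U.
have hE' : h i p = asym p ^+ 2 / \det (Psi (mu p)).
  rewrite /h JE JaE trE /asym.
  by move: (_ / _) => z; field.
have agE : w_adjoint w Jglue i p = w_adjoint w J0 i p.
  by rewrite /w_adjoint Jglue_ring.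
split.
- by rewrite /D QE; exact: D0.
- by rewrite hE' /D QE; exact: hE.
- by rewrite hE' /e /D QE; exact: eE.
rewrite agE Jglue_ring // J0E J0aE sqE; congr ((- 4 * (1 - _))%:M).
by rewrite [LHS]h0E /h0 hE' /e /D /cG /kap QE hG1 // hG2.
Qed.

Lemma Ck_on_defect k i :
  [/\ Ck_on k (W i) (fun x => h i (par (A i) x)), Ck_on k (W i) (fun x => D i (par (A i) x)),
      Ck_on k (W i) (fun x => e i (par (A i) x)) & Ck_on k (W i) (fun x => h0 i (par (A i) x))].
Proof.
have Jk := Ck_on_J hJ k i.
have Qk : Ck_on k (W i) (fun x => Q i (par (A i) x)) := Ck_on_Qmx hM xi Jk.
have ak := Ck_on_adjoint hM Jk.
have cst (a : R) : Ck_on k (W i) (fun=> a) := Ck_on_cst k (W i) a.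
have trk (B : 'rV[R]_4 -> 'M[R]_4) : Ck_on k (W i) B -> Ck_on k (W i) (fun x => \tr (B x)).
  move=> Bk; rewrite /mxtrace.
  apply: (Ck_on_sum (f := fun a x => B x a a) _ _ (@oW i)) => j.
  exact: ((Ck_on_mxP k B (@oW i)).1 Bk j j).
have asymk (B : 'rV[R]_4 -> 'M[R]_2) : Ck_on k (W i) B -> Ck_on k (W i) (fun x => (B x 0 1 - B x 1 0) / 2).
  move=> /((Ck_on_mxP k B (@oW i)).1) Bk; apply: (Ck_on_mul (@oW i)); last exact: cst.
  exact: (Ck_on_add (@oW i) (Bk 0 1) (Ck_on_opp (@oW i) (Bk 1 0))).
have hk : Ck_on k (W i) (fun x => h i (par (A i) x)).
  apply: (Ck_on_add (@oW i)); first exact: cst.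
  apply: (Ck_on_opp (@oW i)); apply: (Ck_on_mul (@oW i)); first exact: cst.
  exact: trk (Ck_on_mulmx (@oW i) Jk ak).
have Dk : Ck_on k (W i) (fun x => D i (par (A i) x)) := Ck_on_det (@oW i) Qk.
have ek : Ck_on k (W i) (fun x => e i (par (A i) x)) := asymk _ Qk.
have ck : Ck_on k (W i) (fun x => cG (par (A i) x)) := asymk _ (@Ck_on_mu_comp k i _ sG1).
have kk : Ck_on k (W i) (fun x => kap i (par (A i) x)).
  apply: (Ck_on_det (@oW i)); apply: (Ck_on_add (@oW i)); first exact: Ck_on_cst.
  exact: (Ck_on_mulmx (@oW i) Qk (@Ck_on_mu_comp k i _ sG2)).
split=> //; apply: (Ck_on_mul (@oW i)) => //.
apply: (Ck_on_add (@oW i)).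
  apply: (Ck_on_add (@oW i)) => //; apply: (Ck_on_mul (@oW i)) => //.
  by apply: (Ck_on_mul (@oW i)) => //.
by apply: (Ck_on_mul (@oW i)) => //; apply: (Ck_on_mul (@oW i)).
Qed.

Lemma boundary_D i p : dom (A i) p -> ~ Mring mu p -> D i p = 0.
Proof.
move=> ip nR; apply/eqP; apply: contrapT => D0; apply: nR.
apply: (regular_of_det hM (xi := xi) (X := - (J i p *m dmu mu xi i p)) ip).
by move/negP: D0; rewrite /D /Q /Qmx mulmxN -(mulmxA (Kdist rho xi i p)).
Qed.

Lemma ratio_derive0 i p v : dom (A i) p -> Mring mu p -> h i p != 0 ->
  'D_v (fun x => D i (par (A i) x) / h i (par (A i) x)) (crd (A i) p) = 0.
Proof.
move=> ip Rp hp.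
have [dF DF] := asym_derive hM hxi hC hJ hPsi ip Rp.
pose F x : R := Psi (mu (par (A i) x)) 0 1 - Psi (mu (par (A i) x)) 1 0.
(* [F] is twice the antisymmetric part, so [g (F x)] is the inverse of its square, that is
   [D / h]. *)
pose g (t : R) : R := (t / 2 * (t / 2))^-1.
have FE : F (crd (A i) p) = Psi (mu p) 0 1 - Psi (mu p) 1 0 by rewrite /F crdK.
have F0 : F (crd (A i) p) != 0.
  apply: contraNN hp => /eqP; have [_ -> _ _] := ring_identities ip Rp.
  by rewrite FE /asym => ->; rewrite mul0r expr0n mul0r.
have dg : differentiable g (F (crd (A i) p)).
  move: (F _) F0 => t t0; apply/derivable1_diffP.
  have d1 : derivable (fun u : R => u / 2) t 1.
    have d0 : derivable (id : R -> R) t 1 by exact: derivable_id.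
    have dc : derivable (cst 2^-1 : R -> R) t 1 by exact: derivable_cst.
    exact: (derivableM d0 dc).
  have d2 : derivable (fun u : R => u / 2 * (u / 2)) t 1 := derivableM d1 d1.
  by apply: (derivableV _ d2); rewrite !mulf_neq0 // invr_neq0.
have E : \forall x \near crd (A i) p, g (F x) = D i (par (A i) x) / h i (par (A i) x).
  have Rn : nbhs p (Mring mu) by apply: open_nbhs_nbhs; split=> //; exact: (open_Mring hM).
  have := par_nbhs ip Rn; apply: filterS => x [ix [_ Rx]].
  have [D0 -> _ _] := ring_identities ix Rx.
  by rewrite expr2 invfM mulrCA mulfV // mulr1.
apply: (etrans (esym (near_eq_derive v E))).
apply: (etrans (derive_comp v dF dg)).
apply: (etrans (congr1 (fun u => 'D_u g (F (crd (A i) p))) (DF v))).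
exact: derive0.
Qed.

(** The open part may cut a ball around [p] into many pieces, with a different constant on each.
    Since [r = D / h] is C1 on the whole ball when [h p <> 0], segments may cross the boundary and
    [r] is a single constant there. *)
Lemma boundary_h i p : dom (A i) p -> ~ Mring mu p -> h i p = 0.
Proof.
move=> ip nR; apply/eqP; apply: contrapT => /negP hp.
have [hk1 Dk1 _ _] := Ck_on_defect 1 i.
pose O := W i `&` (fun x => h i (par (A i) x)) @^-1` (~` [set 0]).
have hc x : W i x -> continuous_at x (fun x => h i (par (A i) x)) by move=> Wx; exact: hk1.1.
have oO : open O.
  rewrite openE => x [Wx hx]; apply: filterI; first exact: open_nbhs_nbhs.
  apply: hc => //; apply: open_nbhs_nbhs; split=> //; apply: closed_openC.
  by apply: accessible_closed_set1; apply: hausdorff_accessible; exact: norm_hausdorff.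
have OW : O `<=` W i by move=> x [].
have hO' x : O x -> h i (par (A i) x) != 0 by move=> [_ /= hx]; apply/eqP.
have hO q : dom (A i) q -> O (crd (A i) q) -> h i q != 0.
  by move=> iq /hO'; rewrite (crdK iq).
have Op : O (crd (A i) p).
  by split; [exact: crd_imgT|rewrite /= crdK //; exact/eqP].
pose r x := D i (par (A i) x) / h i (par (A i) x).
have rk : Ck_on 1 O r.
  by apply: (Ck_on_mul oO); [exact: Ck_on_sub Dk1|apply: (Ck_on_inv oO hO'); exact: Ck_on_sub hk1].
(* The partial derivatives of [r] are continuous on [O] and vanish on a dense subset. *)
have dr0 x v : O x -> 'D_v r x = 0.
  move=> Ox; have dx := C1_differentiable_scalar oO Ox rk.
  apply: (etrans (derive_sum_coord v dx)); apply: big1 => a _.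
  suff -> : 'D_(delta_mx 0 a) r x = 0 by rewrite scaler0.
  have c1 : continuous_at x ('D_(delta_mx 0 a) r) by case: (rk.2 a) => _ [+ _]; apply.
  apply: (chart_density hM oO Ox OW c1 (g := fun=> 0)); first exact: cst_continuous.
  move=> q iq Rq Oq; exact: (ratio_derive0 _ iq Rq (hO _ iq Oq)).
have /nbhs_ballP[s /= s0 sO] : nbhs (crd (A i) p) O by exact: open_nbhs_nbhs.
have r0 : r (crd (A i) p) = 0 by rewrite /r crdK // boundary_D // mul0r.
have rB y : ball (crd (A i) p) s y -> r y = 0.
  rewrite -ball_normE /= => yB.
  have inO t : 0 <= t * 1 -> `|t| <= `|1 : R| -> O (crd (A i) p + t *: (y - crd (A i) p)).
    rewrite normr1 => _ t1; apply: sO; rewrite -ball_normE /= opprD addNKr normrN normrZ.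
    by apply: le_lt_trans yB; rewrite distrC ler_piMl.
  have [|t [t0 t1]] := @line_MVT R _ r (crd (A i) p) (y - crd (A i) p) 1.
    by move=> t t0 t1; apply: diff_derivable; apply: (C1_differentiable_scalar oO (inO t t0 t1) rk).
  by rewrite scale1r addrCA subrr addr0 r0 subr0 (dr0 _ _ (inO t t0 t1)) mulr0.
have Bn : nbhs (crd (A i) p) (ball (crd (A i) p) s) by exact: nbhsx_ballx.
(* The constant is 0 because [D] vanishes at [p], but a point of the open part in the ball has
   [D <> 0]. *)
have [q [iq qB] Rq] := Mring_dense_nbhs hM (crd_nbhs ip Bn).
have [Dq _ _ _] := ring_identities iq Rq.
have hq := hO _ iq (sO _ qB).
have := rB _ qB; rewrite /r (crdK iq) => /eqP.
by rewrite mulf_eq0 invr_eq0 (negbTE Dq) (negbTE hq).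
Qed.

Lemma boundary_defect i p : dom (A i) p -> ~ Mring mu p ->
  (Jglue i p - w_adjoint w Jglue i p) *m (Jglue i p - w_adjoint w Jglue i p) = (- 4)%:M.
Proof.
move=> ip nR.
have Wp := crd_imgT ip.
have [hk Dk ek h0k] := Ck_on_defect 0 i.
have Jk := Ck_on_Jglue 0 i; have ak := Ck_on_adjoint hM Jk.
have sk := Ck_on_add (@oW i) Jk (Ck_on_opp (@oW i) ak).
(* On the open part [e = a D], which says nothing about the limit of [e] while [a] is uncontrolled;
   the identity for its square is closed and forces [e = 0] where [D = 0]. *)
have e2 : e i p * e i p = h i p * D i p.
  apply: (@ring_density _ _ _ _ _ _ hM i R (fun q => e i q * e i q) (fun q => h i q * D i q)
    p ip ((Ck_on_mul (@oW i) ek ek).1 _ Wp) ((Ck_on_mul (@oW i) hk Dk).1 _ Wp)).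
  by move=> q iq Rq; have [_ _ <- _] := ring_identities iq Rq; rewrite expr2.
have e0 : e i p = 0.
  by apply/eqP; rewrite -sqrf_eq0 expr2 e2 (boundary_D ip nR) mulr0.
have hh : h0 i p = 0.
  by rewrite /h0 e0 (boundary_D ip nR) (boundary_h ip nR) !mulr0 !addr0 mul0r.
have rk : Ck_on 0 (W i) (fun x => (- 4 * (1 - h0 i (par (A i) x)))%:M : 'M[R]_4).
  apply/(Ck_on_mxP 0 _ (@oW i)) => a b; under eq_fun do rewrite mxE.
  case: (a == b); last exact: Ck_on_cst.
  apply: (Ck_on_mul (@oW i)); first exact: Ck_on_cst.
  apply: (Ck_on_add (@oW i)); first exact: Ck_on_cst.
  exact: (Ck_on_opp (@oW i) h0k).
have E := @ring_density _ _ _ _ _ _ hM i _ (fun q => (Jglue i q - w_adjoint w Jglue i q)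
  *m (Jglue i q - w_adjoint w Jglue i q)) (fun q => (- 4 * (1 - h0 i q))%:M) p ip
  ((Ck_on_mulmx (@oW i) sk sk).1 _ Wp) (rk.1 _ Wp).
rewrite [LHS]E; first by rewrite hh subr0 mulr1.
by move=> q iq Rq; have [_ _ _ ->] := ring_identities iq Rq.
Qed.

End Glued.

(** Moving from the null vector [v] along [u], the form becomes [t s + t^2 c]; it stays nonnegative
    for all [t] only if the linear coefficient [s] is 0. The sum [B + B^T] appears because [B] is
    not assumed symmetric. *)
Lemma psd_kernel (R : realFieldType) n (B : 'M[R]_n) (v : 'rV[R]_n) :
  (forall u : 'rV[R]_n, 0 <= (u *m B *m u^T) 0 0) -> (v *m B *m v^T) 0 0 = 0 ->
  (B + B^T) *m v^T = 0.
Proof.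
move=> psd v0; apply/colP => a; rewrite [RHS]mxE.
pose q (x y : 'rV[R]_n) := (x *m B *m y^T) 0 0.
pose u : 'rV[R]_n := delta_mx 0 a.
have qT x y : (x *m B^T *m y^T) 0 0 = q y x.
  by rewrite -[x *m B^T *m y^T]trmxK [LHS]mxE !trmx_mul !trmxK mulmxA.
have -> : ((B + B^T) *m v^T) a 0 = q u v + q v u.
  transitivity ((u *m ((B + B^T) *m v^T)) 0 0); first by rewrite -rowE [RHS]mxE.
  by rewrite mulmxA mulmxDr mulmxDl mxE qT.
set s := _ + _; pose c := q u u.
have c0 : 0 <= c by exact: psd.
have qE t : q (v + t *: u) (v + t *: u) = t * s + t ^+ 2 * c.
  have qD x y z : q x (y + t *: z) = q x y + t * q x z.
    by rewrite /q linearD linearZ /= mulmxDr -scalemxAr mxE [X in _ + X]mxE.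
  have qDl x y z : q (y + t *: z) x = q y x + t * q z x.
    by rewrite /q 2!mulmxDl -2!scalemxAl mxE [X in _ + X]mxE.
  rewrite qD !qDl [q v v]v0 /s /c; ring.
apply/eqP; apply: contraT => s0.
(* With this [t] the value is [- (s / (c + 1))^2]; the denominator [c + 1] is positive even when
   [c = 0]. *)
have := psd (v + (- s / (c + 1)) *: u); rewrite -/(q _ _) qE.
have c1 : 0 < c + 1 by rewrite ltr_wpDl.
have -> : - s / (c + 1) * s + (- s / (c + 1)) ^+ 2 * c = - (s / (c + 1)) ^+ 2.
  by field; rewrite gt_eqF.
rewrite oppr_ge0 => /le_gtF; rewrite lt_def sqr_ge0 andbT sqrf_eq0 mulf_eq0 (negbTE s0) invr_eq0.
by rewrite gt_eqF.
Qed.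

(** * Integrability passes to the closure *)

Section Closure.
Variables (R : realType) (M : topologicalType) (A : atlas R M 4).
Variables (w : components A 'M[R]_4) (rho : 'rV[R]_2 -> M -> M).
Variables (mu : M -> 'rV[R]_2) (hM : symplectic_toric w rho mu).

Lemma continuous_at_chart i p (T : topologicalType) (F : 'rV[R]_4 -> T) :
  dom (A i) p -> continuous_at (crd (A i) p) F -> continuous_at p (fun q => F (crd (A i) q)).
Proof.
by move=> ip cF; apply: (@continuous_comp _ _ _ (crd (A i)) F) => //; exact: crd_continuous.
Qed.

Lemma continuous_at_par i p (T : topologicalType) (f : M -> T) :
  dom (A i) p -> continuous_at (crd (A i) p) (fun x => f (par (A i) x)) -> continuous_at p f.
Proof.
move=> ip cf; apply: (continuous_at_near _ (continuous_at_chart ip cf)).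
have : nbhs p (dom (A i)) by apply: open_nbhs_nbhs; split=> //; exact: dom_open.
by apply: filterS => q iq; rewrite crdK.
Qed.

Lemma manifold_density (V : normedModType R) (f g : M -> V) (N : set M) p :
  nbhs p N -> continuous_at p f -> continuous_at p g ->
  (forall q, N q -> Mring mu q -> f q = g q) -> f p = g p.
Proof.
move=> Np cf cg fg; apply: contrapT => nfg.
have cfg : continuous_at p (fun y => f y - g y) by apply: continuousB.
have fgp : nbhs (f p - g p) (~` [set (0 : V)]).
  apply: open_nbhs_nbhs; split; last by move=> /= /eqP; rewrite subr_eq0 => /eqP.
  apply: closed_openC; apply: accessible_closed_set1.
  by apply: hausdorff_accessible; exact: norm_hausdorff.
have H : nbhs p (N `&` [set y | f y - g y <> 0]) by apply: filterI Np _; exact: cfg _ fgp.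
have [q [Nq /= fgq] Rq] := Mring_dense_nbhs hM H.
by apply: fgq; rewrite fg // subrr.
Qed.

Lemma nonneg_density (f : M -> R) (N : set M) p :
  nbhs p N -> continuous_at p f ->
  (forall q, N q -> Mring mu q -> 0 <= f q) -> 0 <= f p.
Proof.
move=> Np cf f0.
(* Nonnegativity is turned into the equation between [f] and its absolute value, to which density
   applies. *)
have -> : f p = `|f p|; last exact: normr_ge0.
apply: (@manifold_density R f (fun q => `|f q|) N p Np cf).
  by apply: (@continuous_comp _ _ _ f Num.norm) => //; exact: norm_continuous.
by move=> q Nq Rq; rewrite ger0_norm // f0.
Qed.

Lemma nbhs_dom i p : dom (A i) p -> nbhs p (dom (A i)).
Proof. by move=> ip; apply: open_nbhs_nbhs; split=> //; exact: dom_open. Qed.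

Lemma continuous_mulmx (T : topologicalType) m n l (f : T -> 'M[R]_(m, n))
    (g : T -> 'M[R]_(n, l)) x :
  continuous_at x f -> continuous_at x g -> continuous_at x (fun y => f y *m g y).
Proof.
move=> cf cg; apply: continuous_mx => a b.
have E : (fun y => (f y *m g y) a b) = fun y => \sum_j f y a j * g y j b.
  by apply/funext => y; rewrite mxE.
rewrite E; elim: (index_enum _) => [|j r IH].
  by under eq_fun do rewrite big_nil; exact: cst_continuous.
under eq_fun do rewrite big_cons; apply: continuousD IH.
by apply: continuousM; exact: continuous_entry.
Qed.

Lemma lie_bracket_congr (X X' Y Y' : components A 'rV[R]_4) i q (O : set M) :
  open O -> O q -> dom (A i) q ->
  (forall q', O q' -> dom (A i) q' -> X i q' = X' i q' /\ Y i q' = Y' i q') ->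
  lie_bracket X Y i q = lie_bracket X' Y' i q.
Proof.
move=> oO Oq iq E; rewrite /lie_bracket.
have [-> ->] := E q Oq iq.
have nO : nbhs q O by exact: open_nbhs_nbhs.
have NX : \forall x \near crd (A i) q, (X i \o par (A i)) x = (X' i \o par (A i)) x.
  by have := par_nbhs iq nO; apply: filterS => x [ix [_ Ox]]; have [] := E _ Ox ix.
have NY : \forall x \near crd (A i) q, (Y i \o par (A i)) x = (Y' i \o par (A i)) x.
  by have := par_nbhs iq nO; apply: filterS => x [ix [_ Ox]]; have [] := E _ Ox ix.
exact: (congr2 (fun a b => a - b) (near_eq_derive _ NY) (near_eq_derive _ NX)).
Qed.

Lemma lie_bracket_continuous (X Y : components A 'rV[R]_4) i p (O : set M) :
  open O -> O p -> dom (A i) p ->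
  Ck_on 1 (crd (A i) @` (dom (A i) `&` O)) (X i \o par (A i)) ->
  Ck_on 1 (crd (A i) @` (dom (A i) `&` O)) (Y i \o par (A i)) ->
  continuous_at p (lie_bracket X Y i).
Proof.
move=> oO Op ip X1 Y1.
pose D := crd (A i) @` (dom (A i) `&` O).
have oD : open D by exact: open_crd_img.
have Dp : D (crd (A i) p) by exact: crd_img.
have N : nbhs p (dom (A i) `&` O) by apply: filterI; [exact: nbhs_dom|exact: open_nbhs_nbhs].
have H (Z1 Z2 : components A 'rV[R]_4) : Ck_on 1 D (Z1 i \o par (A i)) ->
    Ck_on 1 D (Z2 i \o par (A i)) ->
    continuous_at p (fun q => 'D_(Z1 i q) (Z2 i \o par (A i)) (crd (A i) q)).
  move=> C1 C2.
  have c1 : continuous_at p (Z1 i) := continuous_at_par ip (C1.1 _ Dp).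
  have c2 : continuous_at p (fun q => 'J (Z2 i \o par (A i)) (crd (A i) q)).
    exact: (continuous_at_chart ip ((Ck_on_jacobian oD C2).1 _ Dp)).
  apply: (continuous_at_near _ (continuous_mulmx c1 c2)).
  apply: filterS N => q [iq Oq].
  have dZ := C1_differentiable oD (crd_img iq Oq) C2.
  exact: (esym (deriveEjacobian _ dZ)).
exact: (continuousB (H X Y X1 Y1) (H Y X Y1 X1)).
Qed.

(** The test fields [X] and [Y] may live on a neighbourhood of a boundary point. For them the
    Nijenhuis expression of [J] is continuous, and near a point of the open part it is that of [J0]
    on the restricted fields, because brackets are local. *)
Lemma integrable_closure (J J0 : components A 'M[R]_4) :
  (forall i k, Ck_on k (crd (A i) @` dom (A i)) (fun x => J i (par (A i) x))) ->
  (forall i p, dom (A i) p -> Mring mu p -> J i p = J0 i p) ->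
  integrable_endo (Mring mu) J0 -> integrable_endo setT J.
Proof.
move=> Jk JJ0 iJ0 O X Y oO _ vX vY i p Op ip.
have Jc : continuous_at p (J i) := continuous_at_par ip ((Jk i 0%N).1 _ (crd_imgT ip)).
pose D := crd (A i) @` (dom (A i) `&` O).
have oD : open D by exact: open_crd_img.
have X1 : Ck_on 1 D (X i \o par (A i)) := vX.2 i 1%N.
have Y1 : Ck_on 1 D (Y i \o par (A i)) := vY.2 i 1%N.
have J1 : Ck_on 1 D (fun x => J i (par (A i) x)).
  by apply: Ck_on_sub (Jk i 1%N) => x [q [iq _] <-]; exact: crd_imgT.
have JX1 : Ck_on 1 D (endo_apply J X i \o par (A i)) := Ck_on_mulmx oD X1 J1.
have JY1 : Ck_on 1 D (endo_apply J Y i \o par (A i)) := Ck_on_mulmx oD Y1 J1.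
have b1 := lie_bracket_continuous oO Op ip JX1 JY1.
have b2 := continuous_mulmx (lie_bracket_continuous oO Op ip JX1 Y1) Jc.
have b3 := continuous_mulmx (lie_bracket_continuous oO Op ip X1 JY1) Jc.
have b4 := lie_bracket_continuous oO Op ip X1 Y1.
pose NJ q := lie_bracket (endo_apply J X) (endo_apply J Y) i q
      - lie_bracket (endo_apply J X) Y i q *m J i q
      - lie_bracket X (endo_apply J Y) i q *m J i q
      - lie_bracket X Y i q.
have cN : continuous_at p NJ by apply: continuousB b4; apply: continuousB b3; apply: continuousB b2.
have nO : nbhs p (dom (A i) `&` O) by apply: filterI; [exact: nbhs_dom|exact: open_nbhs_nbhs].
apply: (@manifold_density _ NJ (fun=> 0) _ p nO cN); first exact: cst_continuous.
move=> q [iq Oq] Rq.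
pose OR := O `&` Mring mu.
have oOR : open OR by apply: openI => //; exact: (open_Mring hM).
have sub (Z : components A 'rV[R]_4) : vector_field O Z -> vector_field OR Z.
  move=> [Z1 Z2]; split=> [i' j' q' [Oq' _]|i' k]; first exact: Z1.
  by apply: Ck_on_sub (Z2 i' k) => x [q' [iq' [Oq' _]] <-]; exists q'.
have E (Z : components A 'rV[R]_4) q' : OR q' -> dom (A i) q' -> endo_apply J Z i q' = endo_apply J0 Z i q'.
  by move=> [_ Rq'] iq'; rewrite /endo_apply JJ0.
have ORq : OR q by split.
have e1 : lie_bracket (endo_apply J X) (endo_apply J Y) i q =
    lie_bracket (endo_apply J0 X) (endo_apply J0 Y) i q.
  by apply: (lie_bracket_congr oOR ORq iq) => q' O' i'; split; exact: E.
have e2 : lie_bracket (endo_apply J X) Y i q = lie_bracket (endo_apply J0 X) Y i q.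
  by apply: (lie_bracket_congr oOR ORq iq) => q' O' i'; split; [exact: E|].
have e3 : lie_bracket X (endo_apply J Y) i q = lie_bracket X (endo_apply J0 Y) i q.
  by apply: (lie_bracket_congr oOR ORq iq) => q' O' i'; split; [|exact: E].
have K (a a' b b' c c' d : 'rV[R]_4) (m m' : 'M[R]_4) : a = a' -> b = b' -> c = c' -> m = m' ->
    a - b *m m - c *m m - d = a' - b' *m m' - c' *m m' - d by move=> -> -> -> ->.
have H0 := iJ0 OR X Y oOR (fun _ => @proj2 _ _) (sub X vX) (sub Y vY) i q ORq iq.
exact: (etrans (K _ _ _ _ _ _ _ _ _ e1 e2 e3 (JJ0 i q iq Rq)) H0).
Qed.

End Closure.

(** * The remaining conditions at the boundary *)

Section Extension.
Variables (R : realType) (M : topologicalType) (A : atlas R M 4).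
Variables (w : components A 'M[R]_4) (rho : 'rV[R]_2 -> M -> M).
Variables (mu : M -> 'rV[R]_2) (hM : symplectic_toric w rho mu).
Variables (J J0 : components A 'M[R]_4).
Hypothesis Jk : forall i k, Ck_on k (crd (A i) @` dom (A i)) (fun x => J i (par (A i) x)).
Hypothesis JJ0 : forall i p, dom (A i) p -> Mring mu p -> J i p = J0 i p.

Let Jc i p : dom (A i) p -> continuous_at p (J i).
Proof. by move=> ip; exact: (continuous_at_par ip ((Jk i 0%N).1 _ (crd_imgT ip))). Qed.

Lemma complex_closure :
  (forall i p, Mring mu p -> dom (A i) p -> J0 i p *m J0 i p = - 1%:M) ->
  forall i p, dom (A i) p -> J i p *m J i p = - 1%:M.
Proof.
move=> sq i p ip.
apply: (manifold_density hM (nbhs_dom ip) (continuous_mulmx (Jc ip) (Jc ip)) (g := fun=> - 1%:M)).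
  exact: cst_continuous.
by move=> q iq Rq; rewrite JJ0 // sq.
Qed.

Lemma trans_continuous i j p : dom (A i) p -> dom (A j) p ->
  continuous_at p (trans (A i) (A j)).
Proof.
move=> ip jp; have sij : smooth_transition (A i) (A j) := cht_transition i j.
have oO : open (crd (A i) @` (dom (A i) `&` dom (A j))) by apply: open_crd_img; exact: dom_open.
exact: (continuous_at_chart ip ((Ck_on_jacobian oO (sij 1%N)).1 _ (crd_img ip jp))).
Qed.

Lemma endo_closure : endo_field (Mring mu) J0 -> endo_field setT J.
Proof.
move=> [tJ0 _]; split; last by move=> i k; rewrite setIT; exact: Jk.
move=> i j p v _ ip jp.
have sij : smooth_transition (A i) (A j) := cht_transition i j.
rewrite !(changeE _ sij ip jp).
have cv : continuous_at p (fun=> v : 'rV[R]_4) by exact: cst_continuous.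
have ct := trans_continuous ip jp.
have nN : nbhs p (dom (A i) `&` dom (A j)) by apply: filterI; exact: nbhs_dom.
apply: (manifold_density hM nN (continuous_mulmx (continuous_mulmx cv (Jc ip)) ct)
  (continuous_mulmx (continuous_mulmx cv ct) (Jc jp))).
move=> q [iq jq] Rq; rewrite !JJ0 //.
by have := tJ0 i j q v Rq iq jq; rewrite !(changeE _ sij iq jq).
Qed.

Lemma invariant_closure : invariant_endo rho (Mring mu) J0 -> invariant_endo rho setT J.
Proof.
have hact : smooth_action A rho by case: hM => _ [_ [? _] _ _].
move=> inv s i j p v _ _ ip jp.
rewrite !(tmapE hact _ ip jp).
have cv : continuous_at p (fun=> v : 'rV[R]_4) by exact: cst_continuous.
have oS := @open_shift_domain _ _ _ _ hact i j s.
have pS : shift_domain rho i j s (crd (A i) p) by exists p.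
have ct : continuous_at p (fun q => 'J (shift_map rho i j s) (crd (A i) q)).
  exact: (continuous_at_chart ip ((Ck_on_jacobian oS (@Ck_on_shift _ _ _ _ hact 1 i j s)).1 _ pS)).
have cJ : continuous_at p (fun q => J j (rho s q)).
  by apply: (@continuous_comp _ _ _ (rho s) (J j)); [exact: (rho_continuous hact)|exact: Jc].
have nN : nbhs p (dom (A i) `&` rho s @^-1` dom (A j)).
  by apply: filterI; [exact: nbhs_dom|exact: (rho_continuous hact (nbhs_dom jp))].
apply: (manifold_density hM nN (continuous_mulmx (continuous_mulmx cv (Jc ip)) ct)
  (continuous_mulmx (continuous_mulmx cv ct) cJ)).
move=> q [iq jq] Rq.
have Rsq : Mring mu (rho s q) by rewrite /Mring /= (mu_rho hM).
by rewrite !JJ0 // -!(tmapE hact _ iq jq); exact: inv.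
Qed.

Lemma w_continuous i p : dom (A i) p -> continuous_at p (w i).
Proof. by move=> ip; exact: (continuous_at_par ip ((Ck_on_w hM 0 i).1 _ (crd_imgT ip))). Qed.

Lemma tamed_closure : tamed w (Mring mu) J0 ->
  (forall i p, dom (A i) p -> ~ Mring mu p ->
     (J i p - w_adjoint w J i p) *m (J i p - w_adjoint w J i p) = (- 4)%:M) ->
  tamed w setT J.
Proof.
move=> tJ0 defect i p v _ ip v0.
have [Rp|nRp] := pselect (Mring mu p); first by rewrite JJ0 //; exact: tJ0.
have bE q u : bil (w i q) u (u *m J i q) = (u *m (w i q *m (J i q)^T) *m u^T) 0 0.
  by rewrite /bil trmx_mul !mulmxA.
have psd (u : 'rV[R]_4) : 0 <= (u *m (w i p *m (J i p)^T) *m u^T) 0 0.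
  have ce (z : 'rV[R]_4) : continuous_at p (fun=> z) by exact: cst_continuous.
  have cJT : continuous_at p (fun q => (J i q)^T).
    apply: continuous_mx => a b; under eq_fun do rewrite mxE.
    exact: continuous_entry (Jc ip).
  have cu : continuous_at p (fun=> u^T : 'cV[R]_4) by exact: cst_continuous.
  have c := @continuous_entry R M 1 1 _ p 0 0 (continuous_mulmx (continuous_mulmx (ce u) (continuous_mulmx (w_continuous ip) cJT)) cu).
  apply: (nonneg_density hM (nbhs_dom ip) c) => q iq Rq.
  rewrite -bE; have [->|u0] := eqVneq u 0; first by rewrite /bil !mul0mx mxE.
  by rewrite (JJ0 iq Rq); exact: ltW (tJ0 i q u Rq iq u0).
rewrite bE lt_def psd andbT; apply: contraNN v0 => /eqP bv.
(* A null vector of the semidefinite form lies in the kernel of its symmetrization, which is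
   [-(J - adj J) w]; by the defect identity that is invertible. *)
have := psd_kernel psd bv.
have wU := w_unit hM ip; have wT := w_skew hM ip.
have -> : w i p *m (J i p)^T + (w i p *m (J i p)^T)^T = - (J i p - w_adjoint w J i p) *m w i p.
  have aw : w_adjoint w J i p *m w i p = w i p *m (J i p)^T.
    apply: oppr_inj; rewrite -mulmxN -wT /w_adjoint !trmx_mul trmx_inv mulmxA mulmxKV ?unitmx_tr //.
    by rewrite wT mulNmx.
  by rewrite trmx_mul trmxK wT mulmxN opprB mulmxBl aw.
rewrite -mulmxA mulNmx => /eqP; rewrite oppr_eq0 => /eqP E.
have E2 : (J i p - w_adjoint w J i p) *m ((J i p - w_adjoint w J i p) *m (w i p *m v^T)) = 0.
  by rewrite E mulmx0.
move: E2; rewrite mulmxA defect // mul_scalar_mx => /eqP.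
rewrite scaler_eq0 oppr_eq0 pnatr_eq0 /= => /eqP wv.
by rewrite -[v]trmxK -[v^T](mulKmx wU) wv mulmx0 trmx0.
Qed.

End Extension.

Theorem theorem10 (R : realType) (M : topologicalType) (A : atlas R M 4)
    (w : components A 'M[R]_4) (rho : 'rV[R]_2 -> M -> M)
    (mu : M -> 'rV[R]_2) (hM : symplectic_toric w rho mu)
    (xi : 'M[R]_2) (hxi : xi \in unitmx)
    (C : set (chart R M 4)) (hC : admissible_coordinates w rho mu xi C)
    (J J0 : components A 'M[R]_4) (Psi Psi0 : 'rV[R]_2 -> 'M[R]_2)
    (hJ : DGK w rho mu xi setT J)
    (hJ0 : DGK w rho mu xi (Mring mu) J0)
    (hPsi : given_by mu C J Psi)
    (hPsi0 : given_by mu C J0 Psi0)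
    (hC1 : extends_smoothly (moment_polytope mu)
             (fun x => (Psi0 x - Psi x)%R))
    (hC2 : extends_smoothly (moment_polytope mu)
             (fun x => ((Psi x)^T *m invmx (Psi0 x) *m Psi x - (Psi x)^T)%R)) :
  exists J' : components A 'M[R]_4,
    DGK w rho mu xi setT J' /\
    forall i p, dom (A i) p -> Mring mu p -> J' i p = J0 i p.
Proof.
have [G1 [sG1 hG1]] := hC1; have [G2 [sG2 hG2]] := hC2.
have [[[eJ0 sJ0] tJ0 iJ0 iJa0 invJ0] dJ0] := hJ0.
pose J' := Jglue w rho mu xi J G1 G2.
have JJ0 i p : dom (A i) p -> Mring mu p -> J' i p = J0 i p.
  exact: (Jglue_ring hM hC hJ hJ0 hPsi hPsi0 hG1 hG2).
have Jk i k : Ck_on k (crd (A i) @` dom (A i)) (fun x => J' i (par (A i) x)).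
  exact: (Ck_on_Jglue hM hJ sG1 sG2).
have aJ0 i p : dom (A i) p -> Mring mu p -> w_adjoint w J' i p = w_adjoint w J0 i p.
  by move=> ip Rp; rewrite /w_adjoint JJ0.
exists J'; split; last exact: JJ0.
(* The condition on the torus directions concerns the open part only, where [J'] is [J0]. *)
split; last by move=> i p Rp ip; rewrite aJ0 // JJ0 //; exact: dJ0.
split.
- split; first exact: (endo_closure hM Jk JJ0 eJ0).
  by move=> i p _; exact: (complex_closure hM Jk JJ0 sJ0).
- apply: (tamed_closure hM Jk JJ0 tJ0) => i p.
  exact: (boundary_defect hM hxi hC hJ hJ0 hPsi hPsi0 sG1 sG2 hG1 hG2).
- exact: (integrable_closure hM Jk JJ0 iJ0).
(* The adjoint of [J'] is in turn a smooth extension of the adjoint of [J0]. *)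
- exact: (integrable_closure hM (fun i k => Ck_on_adjoint hM (Jk i k)) aJ0 iJa0).
exact: (invariant_closure hM Jk JJ0 invJ0).
Qed.
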